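(* The Hardy algebra $F^\infty(\mathcal V^{\mathbf m}_{\mathbf f,\mathcal Q_c})$ coincides with the algebra $H^\infty(\mathbf D^{\mathbf m}_{\mathbf f,>}(\mathbb C))$ of all multipliers of the Hilbert space $H^2(\mathbf D^{\mathbf m}_{\mathbf f,>}(\mathbb C))$ (under the identification of $\mathcal N_{\mathcal Q_c}$ with $H^2(\mathbf D^{\mathbf m}_{\mathbf f,>}(\mathbb C))$).
   Context: Fix $k\ge 1$ and $(n_1,\dots,n_k)$, $\mathbf m=(m_1,\dots,m_k)$ in $\mathbb N^k$, $\mathbb N=\{1,2,\dots\}$, $\mathbb N_0=\{0,1,\dots\}$. $\mathbb F^+_{n_i}$ is the free unital semigroup on generators $g^i_1,\dots,g^i_{n_i}$ with identity $g^i_0$; $|\alpha|$ is word length. For a tuple $X_i=(X_{i,1},\dots,X_{i,n_i})$ (operators or scalars) and $\alpha=g^i_{j_1}\cdots g^i_{j_p}$ put $X_{i,\alpha}=X_{i,j_1}\cdots X_{i,j_p}$, $X_{i,g^i_0}=I$. $\mathbb C[Z_{i,j}]$ is the algebra of polynomials in indeterminates $Z_{i,j}$, where $Z_{i,1},\dots,Z_{i,n_i}$ are noncommuting and $Z_{s,j},Z_{t,l}$ commute for $s\ne t$. $\mathbf f=(f_1,\dots,f_k)$, where each $f_i=\sum_{\alpha\in\mathbb F^+_{n_i}}a_{i,\alpha}Z_{i,\alpha}$ is a positive regular free holomorphic function: $a_{i,\alpha}\ge0$, $a_{i,g^i_0}=0$, $a_{i,g^i_j}>0$ for $1\le j\le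 n_i$, and $\limsup_{p\to\infty}(\sum_{|\alpha|=p}|a_{i,\alpha}|^2)^{1/2p}<\infty$. $F^2(H_{n_i})=\mathbb C1\oplus\bigoplus_{p\ge1}H_{n_i}^{\otimes p}$ is the full Fock space over an $n_i$-dimensional Hilbert space, with orthonormal basis $\{e^i_\alpha\}_{\alpha\in\mathbb F^+_{n_i}}$, $e^i_{g^i_0}=1$. Set $b^{(m_i)}_{i,g^i_0}=1$ and $b^{(m_i)}_{i,\alpha}=\sum_{p=1}^{|\alpha|}\sum_{\gamma_1\cdots\gamma_p=\alpha,\,|\gamma_s|\ge1}a_{i,\gamma_1}\cdots a_{i,\gamma_p}\binom{p+m_i-1}{m_i-1}$ for $|\alpha|\ge1$; $W_{i,j}e^i_\alpha=\sqrt{b^{(m_i)}_{i,\alpha}/b^{(m_i)}_{i,g^i_j\alpha}}\;e^i_{g^i_j\alpha}$; $\mathbf W_{i,j}=I\otimes\cdots\otimes W_{i,j}\otimes\cdots\otimes I$ ($i$-th factor) on $\otimes_{i=1}^kF^2(H_{n_i})$. $\mathcal Q_c$ is the left ideal of $\mathbb C[Z_{i,j}]$ generated by all $Z_{i,j_1}Z_{i,j_2}-Z_{i,j_2}Z_{i,j_1}$; $\mathcal M_{\mathcal Q_c}$ is the closed linear span of the ranges of $g(\mathbf W)$, $g\in\mathcal Q_c$; $\mathcal N_{\mathcal Q_c}=[\otimes_iF^2(H_{n_i})]\ominus\mathcal M_{\mathcal Q_c}$; $\mathbf L_{i,j}=P_{\mathcal N_{\mathcal Q_c}}\mathbf W_{i,j}|_{\mathcal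 N_{\mathcal Q_c}}$. $F^\infty(\mathcal V^{\mathbf m}_{\mathbf f,\mathcal Q_c})\subset B(\mathcal N_{\mathcal Q_c})$ is the WOT-closed algebra generated by all $\mathbf L_{i,j}$ and the identity. $\mathbf D^{\mathbf m}_{\mathbf f,>}(\mathbb C)=\{\lambda=(\lambda_1,\dots,\lambda_k)\in\mathbb C^{n_1}\times\cdots\times\mathbb C^{n_k}:\sum_{|\alpha|\ge1}a_{i,\alpha}|\lambda_{i,\alpha}|^2<1\text{ for each }i\}$. For $\mathbf k_i\in\mathbb N_0^{n_i}$: $\lambda_i^{\mathbf k_i}=\lambda_{i,1}^{k_{i,1}}\cdots\lambda_{i,n_i}^{k_{i,n_i}}$, $\Lambda_{\mathbf k_i}=\{\alpha\in\mathbb F^+_{n_i}:\lambda_{i,\alpha}=\lambda_i^{\mathbf k_i}\ \forall\lambda_i\in\mathbb C^{n_i}\}$, $\gamma^{(m_i)}_{\mathbf k_i}=\sum_{\alpha\in\Lambda_{\mathbf k_i}}b^{(m_i)}_{i,\alpha}$. $H^2(\mathbf D^{\mathbf m}_{\mathbf f,>}(\mathbb C))$ is the Hilbert space of functions $\varphi(\lambda)=\sum c_{\mathbf k_1,\dots,\mathbf k_k}\lambda_1^{\mathbf k_1}\cdots\lambda_k^{\mathbf k_k}$ on $\mathbf D^{\mathbf m}_{\mathbf f,>}(\mathbb C)$ with $\|\varphi\|_2^2=\sum|c_{\mathbf k_1,\dots,\mathbf k_k}|^2/(\gamma^{(m_1)}_{\mathbf k_1}\cdots\gamma^{(m_k)}_{\mathbf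 k_k})<\infty$. The identification of $\mathcal N_{\mathcal Q_c}$ with this space is the unitary sending $\varphi\in\mathcal N_{\mathcal Q_c}$ to the function $\lambda\mapsto\langle\varphi,u_\lambda\rangle$, where $u_\lambda=\sum_{\beta_1,\dots,\beta_k}\overline{\lambda}_{1,\beta_1}\cdots\overline{\lambda}_{k,\beta_k}\sqrt{b^{(m_1)}_{1,\beta_1}}\cdots\sqrt{b^{(m_k)}_{k,\beta_k}}\,e^1_{\beta_1}\otimes\cdots\otimes e^k_{\beta_k}$. A multiplier of $H^2$ is a function $\psi$ on $\mathbf D^{\mathbf m}_{\mathbf f,>}(\mathbb C)$ with $\psi\varphi\in H^2$ for every $\varphi\in H^2$, identified with the (bounded) operator $M_\psi\varphi=\psi\varphi$. *)

(* Defs.v *)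
From HB Require Import structures.
From mathcomp Require Import all_boot all_order all_algebra.
From mathcomp Require Import complex finmap monalg.
From mathcomp Require Import boolp classical_sets functions cardinality fsbigop.
From mathcomp Require Import reals ereal topology normedtype sequences esum exp.
From mathcomp Require Import numfun ring lra.

Set Implicit Arguments.
Unset Strict Implicit.
Unset Printing Implicit Defensive.

Import Order.TTheory GRing.Theory Num.Theory.

Local Open Scope classical_set_scope.
Local Open Scope complex_scope.
Local Open Scope ring_scope.

Section Sums.
Context {R : realType} {J : choiceType}.
Implicit Types (f g : J -> R) (h : J -> R[i]).

(** The sum of an absolutely summable real family. *)
Definition rsum f : R :=
  fine (\esum_(j in setT) (EFin \o f)^\+ j
        - \esum_(j in setT) (EFin \o f)^\- j)%E.

Definition csum h : R[i] :=
  rsum (fun j => complex.Re (h j)) +i* rsum (fun j => complex.Im (h j)).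

Definition sqmod (z : R[i]) : R := complex.Re z ^+ 2 + complex.Im z ^+ 2.

Definition rsummable f := summable [set: J] (EFin \o f).

Definition csummable h :=
  rsummable (fun j => complex.Re (h j)) /\ rsummable (fun j => complex.Im (h j)).

Lemma esumZ (c : R) f : 0 <= c -> (forall j, 0 <= f j) ->
  (\esum_(j in [set: J]) (c * f j)%:E = c%:E * \esum_(j in [set: J]) (f j)%:E)%E.
Proof.
have le (d : R) (g : J -> R) : 0 <= d -> (forall j, 0 <= g j) ->
  (\esum_(j in [set: J]) (d * g j)%:E <= d%:E * \esum_(j in [set: J]) (g j)%:E)%E.
  move=> d0 g0; rewrite ge_ereal_sup//= => _ [X [finX _]] <-.
  under eq_fsbigr do rewrite EFinM.
  rewrite -ge0_mule_fsumr => [|j]; last by rewrite lee_fin.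
  by rewrite lee_wpmul2l ?lee_fin// esum_ge//; exists X.
move=> c0 f0; apply/eqP; rewrite eq_le le//=.
have [->|cn0] := eqVneq c 0.
  by rewrite mul0e esum_ge0// => j _; rewrite mul0r.
have cp : 0 < c by rewrite lt_def cn0.
rewrite -[leRHS]mul1e -(mulfV cn0) EFinM -muleA lee_wpmul2l ?lee_fin//.
apply: le_trans (le c^-1 (fun j => c * f j) _ _) => //; last 2 first.
- by rewrite invr_ge0.
- by move=> j; rewrite mulr_ge0.
by apply: le_esum => j _; rewrite mulrA mulVf// mul1r.
Qed.


Lemma rsummable_le f g : rsummable g -> (forall j, `|f j| <= g j) -> rsummable f.
Proof.
move=> sg fg; apply: le_lt_trans sg; apply: le_esum => j _ /=.
by rewrite lee_fin (le_trans (fg j))// ler_norm.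
Qed.

Lemma rsummableD f g : rsummable f -> rsummable g ->
  rsummable (fun j => f j + g j).
Proof. exact: summableD. Qed.

Lemma rsummableZ c f : rsummable f -> rsummable (fun j => c * f j).
Proof.
move=> sf; rewrite /rsummable /summable /=.
have -> : (\esum_(j in [set: J]) `|(c * f j)%:E| =
           `|c|%:E * \esum_(j in [set: J]) (`|f j|)%:E)%E.
  by rewrite -esumZ//; apply: eq_esum => j _; rewrite /= normrM.
by move: sf; rewrite /rsummable /summable => sf; rewrite lte_mul_pinfty// lee_fin.
Qed.

Lemma rsummable_abs f : rsummable f -> rsummable (fun j => `|f j|).
Proof.
by apply: le_lt_trans; apply: le_esum => j _ /=; rewrite normr_id.
Qed.

Let S f : R := fine (\esum_(j in [set: J]) (f j)%:E).

Let fin f : (forall j, 0 <= f j) -> rsummable f ->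
  (\esum_(j in [set: J]) (f j)%:E)%E \is a fin_num.
Proof.
move=> f0; rewrite /rsummable summableE => h.
rewrite (eq_esum (b := fun j => `|(EFin \o f) j|%E))// => j _ /=.
by rewrite ger0_norm.
Qed.

Let SD f g : (forall j, 0 <= f j) -> (forall j, 0 <= g j) ->
  rsummable f -> rsummable g -> S (fun j => f j + g j) = S f + S g.
Proof.
move=> f0 g0 sf sg; rewrite /S -fineD ?fin// -esumD// => j _; exact: f0 || exact: g0.
Qed.

Let SZ c f : 0 <= c -> (forall j, 0 <= f j) -> S (fun j => c * f j) = c * S f.
Proof.
move=> c0 f0; rewrite /S esumZ//.
have [->|cn0] := eqVneq c 0; first by rewrite mul0e mul0r.
have cp : 0 < c by rewrite lt_def cn0.
have : (0 <= \esum_(j in [set: J]) (f j)%:E)%E.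
  by apply: esum_ge0 => j _; rewrite lee_fin.
case: (\esum_(j in [set: J]) (f j)%:E)%E => // _.
by rewrite /= gt0_muley ?lte_fin// mulr0.
Qed.

Lemma rsum_sub f g : rsummable f -> rsummable g ->
    (forall j, 0 <= f j) -> (forall j, 0 <= g j) ->
  rsum (fun j => f j - g j) =
  fine (\esum_(j in [set: J]) (f j)%:E) - fine (\esum_(j in [set: J]) (g j)%:E).
Proof.
move=> sf sg f0 g0; rewrite /rsum.
have -> : EFin \o (fun j => f j - g j) = ((EFin \o f) \- (EFin \o g))%E by [].
rewrite esumB//=; last 2 first.
- by move=> j _; rewrite lee_fin.
- by move=> j _; rewrite lee_fin.
by rewrite fineB// fin.
Qed.

Let q0 f j : 0 <= `|f j| - f j. Proof. by rewrite subr_ge0 ler_norm. Qed.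

Let sq f : rsummable f -> rsummable (fun j => `|f j| - f j).
Proof.
move=> sf; apply: rsummableD; first exact: rsummable_abs.
by move: sf; rewrite /rsummable summableN.
Qed.

Let rsumE f : rsummable f ->
  rsum f = S (fun j => `|f j|) - S (fun j => `|f j| - f j).
Proof.
move=> sf; rewrite -rsum_sub//; [|exact: rsummable_abs|exact: sq].
by congr rsum; apply/funext => j; rewrite subKr.
Qed.

Lemma rsumD f g : rsummable f -> rsummable g ->
  rsum (fun j => f j + g j) = rsum f + rsum g.
Proof.
move=> sf sg; have [af ag] := (rsummable_abs sf, rsummable_abs sg).
have -> : (fun j => f j + g j) =
    (fun j => (`|f j| + `|g j|) - ((`|f j| - f j) + (`|g j| - g j))).
  by apply/funext => j; ring.
have s1 := rsummableD af ag; have s2 := rsummableD (sq sf) (sq sg).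
rewrite (rsum_sub s1 s2); last 2 first.
- by move=> j; rewrite addr_ge0.
- by move=> j; apply: addr_ge0; [exact: (q0 f)|exact: (q0 g)].
rewrite -/(S _) -/(S (fun j => (`|f j| - f j) + (`|g j| - g j))).
rewrite (SD (q0 f) (q0 g) (sq sf) (sq sg)) SD//.
by rewrite !rsumE//; ring.
Qed.

Lemma rsumZ c f : rsummable f -> rsum (fun j => c * f j) = c * rsum f.
Proof.
move=> sf; have af := rsummable_abs sf.
have [c0|c0] := leP 0 c.
  have -> : (fun j => c * f j) = (fun j => c * `|f j| - c * (`|f j| - f j)).
    by apply/funext => j; ring.
  rewrite (rsum_sub (rsummableZ c af) (rsummableZ c (sq sf))); last 2 first.
  - by move=> j; rewrite mulr_ge0.
  - by move=> j; apply: mulr_ge0 => //; exact: (q0 f).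
  rewrite -/(S _) -/(S (fun j => c * (`|f j| - f j))) (SZ _ (q0 f))// SZ//.
  by rewrite rsumE//; ring.
have {}c0 : 0 <= - c by rewrite oppr_ge0 ltW.
have -> : (fun j => c * f j) = (fun j => - c * (`|f j| - f j) - (- c * `|f j|)).
  by apply/funext => j; ring.
rewrite (rsum_sub (rsummableZ _ (sq sf)) (rsummableZ _ af)); last 2 first.
- by move=> j; apply: mulr_ge0 => //; exact: (q0 f).
- by move=> j; rewrite mulr_ge0.
rewrite -/(S _) -/(S (fun j => - c * `|f j|)) (SZ _ (q0 f))// SZ//.
by rewrite rsumE//; ring.
Qed.

Lemma csum_linear (c : R[i]) h1 h2 : csummable h1 -> csummable h2 ->
  csum (fun j => c * h1 j + h2 j) = c * csum h1 + csum h2.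
Proof.
case: c => c d [r1 i1] [r2 i2]; rewrite /csum.
have -> : (fun j => complex.Re ((c +i* d) * h1 j + h2 j)) =
    (fun j => (c * complex.Re (h1 j) + (- d) * complex.Im (h1 j))
              + complex.Re (h2 j)).
  by apply/funext => j; case: (h1 j) (h2 j) => ? ? [? ?] /=; ring.
have -> : (fun j => complex.Im ((c +i* d) * h1 j + h2 j)) =
    (fun j => (c * complex.Im (h1 j) + d * complex.Re (h1 j))
              + complex.Im (h2 j)).
  by apply/funext => j; case: (h1 j) (h2 j) => ? ? [? ?] /=; ring.
have Zr e := rsummableZ e r1; have Zi e := rsummableZ e i1.
rewrite !rsumD//; [|exact: rsummableD|exact: rsummableD].
by rewrite !rsumZ//; apply/eqP; rewrite eq_complex /=; apply/andP; split;
  apply/eqP; ring.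
Qed.

End Sums.

Section L2.
Context {R : realType}.
Variable I : choiceType.
Local Notation C := R[i].

Definition l2pred : {pred I -> C} :=
  fun x => (\esum_(i in [set: I]) (sqmod (x i))%:E < +oo)%E.

(** The inner product, linear in its first argument. *)
Definition fdot (x y : I -> C) : C := csum (fun i => x i * (y i)^*).

Lemma sqmod_ge0 (z : C) : 0 <= sqmod z.
Proof. by rewrite /sqmod addr_ge0// sqr_ge0. Qed.

Lemma l2predE (x : I -> C) : (x \in l2pred) <-> rsummable (fun i => sqmod (x i)).
Proof.
rewrite /rsummable /summable /=.
rewrite (eq_esum (b := fun j => (sqmod (x j))%:E))// => j _.
by rewrite ger0_norm// sqmod_ge0.
Qed.

Lemma l2_submod_closed : submod_closed l2pred.
Proof.
split.
  apply/l2predE; apply: (@rsummable_le _ _ _ (fun=> 0)).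
    by rewrite /rsummable /summable esum1 ?ltry// => i _ /=; rewrite normr0.
  by move=> i; rewrite /sqmod/= expr0n/= addr0 normr0.
move=> a x y /l2predE lx /l2predE ly; apply/l2predE.
apply: (@rsummable_le _ _ _
  (fun i => 2 * sqmod a * sqmod (x i) + 2 * sqmod (y i))).
  by apply: rsummableD; exact: rsummableZ.
move=> i; rewrite ger0_norm ?sqmod_ge0//.
have -> : (a *: x + y) i = a * x i + y i by [].
case: a (x i) (y i) => a b [c d] [e f]; rewrite /sqmod /=.
set u := a * c - b * d; set v := a * d + b * c.
have -> : 2 * (a ^+ 2 + b ^+ 2) * (c ^+ 2 + d ^+ 2) = 2 * (u ^+ 2 + v ^+ 2).
  by rewrite /u /v; ring.
rewrite -subr_ge0 (_ : _ - _ = (u - e) ^+ 2 + (v - f) ^+ 2).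
  by rewrite addr_ge0 ?sqr_ge0.
by ring.
Qed.

HB.instance Definition _ := GRing.isSubmodClosed.Build C (I -> C) l2pred
  l2_submod_closed.

Definition l2 := {x : I -> C | x \in l2pred}.
HB.instance Definition _ := SubChoice.on l2.
HB.instance Definition _ := [SubChoice_isSubLmodule of l2 by <:].

Definition dot (x y : l2) : C := fdot (\val x) (\val y).

Definition l2norm (x : l2) : R :=
  Num.sqrt (fine (\esum_(i in [set: I]) (sqmod (\val x i))%:E)).

Lemma csummable_dot (x y : l2) : csummable (fun i => \val x i * (\val y i)^*).
Proof.
have sx : rsummable (fun i => sqmod (\val x i)) by apply/l2predE/(valP x).
have sy : rsummable (fun i => sqmod (\val y i)) by apply/l2predE/(valP y).
have sxy := rsummableD sx sy.
split; apply: (rsummable_le sxy) => i;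
  case: (\val x i) (\val y i) => a b [c d]; rewrite /sqmod /= ler_norml;
  apply/andP; split.
- have : 0 <= (a + c) ^+ 2 + (b + d) ^+ 2 by rewrite addr_ge0 ?sqr_ge0.
  have : 0 <= a ^+ 2 + b ^+ 2 + c ^+ 2 + d ^+ 2 by rewrite !addr_ge0 ?sqr_ge0.
  nra.
- have : 0 <= (a - c) ^+ 2 + (b - d) ^+ 2 by rewrite addr_ge0 ?sqr_ge0.
  have : 0 <= a ^+ 2 + b ^+ 2 + c ^+ 2 + d ^+ 2 by rewrite !addr_ge0 ?sqr_ge0.
  nra.
- have : 0 <= (a - d) ^+ 2 + (b + c) ^+ 2 by rewrite addr_ge0 ?sqr_ge0.
  have : 0 <= a ^+ 2 + b ^+ 2 + c ^+ 2 + d ^+ 2 by rewrite !addr_ge0 ?sqr_ge0.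
  nra.
- have : 0 <= (a + d) ^+ 2 + (b - c) ^+ 2 by rewrite addr_ge0 ?sqr_ge0.
  have : 0 <= a ^+ 2 + b ^+ 2 + c ^+ 2 + d ^+ 2 by rewrite !addr_ge0 ?sqr_ge0.
  nra.
Qed.

Lemma dot_linear (c : C) (x y z : l2) :
  dot (c *: x + y) z = c * dot x z + dot y z.
Proof.
rewrite /dot /fdot -csum_linear; [|exact: csummable_dot|exact: csummable_dot].
congr csum; apply/funext => i.
have -> : \val (c *: x + y) i = c * \val x i + \val y i by [].
by ring.
Qed.

Definition orthopred (A : set l2) : {pred l2} :=
  fun x => `[< forall y, A y -> dot x y = 0 >].

Lemma ortho_submod_closed (A : set l2) : submod_closed (orthopred A).
Proof.
have dot0 y : dot 0 y = 0.
  have := dot_linear 1 0 0 y; rewrite scaler0 addr0 mul1r => /eqP.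
  by rewrite -subr_eq0 opprD addrA subrr sub0r oppr_eq0 => /eqP.
split; first by apply/asboolP => y _; exact: dot0.
move=> c x y /asboolP Ax /asboolP Ay; apply/asboolP => z Az.
by rewrite dot_linear Ax// Ay// mulr0 addr0.
Qed.

HB.instance Definition _ (A : set l2) :=
  GRing.isSubmodClosed.Build C l2 (orthopred A) (ortho_submod_closed A).

Definition orthoc (A : set l2) := {x : l2 | x \in orthopred A}.
HB.instance Definition _ (A : set l2) := SubChoice.on (orthoc A).
HB.instance Definition _ (A : set l2) := [SubChoice_isSubLmodule of orthoc A by <:].

End L2.
Arguments l2 : clear implicits.
Arguments orthoc {R I} A.

Section Generated.
Context {R : realType}.
Local Notation C := R[i].

Definition subspace (V : lmodType C) (A : set V) : Prop :=
  A 0 /\ forall (c : C) (x y : V), A x -> A y -> A (c *: x + y).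

Definition lspan (V : lmodType C) (A : set V) : set V := smallest (@subspace V) A.

Definition left_ideal (P : pzRingType) (A : set P) : Prop :=
  A 0 /\ forall p x y : P, A x -> A y -> A (p * x + y).

Definition l2closure (I : choiceType) (A : set (l2 R I)) : set (l2 R I) :=
  [set y | forall e : R, 0 < e -> exists2 x, A x & l2norm (y - x) < e].

Section Operators.
Context {I : choiceType} {A : set (l2 R I)}.
Local Notation H := (orthoc A).

Definition bounded_op (T : H -> H) : Prop :=
  linear T /\
  exists M : R, forall x : H, l2norm (\val (T x)) <= M * l2norm (\val x).

(** [s] lists the pairs of vectors, and [e] the radius, of a basic
    neighbourhood of [T] in the weak operator topology. *)
Definition wot_closed (B : set (H -> H)) : Prop :=
  forall T, bounded_op T ->
    (forall (s : seq (H * H)) (e : R), 0 < e ->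
      exists2 S, B S & forall p, p \in s ->
        `|dot (\val (T p.1 - S p.1)) (\val p.2)| < e%:C) ->
    B T.

Definition wot_subalgebra (B : set (H -> H)) : Prop :=
  [/\ B `<=` bounded_op, subspace B,
      (forall S T, B S -> B T -> B (S \o T)) & wot_closed B].

(** The orthogonal projection onto [H]: since [H] is closed, the default value
    of [xget] is not used when [x] is square summable. *)
Definition proj (x : I -> C) : H :=
  xget 0 [set p : H | forall z : H,
    fdot (x - \val (\val p)) (\val (\val z)) = 0].

End Operators.
End Generated.

Section Words.
Context {R : realType} {n : nat}.
Local Notation word := (seq 'I_n).
Implicit Types (a : word -> R) (m : nat).

Definition positive_regular a : Prop :=
  [/\ forall w, 0 <= a w, a [::] = 0, forall j, 0 < a [:: j] &
      (limn_esup (fun p => ((\sum_(w : p.-tuple 'I_n) `|a w| ^+ 2)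
                              `^ ((2 * p)%:R^-1))%:E) < +oo)%E].

(** The inner sum runs over the factorizations of [w] into [p] nonempty words;
    their factors have length at most [size w], which makes it a sum over a
    finite type. *)
Definition bcoef m a (w : word) : R :=
  if nilp w then 1 else
  \sum_(1 <= p < (size w).+1)
    \sum_(g : p.-tuple {bseq (size w) of 'I_n} |
        (flatten [seq bseqval u | u <- g] == w)
        && all (fun u : {bseq (size w) of 'I_n} => 0 < size u)%N g)
      (\prod_(u <- g) a u) * 'C(p + m - 1, m - 1)%:R.

Definition wordprod (z : 'I_n -> R[i]) (w : word) : R[i] := \prod_(j <- w) z j.

Definition monomial (z : 'I_n -> R[i]) (q : {ffun 'I_n -> nat}) : R[i] :=
  \prod_j z j ^+ q j.

Definition Lambda (q : {ffun 'I_n -> nat}) : set word :=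
  [set w | forall z : 'I_n -> R[i], wordprod z w = monomial z q].

(** A finite sum: the words in [Lambda q] all have length [\sum_j q j]. *)
Definition gammacoef m a (q : {ffun 'I_n -> nat}) : R :=
  \sum_(w \in Lambda q) bcoef m a w.

End Words.

(** [mword n] is the product of the free semigroups on [n i] generators. It
    indexes both the monomials of [C[Z_{i,j}]] and the orthonormal basis of the
    tensor product of the Fock spaces. *)
Section MultiWords.
Context {k : nat}.
Variable n : 'I_k -> nat.

Definition mword := {dffun forall i : 'I_k, seq 'I_(n i)}.
HB.instance Definition _ := Choice.on mword.

Definition mword1 : mword := [ffun i => [::]].
Definition mword_cat (v w : mword) : mword := [ffun i => v i ++ w i].

Lemma mword_catA : associative mword_cat.
Proof. by move=> u v w; apply/ffunP => i; rewrite !ffunE catA. Qed.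
Lemma mword_1cat : left_id mword1 mword_cat.
Proof. by move=> w; apply/ffunP => i; rewrite !ffunE. Qed.
Lemma mword_cat1 : right_id mword1 mword_cat.
Proof. by move=> w; apply/ffunP => i; rewrite !ffunE cats0. Qed.
Lemma mword_cat_eq1 (v w : mword) :
  mword_cat v w = mword1 -> v = mword1 /\ w = mword1.
Proof.
move=> vw; split; apply/ffunP => i;
  by have /ffunP/(_ i) := vw; rewrite !ffunE; case: (v i) (w i) => [|? ?] [].
Qed.

HB.instance Definition _ := Choice_isMonomialDef.Build mword
  mword_catA mword_1cat mword_cat1 mword_cat_eq1.

Definition upd (w : mword) (i : 'I_k) (v : seq 'I_(n i)) : mword :=
  [ffun i' => dfwith w v i'].

Context {R : realType}.
Local Notation P := {malg R[i][mword]}.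

Definition Zvar (i : 'I_k) (j : 'I_(n i)) : P := << upd mword1 [:: j] >>.

Definition Qc : set P :=
  smallest (@left_ideal P)
    [set g | exists i (j1 j2 : 'I_(n i)),
       g = Zvar j1 * Zvar j2 - Zvar j2 * Zvar j1].

End MultiWords.

Section Model.
Context {R : realType} {k : nat} {n : 'I_k -> nat}.
Variables (m : 'I_k -> nat) (a : forall i, seq 'I_(n i) -> R).
Local Notation C := R[i].
Local Notation mword := (mword n).

(** The tensor product of the Fock spaces is [l2 R mword], its orthonormal basis
    being the family of the [delta w]. *)
Definition delta (w : mword) : mword -> C := fun v => (v == w)%:R.

Definition b (i : 'I_k) (w : seq 'I_(n i)) : R := bcoef (m i) (@a i) w.

(** The weighted left creation operator, given on coordinates; see [W_delta]. *)
Definition W (i : 'I_k) (j : 'I_(n i)) (x : mword -> C) : mword -> C :=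
  fun w => if w i is j' :: v then
             if j' == j then (Num.sqrt (b v / b (j :: v)))%:C * x (upd w v)
             else 0
           else 0.

Lemma W_delta (i : 'I_k) (j : 'I_(n i)) (w : mword) :
  W j (delta w) =
  (Num.sqrt (b (w i) / b (j :: w i)))%:C *: delta (upd w (j :: w i)).
Proof.
apply/funext => v; rewrite /W /delta.
have -> : ((Num.sqrt (b (w i) / b (j :: w i)))%:C *:
             (fun v0 => (v0 == upd w (j :: w i))%:R : C)) v =
          (Num.sqrt (b (w i) / b (j :: w i)))%:C * (v == upd w (j :: w i))%:R.
  by [].
have ne u : v i = u -> u != j :: w i -> v == upd w (j :: w i) = false.
  move=> vi; apply: contraNF => /eqP e.
  by rewrite -vi e ffunE dfwith_in.
case E : (v i) => [|j' u]; first by rewrite (ne _ E)// mulr0.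
have [ej|nj] := eqVneq j' j; last first.
  by rewrite (ne _ E) ?mulr0// eqseq_cons (negbTE nj).
subst j'; have [eu|nu] := eqVneq u (w i); last first.
  rewrite (ne _ E) ?eqseq_cons ?eqxx//= mulr0.
  case: eqP => [ev|]; last by rewrite mulr0.
  by move/ffunP/(_ i): ev; rewrite ffunE dfwith_in => uw; rewrite uw eqxx in nu.
subst u; congr (_ * _%:R); congr nat_of_bool; apply/eqP/eqP => [ew|ev].
  apply/ffunP => i'; rewrite ffunE; have [<-|ii'] := eqVneq i i'.
    by rewrite dfwith_in.
  by rewrite dfwith_out// -ew ffunE dfwith_out.
apply/ffunP => i'; rewrite ffunE; have [<-|ii'] := eqVneq i i'.
  by rewrite dfwith_in.
by rewrite dfwith_out// ev ffunE dfwith_out.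
Qed.

(** The monomial [Z_w], then the polynomial [g], evaluated at [W]; the factors
    with different first indices commute, so their order is immaterial. *)
Definition Wword (w : mword) (x : mword -> C) : mword -> C :=
  foldr (fun i y => foldr (@W i) y (w i)) x (enum 'I_k).

Definition Wpoly (g : {malg C[mword]}) (x : mword -> C) : mword -> C :=
  \sum_(w <- msupp g) g@_w *: Wword w x.

Definition MQ : set (l2 R mword) :=
  l2closure (lspan [set y | exists2 g, Qc g &
                      exists x : l2 R mword, \val y = Wpoly g (\val x)]).

Definition NQ := orthoc MQ.

Definition L (i : 'I_k) (j : 'I_(n i)) (x : NQ) : NQ := proj (W j (\val (\val x))).

Definition Finfty : set (NQ -> NQ) :=
  smallest wot_subalgebra
    ([set T | exists i (j : 'I_(n i)), T = L j] `|` [set id]).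

Local Notation point := (forall i, 'I_(n i) -> C).
Local Notation mindex := {dffun forall i : 'I_k, {ffun 'I_(n i) -> nat}}.

Definition D : set point :=
  [set z | forall i, (\esum_(w in [set w | (0 < size w)%N])
                        (a w * sqmod (wordprod (z i) w))%:E < 1)%E].

(** The squared norm of the power series with coefficients [c]. *)
Definition h2norm2 (c : mindex -> C) : \bar R :=
  (\esum_(q in [set: mindex])
     (sqmod (c q) / \prod_i gammacoef (m i) (@a i) (q i))%:E)%E.

Definition has_series (f : D -> C) (c : mindex -> C) : Prop :=
  forall z : D, f z = csum (fun q : mindex => c q * \prod_i monomial (\val z i) (q i)).

Definition H2 : set (D -> C) :=
  [set f | exists2 c, (h2norm2 c < +oo)%E & has_series f c].

Definition multiplier (psi : D -> C) : Prop :=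
  forall f, H2 f -> H2 (fun z => psi z * f z).

Definition ulam (z : point) : mword -> C :=
  fun w => \prod_i ((wordprod (z i) (w i))^* * (Num.sqrt (b (w i)))%:C).

Definition U (x : NQ) : D -> C := fun z => fdot (\val (\val x)) (ulam (\val z)).

(** [U] is a unitary operator of [NQ] onto [H2]; its isometry is stated through
    every series expansion of finite norm. *)
Definition U_unitary : Prop :=
  [/\ forall (c : C) (x y : NQ), U (c *: x + y) = (c *: U x + U y),
      forall (x : NQ) (c : mindex -> C), (h2norm2 c < +oo)%E ->
        has_series (U x) c -> h2norm2 c = (l2norm (\val x) ^+ 2)%:E &
      range U = H2].

(** The operators [U T U^-1] on [H2], for [T] in the Hardy algebra. *)
Definition Finfty_on_H2 : set (H2 -> H2) :=
  [set S | exists2 T, Finfty T &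
     forall (x : NQ) (f : H2), \val f = U x -> \val (S f) = U (T x)].

Definition Hinfty : set (H2 -> H2) :=
  [set S | exists2 psi, multiplier psi &
     forall (f : H2) (z : D), \val (S f) z = psi z * \val f z].

End Model.

Arguments W {R k n} m a {i} j x _.
Arguments L {R k n} m a {i} j x.
Arguments Finfty {R k n} m a _.
Arguments D {R k n} a _.
Arguments H2 {R k n} m a _.
Arguments Finfty_on_H2 {R k n} m a _.
Arguments Hinfty {R k n} m a _.

(* Main.v *)
Require Import Defs.
From HB Require Import structures.
From mathcomp Require Import all_boot all_order all_algebra.
From mathcomp Require Import complex finmap monalg.
From mathcomp Require Import boolp classical_sets functions cardinality fsbigop.
From mathcomp Require Import reals ereal topology normedtype sequences esum exp.
From mathcomp Require Import numfun ring lra zify.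

Local Open Scope classical_set_scope.
Set Implicit Arguments.
Unset Strict Implicit.
Unset Printing Implicit Defensive.

Import Order.TTheory GRing.Theory Num.Theory.

Local Open Scope complex_scope.
Local Open Scope ring_scope.

(** The space [NQ] is a concrete weighted space of power series. A vector [x] is
    orthogonal to the ranges of the commutators exactly when its normalized
    coordinates [x_w / sqrt (beta w)] do not change under a transposition of two
    adjacent letters, hence depend only on the type of [w], that is, on the
    exponent of the commutative monomial [Z_w] ([NQ_tp], [vecf_in_NQ]). So [x] is
    described by coefficients [ncoef x q], one for each exponent [q], its squared
    norm is [sum_q |ncoef x q| ^ 2 / Gam q], and [U x] is the power series
    [sum_q ncoef x q z ^ q] ([U_coef]). The kernel [sum_q Gam q |z ^ q| ^ 2] is finite
    on the domain, because for each [i] it is a binomial series in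
    [sum_w a_w |z_w| ^ 2 < 1] ([kernel_summable]); evaluation at a point is then the
    scalar product with a vector of [NQ]. The coefficients are determined by the
    values, since the domain contains a polydisc ([small_polydisc], [low_order]).
    This gives the unitarity of [U].

    In these coordinates [L j] multiplies a power series by the variable [z_j]
    ([U_L]). The bounded operators that [U] carries to multiplication by some
    function form an algebra that is closed in the weak operator topology, because
    point evaluations are scalar products ([mult_wot_subalgebra]); it contains the
    [L j], hence the whole Hardy algebra.

    Conversely, let [psi] be a multiplier and [T] the operator corresponding to
    multiplication by [psi]. First, [T] is bounded. The coefficients of [T x] of
    degree at most [N] depend only on those of [x] ([mult_low]), so were [T]
    unbounded, a sum of small vectors supported in higher and higher degrees would
    have an image of infinite norm ([unbounded_absurd]). Next, [T] is a weak limit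
    of polynomials in the [L j]. Its homogeneous component of degree [d] is such a
    polynomial [A d], because [T] commutes with the [L j] and is thereby determined
    by the image of the constant function [1] ([component_monom]). The Fejer mean
    [sum_(d < N) (1 - d / N) A d] is the average of the compressions of [T] to
    windows of [N] consecutive degrees, because degrees [i] and [j] lie together in
    [N - |i - j|] windows ([fejer_windows]). Its norm is therefore at most that of
    [T] ([fejer_bound]), and convergence on each homogeneous component becomes weak
    convergence ([fejer_cvg]). *)

(** * Sums of families *)

Section Sums.
Context {R : realType}.
Implicit Types J K : choiceType.

Lemma esum_le_seq J (f : J -> R) (c : R) :
  (forall s : seq J, uniq s -> \sum_(j <- s) f j <= c) ->
  (\esum_(j in [set: J]) (f j)%:E <= c%:E)%E.
Proof.
move=> sf; apply: ge_ereal_sup => _ [X [finX _]] <-.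
by rewrite fsbig_finite//= sumEFin lee_fin sf// fset_uniq.
Qed.

Lemma esum_ge_seq J (f : J -> R) (s : seq J) : uniq s ->
  ((\sum_(j <- s) f j)%:E <= \esum_(j in [set: J]) (f j)%:E)%E.
Proof.
move=> us; apply: esum_ge; exists [set` s]; first by split.
by rewrite -fsbig_seq// sumEFin.
Qed.

Lemma esum_inj J K (e : J -> K) (f : K -> \bar R) : injective e ->
  (forall k, (forall j, k <> e j) -> f k = 0%E) ->
  (\esum_(k in [set: K]) f k = \esum_(j in [set: J]) f (e j))%E.
Proof.
move=> ie f0; transitivity (\esum_(k in range e) f k)%E; last first.
  by apply: (esum_image [set: J] e f) => i j _ _; exact: ie.
rewrite [in RHS]esum_mkcond; apply: eq_esum => k _; case: ifPn => // /negP kn.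
by apply: f0 => j kj; apply: kn; apply/mem_set; exists j.
Qed.

Lemma rsum_inj J K (e : J -> K) (f : K -> R) : injective e ->
  (forall k, (forall j, k <> e j) -> f k = 0) -> rsum f = rsum (f \o e).
Proof.
move=> ie f0; rewrite /rsum; congr (fine (_ - _)%E).
  by rewrite (@esum_inj _ _ e (EFin \o f)^\+%E ie) => [|k kn]; [apply: eq_esum => j _; rewrite !funeposE /=|rewrite !funeposE /= f0// maxxx].
by rewrite (@esum_inj _ _ e (EFin \o f)^\-%E ie) => [|k kn]; [apply: eq_esum => j _; rewrite !funenegE /=|rewrite !funenegE /= f0// oppr0 maxxx].
Qed.

Lemma csum_inj J K (e : J -> K) (f : K -> R[i]) : injective e ->
  (forall k, (forall j, k <> e j) -> f k = 0) -> csum f = csum (f \o e).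
Proof.
move=> ie f0; rewrite /csum; congr (_ +i* _).
  by apply: (@rsum_inj _ _ e (fun k => complex.Re (f k)) ie) => k kn; rewrite f0.
by apply: (@rsum_inj _ _ e (fun k => complex.Im (f k)) ie) => k kn; rewrite f0.
Qed.


Lemma esumZ_set J (A : set J) (c : R) (f : J -> R) : 0 <= c -> (forall j, 0 <= f j) ->
  (\esum_(j in A) (c * f j)%:E = c%:E * \esum_(j in A) (f j)%:E)%E.
Proof.
move=> c0 f0; rewrite esum_mkcond [in RHS]esum_mkcond.
transitivity (\esum_(j in [set: J]) (c * (if j \in A then f j else 0))%:E)%E.
  by apply: eq_esum => j _; case: ifP => //; rewrite mulr0.
rewrite (@esumZ R J c (fun j => if j \in A then f j else 0))//; last by move=> j; case: ifP.
by congr (_ * _)%E; apply: eq_esum => j _; case: ifP.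
Qed.

Section Fiber.
Context {J K : choiceType} (t : J -> K) (beta : J -> R) (Gam : K -> R).
Hypothesis beta0 : forall j, 0 <= beta j.
Hypothesis betaG : forall k, (\esum_(j in [set j | t j = k]) (beta j)%:E = (Gam k)%:E)%E.

(** Families on words depend on a word through its type, up to a nonnegative
    weight; this turns sums over words into sums over types. *)
Lemma esum_fiber (h : K -> R) : (forall k, 0 <= h k) ->
  (\esum_(j in [set: J]) (h (t j) * beta j)%:E =
   \esum_(k in [set: K]) (h k * Gam k)%:E)%E.
Proof.
move=> h0.
transitivity (\esum_(k in [set: K]) \esum_(j in [set j | t j = k]) (h k * beta j)%:E)%E.
  rewrite esum_esum => [|k j _ _]; last by rewrite lee_fin mulr_ge0.
  rewrite (reindex_esum [set: J] _ (fun j => (t j, j)))//=.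
  split => [j _ //|i j _ _ /=[]//|[k j] [/= _ <-]].
  by exists j.
by apply: eq_esum => k _; rewrite esumZ_set// betaG.
Qed.

Let Gam0 k : 0 <= Gam k.
Proof. by rewrite -lee_fin -betaG; apply: esum_ge0 => j _; rewrite lee_fin. Qed.

(** As the weights are nonnegative, all the terms of one fibre have the same
    sign, so positive and negative parts are grouped separately. *)
Lemma rsum_fiber (h : K -> R) :
  rsum (fun j => h (t j) * beta j) = rsum (fun k => h k * Gam k).
Proof.
have pos (g x : R) : 0 <= x -> maxe (g * x)%:E 0%E = (Num.max g 0 * x)%:E.
  by move=> x0; rewrite maxr_pMl// mul0r EFin_max.
rewrite /rsum; congr (fine (_ - _)%E).
  transitivity (\esum_(j in [set: J]) (Num.max (h (t j)) 0 * beta j)%:E)%E.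
    by apply: eq_esum => j _; rewrite !funeposE /= pos.
  rewrite (@esum_fiber (fun k => Num.max (h k) 0)) => [|k]; last by rewrite le_max lexx orbT.
  by apply: eq_esum => k _; rewrite !funeposE /= pos.
transitivity (\esum_(j in [set: J]) (Num.max (- h (t j)) 0 * beta j)%:E)%E.
  by apply: eq_esum => j _; rewrite !funenegE /= -mulNr pos.
rewrite (@esum_fiber (fun k => Num.max (- h k) 0)) => [|k]; last by rewrite le_max lexx orbT.
by apply: eq_esum => k _; rewrite !funenegE /= -mulNr pos.
Qed.

Lemma csum_fiber (h : K -> R[i]) :
  csum (fun j => h (t j) * (beta j)%:C) = csum (fun k => h k * (Gam k)%:C).
Proof.
rewrite /csum; congr (_ +i* _).
  transitivity (rsum (fun j => complex.Re (h (t j)) * beta j)).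
    by congr rsum; apply/funext => j; case: (h (t j)) => a b /=; rewrite mulr0 subr0.
  rewrite (rsum_fiber (fun k => complex.Re (h k))).
  by congr rsum; apply/funext => j; case: (h j) => a b /=; rewrite mulr0 subr0.
transitivity (rsum (fun j => complex.Im (h (t j)) * beta j)).
  by congr rsum; apply/funext => j; case: (h (t j)) => a b /=; rewrite mulr0 add0r.
rewrite (rsum_fiber (fun k => complex.Im (h k))).
by congr rsum; apply/funext => j; case: (h j) => a b /=; rewrite mulr0 add0r.
Qed.

End Fiber.

Lemma rsummableP J (f : J -> R) : (forall j, 0 <= f j) ->
  rsummable f <-> (\esum_(j in [set: J]) (f j)%:E < +oo)%E.
Proof.
move=> f0; rewrite /rsummable /summable /=.
by rewrite (eq_esum (b := fun j => (f j)%:E))// => j _; rewrite ger0_norm.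
Qed.

Lemma rsum_ge0E J (f : J -> R) : (forall j, 0 <= f j) ->
  rsum f = fine (\esum_(j in [set: J]) (f j)%:E)%E.
Proof.
move=> f0; rewrite /rsum [X in (_ - X)%E]esum1 ?sube0; last first.
  by move=> j _; rewrite !funenegE /= -EFin_max; congr EFin; apply/max_idPr; rewrite oppr_le0.
congr fine; apply: eq_esum => j _; rewrite !funeposE /= -EFin_max; congr EFin.
by apply/max_idPl.
Qed.

Lemma rsumK J (f : J -> R) : (forall j, 0 <= f j) -> rsummable f ->
  ((rsum f)%:E = \esum_(j in [set: J]) (f j)%:E)%E.
Proof.
move=> f0 sf; rewrite rsum_ge0E// fineK//.
have := (rsummableP f0).1 sf; rewrite ge0_fin_numE//.
by apply: esum_ge0 => j _; rewrite lee_fin.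
Qed.

Lemma rsum_ge0 J (f : J -> R) : (forall j, 0 <= f j) -> 0 <= rsum f.
Proof. by move=> f0; rewrite rsum_ge0E// fine_ge0// esum_ge0// => j _; rewrite lee_fin. Qed.

Lemma rsum0 J : rsum (fun _ : J => 0 : R) = 0.
Proof. by rewrite rsum_ge0E// esum1. Qed.

Lemma rsummable0 J : rsummable (fun _ : J => 0 : R).
Proof. by apply/rsummableP => //; rewrite esum1 ?ltry. Qed.

Lemma rsumN J (f : J -> R) : rsummable f -> rsum (fun j => - f j) = - rsum f.
Proof.
move=> sf; rewrite -mulN1r -rsumZ//.
by congr rsum; apply/funext => j; rewrite mulN1r.
Qed.

Lemma rsummableN J (f : J -> R) : rsummable f -> rsummable (fun j => - f j).
Proof.
by move=> sf; apply: (rsummable_le (rsummable_abs sf)) => j; rewrite normrN.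
Qed.

Lemma le_rsum J (f g : J -> R) : rsummable f -> rsummable g ->
  (forall j, f j <= g j) -> rsum f <= rsum g.
Proof.
move=> sf sg fg; rewrite -subr_ge0 -rsumN// -rsumD//; last exact: rsummableN.
by apply: rsum_ge0 => j; rewrite subr_ge0.
Qed.

Lemma rsum_norm J (f : J -> R) : rsummable f -> `|rsum f| <= rsum (fun j => `|f j|).
Proof.
move=> sf; have sa := rsummable_abs sf; rewrite ler_norml; apply/andP; split.
  rewrite -rsumN//; apply: le_rsum => //; first exact: rsummableN.
  by move=> j; rewrite lerNl -normrN ler_norm.
by apply: le_rsum => // j; rewrite ler_norm.
Qed.

Lemma rsummable_sum J (X : Type) (s : seq X) (P : pred X) (f : X -> J -> R) :
  (forall x, P x -> rsummable (f x)) -> rsummable (fun j => \sum_(x <- s | P x) f x j).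
Proof.
move=> sf; elim: s => [|x s IH].
  by rewrite (_ : (fun _ => _) = fun=> 0) ?rsummable0//; apply/funext => j; rewrite big_nil.
have [Px|Px] := boolP (P x).
  rewrite (_ : (fun _ => _) = fun j => f x j + \sum_(x <- s | P x) f x j).
    by apply: rsummableD => //; exact: sf.
  by apply/funext => j; rewrite big_cons Px.
rewrite (_ : (fun _ => _) = fun j => \sum_(x <- s | P x) f x j)//.
by apply/funext => j; rewrite big_cons (negbTE Px).
Qed.

Lemma rsum_sum J (X : Type) (s : seq X) (P : pred X) (f : X -> J -> R) :
  (forall x, P x -> rsummable (f x)) ->
  rsum (fun j => \sum_(x <- s | P x) f x j) = \sum_(x <- s | P x) rsum (f x).
Proof.
move=> sf; elim: s => [|x s IH].
  rewrite big_nil -[RHS](@rsum0 J).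
  by congr rsum; apply/funext => j; rewrite big_nil.
rewrite big_cons; case: ifPn => Px.
  rewrite -IH -rsumD//; [|exact: sf|exact: rsummable_sum].
  by congr rsum; apply/funext => j; rewrite big_cons Px.
by rewrite -IH; congr rsum; apply/funext => j; rewrite big_cons (negbTE Px).
Qed.

(** The norm of [R[i]] has values in [R[i]]; estimates need a real number. *)
Definition modc (z : R[i]) : R := Num.sqrt (sqmod z).

Lemma normcE (z : R[i]) : `|z| = (modc z)%:C.
Proof. by case: z => a b; rewrite normc_def. Qed.

Lemma modc_ltP (z : R[i]) (e : R) : `|z| < e%:C <-> modc z < e.
Proof. by rewrite normcE ltcR. Qed.

Lemma modc_ge0 z : 0 <= modc z. Proof. exact: sqrtr_ge0. Qed.

Lemma sqmodE z : sqmod z = modc z ^+ 2.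
Proof. by rewrite sqr_sqrtr// sqmod_ge0. Qed.

Lemma modcM z1 z2 : modc (z1 * z2) = modc z1 * modc z2.
Proof. by apply: complexI; rewrite -normcE normrM !normcE rmorphM. Qed.

Lemma modcD z1 z2 : modc (z1 + z2) <= modc z1 + modc z2.
Proof. by rewrite -lecR -normcE rmorphD/= -!normcE ler_normD. Qed.

Lemma modcN z : modc (- z) = modc z.
Proof. by apply: complexI; rewrite -!normcE normrN. Qed.

Lemma modcR (x : R) : modc x%:C = `|x|.
Proof. by rewrite /modc /sqmod /= expr0n/= addr0 sqrtr_sqr. Qed.

Lemma modc0 : modc 0 = 0. Proof. by rewrite modcR normr0. Qed.

Lemma modc_conj z : modc z^* = modc z.
Proof. by case: z => a b; rewrite /modc /sqmod/= sqrrN. Qed.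

Lemma mulC_conj (z : R[i]) : z * z^* = (sqmod z)%:C.
Proof.
case: z => a b; rewrite /sqmod/=.
by apply/eqP; rewrite eq_complex /=; apply/andP; split; apply/eqP; ring.
Qed.

Lemma modc_eq0 z : modc z = 0 -> z = 0.
Proof. by move=> z0; apply/eqP; rewrite -normr_eq0 normcE z0. Qed.

Lemma modc_sum (X : Type) (s : seq X) (P : pred X) (f : X -> R[i]) :
  modc (\sum_(x <- s | P x) f x) <= \sum_(x <- s | P x) modc (f x).
Proof.
elim/big_rec2: _ => [|x u v _ uv]; first by rewrite modc0.
by rewrite (le_trans (modcD _ _))// lerD2l.
Qed.

Lemma Re_le_modc z : `|complex.Re z| <= modc z.
Proof. by rewrite -sqrtr_sqr ler_wsqrtr// lerDl sqr_ge0. Qed.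

Lemma Im_le_modc z : `|complex.Im z| <= modc z.
Proof. by rewrite -sqrtr_sqr ler_wsqrtr// lerDr sqr_ge0. Qed.

Lemma modc_le_ReIm z : modc z <= `|complex.Re z| + `|complex.Im z|.
Proof.
rewrite -(@ger0_norm _ (_ + _)) ?addr_ge0// -sqrtr_sqr ler_wsqrtr//.
rewrite /sqmod sqrrD !real_normK ?num_real// -addrA lerD2l lerDr.
by rewrite mulrn_wge0// mulr_ge0.
Qed.

Lemma csummableP J (h : J -> R[i]) : csummable h <-> rsummable (fun j => modc (h j)).
Proof.
split=> [[sr si]|sh].
  apply: (rsummable_le (rsummableD (rsummable_abs sr) (rsummable_abs si))) => j.
  by rewrite ger0_norm ?modc_ge0// modc_le_ReIm.
by split; apply: (rsummable_le sh) => j; [exact: Re_le_modc|exact: Im_le_modc].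
Qed.

Lemma csummable_le J (h : J -> R[i]) (g : J -> R) : rsummable g ->
  (forall j, modc (h j) <= g j) -> csummable h.
Proof.
move=> sg hg; apply/csummableP; apply: (rsummable_le sg) => j.
by rewrite ger0_norm ?modc_ge0.
Qed.

Lemma csummable0 J : csummable (fun _ : J => 0 : R[i]).
Proof. by split; exact: rsummable0. Qed.

Lemma csum0 J : csum (fun _ : J => 0 : R[i]) = 0.
Proof. by rewrite /csum rsum0. Qed.

Lemma csumD J (h g : J -> R[i]) : csummable h -> csummable g ->
  csum (fun j => h j + g j) = csum h + csum g.
Proof.
move=> sh sg; rewrite -[csum h]mul1r -csum_linear//.
by congr csum; apply/funext => j; rewrite mul1r.
Qed.

Lemma csumZ J (c : R[i]) (h : J -> R[i]) : csummable h ->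
  csum (fun j => c * h j) = c * csum h.
Proof.
move=> sh; rewrite -[RHS]addr0 -(@csum0 J) -csum_linear//; last exact: csummable0.
by congr csum; apply/funext => j; rewrite addr0.
Qed.

(** The factor [2] comes from treating real and imaginary parts separately. *)
Lemma modc_csum J (h : J -> R[i]) : csummable h ->
  modc (csum h) <= 2 * rsum (fun j => modc (h j)).
Proof.
move=> sh; have [sr si] := sh; have /csummableP sm := sh.
rewrite (le_trans (modc_le_ReIm _))//= mulrDl mul1r lerD//.
  apply: le_trans (rsum_norm sr) _; apply: le_rsum => //; first exact: rsummable_abs.
  by move=> j; exact: Re_le_modc.
apply: le_trans (rsum_norm si) _; apply: le_rsum => //; first exact: rsummable_abs.
by move=> j; exact: Im_le_modc.
Qed.

Lemma csum_single J (j0 : J) (h : J -> R[i]) : (forall j, j <> j0 -> h j = 0) ->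
  csum h = h j0.
Proof.
move=> h0; rewrite (@csum_inj unit J (fun=> j0)); first last.
- by move=> j jj0; apply: h0 => e; exact: (jj0 tt).
- by case=> -[].
have rE (r : R) : rsum (fun _ : unit => r) = r.
  rewrite /rsum (_ : [set: unit] = [set tt]); last by apply/seteqP; split => -[].
  rewrite !esum_set1 ?funepos_ge0 ?funeneg_ge0//.
  by rewrite -[(_ - _)%E]/((fun u => _ - _)%E tt) -funeposneg.
by rewrite /csum /comp !rE; case: (h j0).
Qed.

Lemma csum_conj J (h : J -> R[i]) : csummable h ->
  csum (fun j => (h j)^*) = (csum h)^*.
Proof.
move=> [sr si]; rewrite /csum /=; congr (_ +i* _).
  by congr rsum; apply/funext => j; case: (h j).
by rewrite -rsumN//; congr rsum; apply/funext => j; case: (h j).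
Qed.

End Sums.

(** * The scalar product of square summable families *)

Section Hilbert.
Context {R : realType} {I : choiceType}.
Implicit Types (x y z : l2 R I) (c : R[i]).

Lemma l2_ext x y : (forall i, \val x i = \val y i) -> x = y.
Proof. by move=> xy; apply/val_inj/funext. Qed.

Lemma l2val0 i : \val (0 : l2 R I) i = 0. Proof. by []. Qed.

Lemma rsummable_sqmod x : rsummable (fun i => sqmod (\val x i)).
Proof. by apply: (l2predE (\val x)).1; exact: valP. Qed.

Lemma esum_sqmod x :
  (\esum_(i in [set: I]) (sqmod (\val x i))%:E = (l2norm x ^+ 2)%:E)%E.
Proof.
rewrite /l2norm sqr_sqrtr; last by rewrite fine_ge0// esum_ge0// => i _; rewrite lee_fin sqmod_ge0.
rewrite fineK// ge0_fin_numE; last by rewrite esum_ge0// => i _; rewrite lee_fin sqmod_ge0.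
exact: (valP x).
Qed.

Lemma l2norm_ge0 x : 0 <= l2norm x. Proof. exact: sqrtr_ge0. Qed.

Lemma l2norm2E x : l2norm x ^+ 2 = rsum (fun i => sqmod (\val x i)).
Proof.
apply: EFin_inj; rewrite -esum_sqmod rsumK//; last exact: rsummable_sqmod.
by move=> i; exact: sqmod_ge0.
Qed.

Lemma conjCR (r : R) : (r%:C : R[i])^* = r%:C. Proof. exact: conjc_real. Qed.

Lemma dotxx x : dot x x = (l2norm x ^+ 2)%:C.
Proof.
rewrite l2norm2E /dot /fdot /csum /real_complex_def; congr (_ +i* _).
  by congr rsum; apply/funext => i; case: (\val x i) => a b; rewrite /sqmod/=; ring.
by rewrite -[RHS](@rsum0 _ I); congr rsum; apply/funext => i; case: (\val x i) => a b /=; ring.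
Qed.

Lemma dotC x y : dot y x = (dot x y)^*.
Proof.
rewrite /dot /fdot -csum_conj; last exact: csummable_dot.
by congr csum; apply/funext => i; rewrite rmorphM/= conjCK mulrC.
Qed.

Lemma dotDl x y z : dot (x + y) z = dot x z + dot y z.
Proof. by rewrite -[x]scale1r dot_linear mul1r scale1r. Qed.

Lemma dot0l z : dot 0 z = 0.
Proof. by apply: (addrI (dot 0 z)); rewrite -dotDl addr0 addr0. Qed.

Lemma dotZl c x z : dot (c *: x) z = c * dot x z.
Proof. by rewrite -[c *: x]addr0 dot_linear dot0l addr0. Qed.

Lemma dotNl x z : dot (- x) z = - dot x z.
Proof. by rewrite -scaleN1r dotZl mulN1r. Qed.

Lemma dotBl x y z : dot (x - y) z = dot x z - dot y z.
Proof. by rewrite dotDl dotNl. Qed.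

Lemma dotDr x y z : dot z (x + y) = dot z x + dot z y.
Proof. by rewrite dotC dotDl rmorphD/= -!dotC. Qed.

Lemma dot0r z : dot z 0 = 0.
Proof. by rewrite dotC dot0l rmorph0. Qed.

Lemma dotZr c x z : dot z (c *: x) = c^* * dot z x.
Proof. by rewrite dotC dotZl rmorphM/= -dotC. Qed.

Lemma dotNr x z : dot z (- x) = - dot z x.
Proof. by rewrite -scaleN1r dotZr rmorphN rmorph1 mulN1r. Qed.

Lemma dotBr x y z : dot z (x - y) = dot z x - dot z y.
Proof. by rewrite dotDr dotNr. Qed.

Lemma l2norm0_eq0 x : l2norm x = 0 -> x = 0.
Proof.
move=> x0; apply: l2_ext => i; rewrite l2val0.
have := @esum_ge_seq _ _ (fun j => sqmod (\val x j)) [:: i] isT.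
rewrite big_seq1 esum_sqmod x0 expr0n lee_fin /= sqmodE => h.
by apply/modc_eq0/eqP; rewrite -sqrf_eq0 eq_le h sqr_ge0.
Qed.

Lemma l2norm0 : l2norm (0 : l2 R I) = 0.
Proof. by apply/eqP; rewrite -sqrf_eq0 l2norm2E /sqmod/= expr0n/= addr0 rsum0. Qed.

Lemma l2normZ c x : l2norm (c *: x) = modc c * l2norm x.
Proof.
apply/eqP; rewrite -(@eqrXn2 _ 2)// ?mulr_ge0 ?l2norm_ge0 ?modc_ge0//.
apply/eqP/complexI; rewrite -dotxx dotZl dotZr dotxx mulrA mulC_conj sqmodE.
by rewrite -rmorphM exprMn.
Qed.

Lemma l2normN x : l2norm (- x) = l2norm x.
Proof. by rewrite -scaleN1r l2normZ modcN (modcR 1) normr1 mul1r. Qed.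

(** Positivity of the norm of [n x - d y], where [n] is the squared norm of
    [y] and [d] the scalar product of [x] and [y]. *)
Lemma cauchy_schwarz x y : modc (dot x y) <= l2norm x * l2norm y.
Proof.
have [y0|yn0] := eqVneq (l2norm y) 0.
  by rewrite (l2norm0_eq0 y0) dot0r modc0 mulr_ge0 ?l2norm_ge0.
rewrite -(@ler_pXn2r _ 2)// ?nnegrE ?mulr_ge0 ?l2norm_ge0 ?modc_ge0//.
set d := dot x y; set n := l2norm y ^+ 2.
have n0 : 0 < n by rewrite exprn_gt0// lt_def yn0 l2norm_ge0.
have : 0 <= l2norm (n%:C *: x - d *: y) ^+ 2 by exact: sqr_ge0.
have dd : d * d^* = (modc d ^+ 2)%:C by rewrite -sqmodE mulC_conj.
have -> : l2norm (n%:C *: x - d *: y) ^+ 2 = n * (l2norm x ^+ 2 * n - modc d ^+ 2).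
  apply: complexI; rewrite -dotxx !(dotBl, dotBr, dotZl, dotZr) !dotxx -/n.
  rewrite (dotC x y) -/d conjCR.
  move: (l2norm x ^+ 2) (modc d ^+ 2) dd n {n0} => nx p dd n.
  rewrite rmorphM rmorphB rmorphM /= -dd; ring.
by rewrite pmulr_rge0// subr_ge0 exprMn.
Qed.

Lemma l2normD x y : l2norm (x + y) <= l2norm x + l2norm y.
Proof.
rewrite -(@ler_pXn2r _ 2)// ?nnegrE ?addr_ge0 ?l2norm_ge0//.
have cs := cauchy_schwarz x y.
rewrite -lecR -dotxx dotDl !dotDr !dotxx (dotC x y).
have -> : (l2norm x ^+ 2)%:C + dot x y + ((dot x y)^* + (l2norm y ^+ 2)%:C) =
  (l2norm x ^+ 2 + 2 * complex.Re (dot x y) + l2norm y ^+ 2)%:C.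
  by case: (dot x y) => a b; apply/eqP; rewrite eq_complex /=; apply/andP; split; apply/eqP; ring.
rewrite lecR.
have := Re_le_modc (dot x y); rewrite ler_norml => /andP[_ h].
by have := le_trans h cs; nra.
Qed.

Lemma l2normB x y : l2norm (x - y) <= l2norm x + l2norm y.
Proof. by rewrite -(l2normN y) l2normD. Qed.

Lemma l2norm_sum (X : Type) (s : seq X) (P : pred X) (f : X -> l2 R I) :
  l2norm (\sum_(u <- s | P u) f u) <= \sum_(u <- s | P u) l2norm (f u).
Proof.
elim/big_rec2: _ => [|u v w _ vw]; first by rewrite l2norm0.
by rewrite (le_trans (l2normD _ _))// lerD2l.
Qed.

Lemma dot_suml (X : Type) (s : seq X) (P : pred X) (f : X -> l2 R I) z :
  dot (\sum_(u <- s | P u) f u) z = \sum_(u <- s | P u) dot (f u) z.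
Proof.
by elim/big_rec2: _ => [|u v w _ <-]; rewrite ?dot0l ?dotDl.
Qed.

End Hilbert.

(** * Words and their weights *)

Lemma big_tcons (R : nmodType) (T : finType) p (F : p.+1.-tuple T -> R) :
  \sum_(g : p.+1.-tuple T) F g = \sum_(u : T) \sum_(g : p.-tuple T) F [tuple of u :: g].
Proof.
rewrite pair_bigA /= (reindex (fun ug : T * p.-tuple T => [tuple of ug.1 :: ug.2]))//=.
exists (fun g => (thead g, [tuple of behead g])) => [[u g]|g] _ /=.
  by congr pair; apply/val_inj.
by apply/val_inj; rewrite /= [in RHS](tuple_eta g).
Qed.

(** By Pascal's rule, multiplication by [1 - t] lowers [m] by one, up to a
    nonpositive boundary term. *)
Lemma sum_binomial_le (R : realFieldType) (t : R) m N : 0 <= t -> t < 1 ->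
  \sum_(p < N) 'C(p + m, m)%:R * t ^+ p <= (1 - t) ^- m.+1.
Proof.
move=> t0 t1; have t1' : 0 < 1 - t by rewrite subr_gt0.
elim: m => [|m IH].
  rewrite expr1 -(ler_pM2l t1') divff ?gt_eqF//.
  have -> : (1 - t) * (\sum_(p < N) 'C(p + 0, 0)%:R * t ^+ p) = 1 - t ^+ N.
    elim: N => [|N IH]; first by rewrite big_ord0 mulr0 expr0 subrr.
    by rewrite big_ord_recr/= mulrDr IH addn0 bin0 exprS; ring.
  by rewrite gerDl oppr_le0 exprn_ge0.
rewrite -(ler_pM2l t1') exprS invfM mulrA divff ?gt_eqF// mul1r.
apply: le_trans IH.
suff -> : (1 - t) * (\sum_(p < N) 'C(p + m.+1, m.+1)%:R * t ^+ p) =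
    \sum_(p < N) 'C(p + m, m)%:R * t ^+ p - 'C(N + m, m.+1)%:R * t ^+ N.
  by rewrite gerDl oppr_le0 mulr_ge0// exprn_ge0.
elim: N => [|N IH]; first by rewrite !big_ord0 bin_small// mulr0 mul0r subr0.
rewrite !big_ord_recr/= mulrDr IH addnS addSn binS natrD exprS.
ring.
Qed.

Section Words.
Context {R : realType} {n : nat}.
Local Notation word := (seq 'I_n).
Implicit Types (w u v : word).

Definition cnt w : {ffun 'I_n -> nat} := [ffun j => count_mem j w].

Lemma cnt_cons j w : cnt (j :: w) = [ffun j' => ((j == j') + cnt w j')%N].
Proof. by apply/ffunP => j'; rewrite !ffunE. Qed.

Lemma wordprod_cnt (z : 'I_n -> R[i]) w : wordprod z w = monomial z (cnt w).
Proof.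
rewrite /wordprod /monomial; elim: w => [|j w IH].
  by rewrite big_nil big1// => j _; rewrite ffunE expr0.
rewrite big_cons IH cnt_cons.
under [RHS]eq_bigr do rewrite ffunE exprD.
rewrite big_split/=; congr (_ * _).
rewrite (bigD1 j)//= eqxx expr1 big1 ?mulr1// => j' /negbTE jj'.
by rewrite eq_sym jj' expr0.
Qed.

(** Evaluation at [2] in one variable and at [1] in the others recovers the
    exponents of a monomial. *)
Lemma LambdaE (q : {ffun 'I_n -> nat}) w : Lambda (R := R) q w <-> cnt w = q.
Proof.
split=> [wq|<- z]; last exact: wordprod_cnt.
apply/ffunP => j; have := wq (fun j' => if j' == j then 2 else 1).
have mono p : monomial (fun j' => if j' == j then 2 else 1 : R[i]) p = 2 ^+ p j.
  rewrite /monomial (bigD1 j)//= eqxx big1 ?mulr1// => j' /negbTE ->.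
  by rewrite expr1n.
rewrite wordprod_cnt !mono => /eqP; rewrite -!natrX eqr_nat => /eqP.
by move/eqP; rewrite eqn_exp2l// => /eqP.
Qed.

Lemma size_cnt w : size w = (\sum_j cnt w j)%N.
Proof.
elim: w => [|j w IH]; first by rewrite big1// => j _; rewrite ffunE.
rewrite cnt_cons /=; under eq_bigr do rewrite ffunE.
rewrite big_split/= (bigD1 j)//= eqxx big1 ?IH// => j' /negbTE.
by rewrite eq_sym => ->.
Qed.

Section Conv.
Variables (a : word -> R) (m : nat).
Hypotheses (a0 : forall w, 0 <= a w) (anil : a [::] = 0) (m1 : (1 <= m)%N).

(** The [p]-fold convolution power of [a]: the coefficients of the [p]-th
    power of the power series with coefficients [a]. *)
Fixpoint conv (p : nat) w : R :=
  if p is p'.+1 then \sum_(1 <= s < (size w).+1) a (take s w) * conv p' (drop s w)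
  else (nilp w)%:R.

Lemma conv0 w : conv 0 w = (nilp w)%:R. Proof. by []. Qed.

Lemma convS p w : conv p.+1 w =
  \sum_(1 <= s < (size w).+1) a (take s w) * conv p (drop s w).
Proof. by []. Qed.

Arguments conv : simpl never.

Lemma conv_ge0 p w : 0 <= conv p w.
Proof.
elim: p w => [|p IH] w; first by rewrite conv0.
by rewrite convS; apply: sumr_ge0 => s _; rewrite mulr_ge0.
Qed.

Lemma conv_gt p w : (size w < p)%N -> conv p w = 0.
Proof.
elim: p w => [//|p IH] w; rewrite ltnS => wp.
rewrite convS big_nat_cond big1// => s; rewrite andbT => /andP[s1 sw].
by rewrite IH ?mulr0// size_drop; lia.
Qed.

Lemma conv_cons p j w : a [:: j] * conv p w <= conv p.+1 (j :: w).
Proof.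
rewrite convS big_ltn//= take0 drop0 lerDl.
by apply: sumr_ge0 => s _; rewrite mulr_ge0// conv_ge0.
Qed.

(** The first factor of a factorization is a prefix, and its other factors
    form a factorization of the rest. Empty factors contribute nothing to
    [conv], because [a [::] = 0]. *)
Lemma conv_tuples N p w : (size w <= N)%N ->
  \sum_(g : p.-tuple {bseq N of 'I_n} | flatten [seq bseqval x | x <- g] == w)
     \prod_(x <- g) a x = conv p w.
Proof.
elim: p w => [|p IH] w wN.
  rewrite conv0 big_mkcond /= (big_pred1 (nil_tuple _)) => [|g]; last by rewrite [g]tuple0; apply/esym/eqP.
  by rewrite big_nil /= eq_sym; case: w wN.
rewrite convS big_mkcond big_tcons /=.
transitivity (\sum_(u : {bseq N of 'I_n} | take (size u) w == u)
    a u * conv p (drop (size u) w)).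
  rewrite [RHS]big_mkcond; apply: eq_bigr => u _.
  case: ifPn => [/eqP uw|uw].
    rewrite -IH; last by rewrite size_drop; lia.
    rewrite big_distrr [RHS]big_mkcond; apply: eq_bigr => g _ /=.
    rewrite big_cons; congr (if _ then _ else _).
    by rewrite -{1}(cat_take_drop (size u) w) uw eqseq_cat ?eqxx.
  rewrite big1// => g _; case: eqP => // e.
  by move: uw; rewrite -e take_size_cat ?eqxx.
rewrite (reindex_onto (fun s : 'I_(size w).+1 => insub_bseq N (take s w))
  (fun x : {bseq N of _} => inord (size x))); last first.
  move=> u /eqP uw; apply/val_inj; rewrite /= inordK.
    by rewrite val_insubd uw size_bseq.
  by rewrite ltnS -{1}uw size_take; case: ltnP => // /ltnW.
have tk s : (s <= size w)%N -> insub_bseq N (take s w) = take s w :> seq _.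
  by move=> sw; rewrite /= val_insubd size_takel// (leq_trans sw wN).
have sz s : (s <= size w)%N -> size (insub_bseq N (take s w)) = s.
  by move=> sw; rewrite tk// size_takel.
transitivity (\sum_(s < (size w).+1) a (take s w) * conv p (drop s w)).
  have sw (s : 'I_(size w).+1) : (s <= size w)%N by rewrite -ltnS.
  apply: eq_big => [s|s _]; last by rewrite (sz _ (sw s)) (tk _ (sw s)).
  by rewrite (sz _ (sw s)) (tk _ (sw s)) eqxx inord_val eqxx.
rewrite -(big_mkord xpredT (fun s => a (take s w) * conv p (drop s w))).
by rewrite big_ltn// take0 anil mul0r add0r.
Qed.

(** The term [p = 0] accounts for the empty word, so that one formula covers
    all words. *)
Lemma bcoefE w : bcoef m a w = \sum_(p < (size w).+1) 'C(p + m - 1, m - 1)%:R * conv p w.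
Proof.
rewrite /bcoef; case: ifPn => [|wn].
  by case: w => // _; rewrite big_ord1 conv0 add0n binn mulr1.
rewrite -(big_mkord xpredT (fun p => 'C(p + m - 1, m - 1)%:R * conv p w)).
rewrite [RHS]big_ltn// conv0 (negbTE wn) mulr0 add0r; apply: eq_bigr => p _.
rewrite -big_distrl/= mulrC; congr (_ * _).
rewrite -(@conv_tuples (size w))// [RHS]big_mkcond [LHS]big_mkcond; apply: eq_bigr => g _.
case: (flatten _ == w) => //=; case: ifPn => // /allPn[x xg].
rewrite lt0n negbK => /nilP xn; rewrite (big_rem x)//=.
by rewrite (_ : a x = 0) ?mul0r// (_ : bseqval x = [::])//.
Qed.

Lemma bcoefEw N w : (size w < N)%N ->
  bcoef m a w = \sum_(p < N) 'C(p + m - 1, m - 1)%:R * conv p w.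
Proof.
move=> wN; rewrite bcoefE.
rewrite -!(big_mkord xpredT (fun p => 'C(p + m - 1, m - 1)%:R * conv p w)).
rewrite [RHS](big_cat_nat (n := (size w).+1))//= [X in _ + X]big1_seq ?addr0// => p.
by rewrite mem_index_iota => /andP[_ /andP[wp _]]; rewrite conv_gt ?mulr0.
Qed.

Lemma bcoef_nil : bcoef m a [::] = 1. Proof. by []. Qed.

(** A factorization of [w] becomes one of [j :: w] by adding the factor [j].
    This bounds the weighted shifts. *)
Lemma bcoef_cons j w : a [:: j] * bcoef m a w <= bcoef m a (j :: w).
Proof.
rewrite !bcoefE big_distrr/= [leRHS]big_ord_recl/= conv0 mulr0 add0r.
apply: ler_sum => p _; rewrite mulrCA /bump/= add1n.
apply: ler_pM; rewrite ?ler_nat ?mulr_ge0 ?conv_ge0 ?conv_cons//.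
by apply: leq_bin2l; lia.
Qed.

Lemma bcoef_gt0 w : (forall j, 0 < a [:: j]) -> 0 < bcoef m a w.
Proof.
move=> aj; elim: w => [|j w IH]; first by rewrite bcoef_nil.
by rewrite (lt_le_trans _ (bcoef_cons j w))// mulr_gt0.
Qed.

Section Kernel.
Variables (r : word -> R) (t : R).
Hypotheses (r0 : forall w, 0 <= r w) (r1 : r [::] = 1)
  (rM : forall u v, r (u ++ v) = r u * r v).
Hypotheses (t1 : t < 1)
  (at_ : (\esum_(w in [set w | (0 < size w)%N]) (a w * r w)%:E = t%:E)%E).

(** A word with a marked nonempty prefix is the same as a nonempty word
    followed by a word, and [r] is multiplicative; so the sum over [conv
    p.+1] is the product of the sums over [a] and over [conv p]. *)
Lemma esum_conv p : (\esum_(w in [set: word]) (conv p w * r w)%:E <= (t ^+ p)%:E)%E.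
Proof.
elim: p => [|p IH].
  apply: esum_le_seq => s us; rewrite expr0.
  have [ns|ns] := boolP ([::] \in s).
    rewrite (big_rem [::])//= conv0 mul1r r1 big_seq big1 ?addr0// => -[|j w]; last by rewrite conv0 mul0r.
    by rewrite mem_rem_uniqF.
  rewrite big_seq big1// => -[|j w]; last by rewrite conv0 mul0r.
  by rewrite (negbTE ns).
(* [conv p.+1 w * r w] is the sum over the cuts [w = u ++ v] with [u] nonempty;
   the double sum over [w] and the length of [u] is one over the pairs. *)
pose F (uv : word * word) := (a uv.1 * r uv.1 * (conv p uv.2 * r uv.2))%:E.
have F0 uv : (0 <= F uv)%E by rewrite lee_fin !mulr_ge0// conv_ge0.
have -> : (\esum_(w in [set: word]) (conv p.+1 w * r w)%:E =
    \esum_(w in [set: word]) \esum_(s in [set` index_iota 1 (size w).+1])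
      F (take s w, drop s w))%E.
  apply: eq_esum => w _; rewrite esum_fset; [|exact: finite_seq|by []].
  rewrite -fsbig_seq; last exact: iota_uniq.
  rewrite sumEFin; congr EFin; rewrite convS big_distrl/=; apply: eq_bigr => s _ /=.
  have -> : r w = r (take s w) * r (drop s w) by rewrite -rM cat_take_drop.
  by ring.
rewrite esum_esum//.
rewrite (reindex_esum ([set u | (0 < size u)%N] `*`` (fun=> [set: word])) _
  (fun uv => (uv.1 ++ uv.2, size uv.1)))/=; last first.
  split.
  - move=> [u v] /= [u0 _]; split => //; rewrite /= mem_index_iota size_cat u0 ltnS leq_addr//.
  - move=> [u v] [u' v'] _ _ /= [/eqP + uu'].
    by rewrite eqseq_cat// => /andP[/eqP -> /eqP ->].
  move=> [w s] /= [_]; rewrite mem_index_iota ltnS => /andP[s0 sw].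
  exists (take s w, drop s w); first by rewrite /= size_takel.
  by rewrite /= cat_take_drop size_takel.
have -> : (\esum_(k in [set u | (0 < size u)%N] `*`` (fun=> [set: word]))
    F (take (size k.1) (k.1 ++ k.2), drop (size k.1) (k.1 ++ k.2)) =
    \esum_(u in [set u | (0 < size u)%N]) \esum_(v in [set: word]) F (u, v))%E.
  rewrite esum_esum//; apply: eq_esum => -[u v] _ /=.
  by rewrite take_size_cat ?drop_size_cat.
have tp : (\esum_(v in [set: word]) (conv p v * r v)%:E)%E \is a fin_num.
  rewrite ge0_fin_numE; first by rewrite (le_lt_trans IH) ?ltry.
  by apply: esum_ge0 => v _; rewrite lee_fin mulr_ge0 ?conv_ge0.
set T := fine (\esum_(v in [set: word]) (conv p v * r v)%:E)%E.
have T0 : 0 <= T by rewrite fine_ge0// esum_ge0// => v _; rewrite lee_fin mulr_ge0 ?conv_ge0.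
have -> : (\esum_(u in [set u | (0 < size u)%N]) \esum_(v in [set: word]) F (u, v) =
  \esum_(u in [set u | (0 < size u)%N]) (T * (a u * r u))%:E)%E.
  apply: eq_esum => u _; rewrite (@esumZ_set _ _ _ (a u * r u) (fun v => conv p v * r v)) ?mulr_ge0//; last first.
    by move=> v; rewrite mulr_ge0 ?conv_ge0.
  by rewrite -(fineK tp) -/T -EFinM [T * _]mulrC.
rewrite esumZ_set//; last by move=> u; rewrite mulr_ge0.
rewrite at_ exprSr -EFinM lee_fin ler_wpM2r//.
  by rewrite -lee_fin -at_ esum_ge0// => u _; rewrite lee_fin mulr_ge0.
by rewrite -lee_fin fineK.
Qed.

(** Weighted by [r], the coefficients [b] sum to the binomial series at [t =
    sum_w a_w r_w]. *)
Lemma sum_bcoef_le (s : seq word) : uniq s ->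
  \sum_(w <- s) bcoef m a w * r w <= (1 - t) ^- m.
Proof.
move=> us; set N := (\max_(w <- s) size w).+1.
have t0 : 0 <= t by rewrite -lee_fin -at_ esum_ge0// => u _; rewrite lee_fin mulr_ge0.
have -> : \sum_(w <- s) bcoef m a w * r w =
  \sum_(p < N) 'C(p + m - 1, m - 1)%:R * \sum_(w <- s) conv p w * r w.
  under [RHS]eq_bigr do rewrite big_distrr.
  rewrite exchange_big /=; apply: eq_big_seq => w ws.
  rewrite (@bcoefEw N); last by rewrite ltnS; exact: leq_bigmax_seq.
  by rewrite big_distrl; apply: eq_bigr => p _ /=; rewrite mulrA.
have := sum_binomial_le m.-1 N t0 t1; rewrite prednK// => /(le_trans _); apply.
apply: ler_sum => p _; rewrite -subn1 addnBA// ler_wpM2l// -lee_fin.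
by rewrite (le_trans (esum_ge_seq _ us))// esum_conv.
Qed.

End Kernel.

End Conv.
End Words.

(** * Commutative monomials and their weights *)

Lemma esum_finType (R : realType) (T : finType) (f : T -> R) : (forall x, 0 <= f x) ->
  (\esum_(x in [set: T]) (f x)%:E = (\sum_x f x)%:E)%E.
Proof.
move=> f0; have -> : [set: T] = [set` enum T].
  by apply/seteqP; split => x _ //=; rewrite mem_enum.
rewrite esum_fset; [|exact: finite_seq|by move=> x _; rewrite lee_fin].
by rewrite -fsbig_seq ?enum_uniq// big_enum/= sumEFin.
Qed.

Section Types.
Context {k : nat}.
Variable n : 'I_k -> nat.
Local Notation mindex := {dffun forall i : 'I_k, {ffun 'I_(n i) -> nat}}.
Implicit Types (w : mword n) (q : mindex).

(** The exponent of the commutative monomial [Z_w]. *)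
Definition tp w : mindex := [ffun i => cnt (w i)].

Definition push i (j : 'I_(n i)) w : mword n := upd w (j :: w i).

(** The exponent multiplied by the variable [Z_{i,j}]. Letters of distinct
    alphabets have distinct types, hence the comparison of tagged letters. *)
Definition inc i (j : 'I_(n i)) q : mindex :=
  [ffun i' => [ffun j' => (q i' j' + (Tagged (fun i => 'I_(n i)) j' ==
                                      Tagged (fun i => 'I_(n i)) j))%N]].

Definition deg q : nat := (\sum_i \sum_j q i j)%N.

Lemma updE i (v : seq 'I_(n i)) w : upd w v i = v.
Proof. by rewrite ffunE dfwith_in. Qed.

Lemma updE_neq i (v : seq 'I_(n i)) w i' : i != i' -> upd w v i' = w i'.
Proof. by move=> ii'; rewrite ffunE dfwith_out. Qed.

Lemma upd_id i (v : seq 'I_(n i)) w : w i = v -> upd w v = w.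
Proof.
move=> wv; apply/ffunP => i'; have [<-|ii'] := eqVneq i i'; first by rewrite updE.
by rewrite updE_neq.
Qed.

Lemma upd_upd i (u v : seq 'I_(n i)) w : upd (upd w u) v = upd w v.
Proof.
apply/ffunP => i'; have [<-|ii'] := eqVneq i i'; first by rewrite !updE.
by rewrite !updE_neq.
Qed.

Lemma push_inj i (j : 'I_(n i)) : injective (push j).
Proof.
move=> u v uv; have e i' : push j u i' = push j v i' by rewrite uv.
apply/ffunP => i'; have [<-|ii'] := eqVneq i i'.
  by have := e i; rewrite !updE => -[].
by have := e i'; rewrite !updE_neq.
Qed.

Lemma incE i (j : 'I_(n i)) q j' : inc j q i j' = (q i j' + (j' == j))%N.
Proof. by rewrite !ffunE eq_Tagged. Qed.

Lemma incE_neq i (j : 'I_(n i)) q i' : i != i' -> inc j q i' = q i'.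
Proof.
move=> ii'; apply/ffunP => j'; rewrite !ffunE.
rewrite (_ : (_ == _) = false) ?addn0//; apply/eqP => /(congr1 tag) /= e.
by rewrite e eqxx in ii'.
Qed.

Lemma minc_inj i (j : 'I_(n i)) : injective (inc j).
Proof.
move=> p q pq; apply/ffunP => i'; apply/ffunP => j'.
by have := congr1 (fun r : mindex => r i' j') pq; rewrite !ffunE => /addIn.
Qed.

Lemma tp_push i (j : 'I_(n i)) w : tp (push j w) = inc j (tp w).
Proof.
apply/ffunP => i'; rewrite ffunE; have [<-|ii'] := eqVneq i i'.
  apply/ffunP => j'; rewrite updE incE cnt_cons !ffunE addnC.
  by rewrite [j == j']eq_sym.
by rewrite updE_neq// incE_neq// ffunE.
Qed.

Lemma deg_inc i (j : 'I_(n i)) q : deg (inc j q) = (deg q).+1.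
Proof.
rewrite /deg (bigD1 i)//= [in RHS](bigD1 i)//= -addSn; congr (_ + _)%N.
  under eq_bigr do rewrite incE.
  rewrite big_split/= -addn1; congr (_ + _)%N.
  by rewrite (bigD1 j)//= eqxx big1// => j' /negbTE ->.
apply: eq_bigr => i' ii'; apply: eq_bigr => j' _.
by rewrite incE_neq// eq_sym.
Qed.

Lemma deg_tp w : deg (tp w) = (\sum_i size (w i))%N.
Proof. by apply: eq_bigr => i _; rewrite size_cnt ffunE. Qed.

Lemma deg0 q : deg q = 0%N -> q = tp (mword1 n).
Proof.
move=> q0; apply/ffunP => i; apply/ffunP => j; rewrite !ffunE /=.
apply/eqP; rewrite -leqn0 -q0 /deg (bigD1 i)//= (bigD1 j)//= -addnA leq_addr//.
Qed.

Lemma inc_pred q : deg q != 0%N -> exists i (j : 'I_(n i)) p, q = inc j p.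
Proof.
move=> q0; have [i [j qij]] : exists i (j : 'I_(n i)), q i j != 0%N.
  apply: contrapT => h; move/eqP: q0; apply; apply: big1 => i _; apply: big1 => j _.
  by apply/eqP/negPn/negP => qij; apply: h; exists i, j.
exists i, j, [ffun i' => [ffun j' => (q i' j' - (Tagged (fun i => 'I_(n i)) j' ==
                                      Tagged (fun i => 'I_(n i)) j))%N]].
apply/ffunP => i'; apply/ffunP => j'; rewrite !ffunE; case: eqP => e; last by rewrite subn0 addn0.
rewrite subnK// lt0n.
by have /= -> := congr1 (fun x : {i & 'I_(n i)} => q (tag x) (tagged x)) e.
Qed.

(** Induction on the degree, one letter at a time. *)
Lemma tp_surj q : exists w, tp w = q.
Proof.
elim: (deg q) {-2}q (erefl (deg q)) => [|d IH] {}q dq.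
  by exists (mword1 n); rewrite (deg0 dq).
have [|i [j [p qp]]] := @inc_pred q; first by rewrite dq.
move: dq; rewrite qp deg_inc => -[/IH[w <-]].
by exists (push j w); rewrite tp_push.
Qed.

Definition mono (R : comNzRingType) (z : forall i, 'I_(n i) -> R) q : R := \prod_i \prod_j z i j ^+ q i j.

Lemma mono_inc (R : comNzRingType) (z : forall i, 'I_(n i) -> R) i (j : 'I_(n i)) q :
  mono z (inc j q) = z i j * mono z q.
Proof.
rewrite /mono (bigD1 i)//= [in RHS](bigD1 i)//= mulrA; congr (_ * _).
  under eq_bigr do rewrite incE exprD.
  rewrite big_split/= mulrC; congr (_ * _).
  by rewrite (bigD1 j)//= eqxx expr1 big1 ?mulr1// => j' /negbTE ->.
apply: eq_bigr => i' ii'; apply: eq_bigr => j' _.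
by rewrite incE_neq// eq_sym.
Qed.

End Types.

Section Weights.
Context {R : realType} {k : nat} {n : 'I_k -> nat}.
Variables (m : 'I_k -> nat) (a : forall i, seq 'I_(n i) -> R).
Arguments a : clear implicits.
Hypotheses (a0 : forall i w, 0 <= a i w) (anil : forall i, a i [::] = 0)
  (agen : forall i j, 0 < a i [:: j]) (m1 : forall i, (1 <= m i)%N).
Local Notation mindex := {dffun forall i : 'I_k, {ffun 'I_(n i) -> nat}}.
Implicit Types (w : mword n) (q : mindex).

Definition beta w : R := \prod_i b m a (w i).

Definition Gam q : R := \prod_i gammacoef (m i) (a i) (q i).

Lemma b_gt0 i (w : seq 'I_(n i)) : 0 < b m a w.
Proof. exact: bcoef_gt0. Qed.

Lemma beta_gt0 w : 0 < beta w.
Proof. by apply: prodr_gt0 => i _; exact: b_gt0. Qed.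

Lemma beta_ge0 w : 0 <= beta w. Proof. exact/ltW/beta_gt0. Qed.

(** Stated as a product, because the factors of [beta] other than the [i]-th
    are left alone and only the [i]-th changes. *)
Lemma beta_upd w i (v : seq 'I_(n i)) : beta (upd w v) * b m a (w i) = beta w * b m a v.
Proof.
rewrite /beta (bigD1 i)//= [in RHS](bigD1 i)//= updE.
rewrite (eq_bigr (fun i' => b m a (w i'))); first by ring.
by move=> i' ii'; rewrite updE_neq// eq_sym.
Qed.

(** Distributivity of the product over the sums. The bound [N] on the
    lengths makes the sums finite without the choice of a finite set of
    words in each factor. *)
Lemma esum_prod N (F : forall i, seq 'I_(n i) -> R) : (forall i v, 0 <= F i v) ->
  (\esum_(w in [set: mword n])
     (if [forall i, (size (w i) <= N)%N] then \prod_i F i (w i) else 0)%:E =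
   (\prod_i \sum_(u : {bseq N of 'I_(n i)}) F i u)%:E)%E.
Proof.
move=> F0; pose T_ i : finType := {bseq N of 'I_(n i)}.
pose e (t : fprod T_) : mword n := [ffun i => bseqval (t i)].
rewrite (@esum_inj _ _ _ e); first last.
- move=> w we; case: ifPn => // /fintype.forallP wN; case: (we [fprod i => Bseq (wN i)]).
  by apply/ffunP => i; rewrite ffunE fprodE.
- move=> t u tu; apply/(@fprodP _ T_) => i; apply/val_inj.
  by have /ffunP/(_ i) := tu; rewrite !ffunE.
have eN t : [forall i, (size (e t i) <= N)%N].
  by apply/fintype.forallP => i; rewrite ffunE size_bseq.
transitivity (\esum_(t in [set: fprod T_]) (\prod_i F i (t i))%:E)%E.
  apply: eq_esum => t _; rewrite eN; congr EFin.
  by apply: eq_bigr => i _; rewrite ffunE.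
rewrite esum_finType => [|t]; last by rewrite prodr_ge0.
congr EFin; pose P_ i : {ffun T_ i -> R} := [ffun u : T_ i => F i u].
transitivity (\sum_(t : fprod T_) \prod_(i in 'I_k) P_ i (t i)).
  by apply: eq_bigr => t _; apply: eq_bigr => i _; rewrite ffunE.
transitivity (\prod_i \sum_(x in tagged_with T_ i) untag 0 (P_ i) x).
  by rewrite big_fprod bigA_distr_big_dep.
apply: eq_bigr => i _; rewrite -(big_tag (fun i => P_ i)).
by apply: eq_bigr => u _; rewrite ffunE.
Qed.

Lemma gammacoefE N i (q : {ffun 'I_(n i) -> nat}) : (\sum_j q j <= N)%N ->
  gammacoef (m i) (a i) q = \sum_(u : {bseq N of 'I_(n i)}) (cnt u == q)%:R * b m a u.
Proof.
move=> qN; rewrite /gammacoef.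
rewrite (reindex_fsbig (fun u : {bseq N of 'I_(n i)} => bseqval u) [set u | cnt u = q]); last first.
  split => [u /= /LambdaE//|u v _ _ uv|w /LambdaE wq]; first exact/val_inj.
  have wN : (size w <= N)%N by rewrite size_cnt wq.
  by exists (Bseq wN).
rewrite fsbig_mkcond /=.
have -> : [set: {bseq N of 'I_(n i)}] = [set` index_enum {bseq N of 'I_(n i)}].
  by apply/seteqP; split => x _ //=; rewrite mem_index_enum.
rewrite -fsbig_seq ?index_enum_uniq//; apply: eq_bigr => u _.
rewrite /patch; case: ifPn => [/set_mem /= ->|/negP uq]; first by rewrite eqxx mul1r.
by case: eqP => [e|]; rewrite ?mul0r//; case: uq; exact/mem_set.
Qed.

(** The type of a multiword is the family of the types of its components, so
    the sum over a fibre splits into a product. *)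
Lemma esum_beta q : (\esum_(w in [set w | tp w = q]) (beta w)%:E = (Gam q)%:E)%E.
Proof.
pose F i (v : seq 'I_(n i)) := (cnt v == q i)%:R * b m a v.
have qdeg i : (\sum_j q i j <= deg q)%N by rewrite /deg (bigD1 i)//= leq_addr.
have -> : Gam q = \prod_i \sum_(u : {bseq (deg q) of 'I_(n i)}) F i u.
  by apply: eq_bigr => i _; rewrite (gammacoefE (qdeg i)).
rewrite -esum_prod => [|i v]; last by rewrite mulr_ge0// ltW// b_gt0.
rewrite esum_mkcond; apply: eq_esum => w _; case: ifPn => [/set_mem /= wq|/negP wq].
  rewrite ifT; last first.
    by apply/fintype.forallP => i; rewrite (leq_trans _ (qdeg i))// size_cnt -wq ffunE.
  by congr EFin; apply: eq_bigr => i _; rewrite /F -wq ffunE eqxx mul1r.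
case: ifPn => // _; congr EFin.
have [i /eqP wi] : exists i, cnt (w i) <> q i.
  apply: contrapT => h; apply: wq; apply/mem_set/ffunP => i; rewrite ffunE.
  by apply: contrapT => wi; apply: h; exists i.
by rewrite (bigD1 i)//= /F (negbTE wi) !mul0r.
Qed.

Lemma Gam_gt0 q : 0 < Gam q.
Proof.
have [w wq] := tp_surj q.
rewrite -lte_fin -esum_beta; apply: (@lt_le_trans _ _ (beta w)%:E).
  by rewrite lte_fin beta_gt0.
apply: esum_ge; exists [set w]; first by split => // _ ->.
by rewrite fsbig_set1.
Qed.

Lemma Gam_ge0 q : 0 <= Gam q. Proof. exact/ltW/Gam_gt0. Qed.

Lemma beta_push i (j : 'I_(n i)) w : a i [:: j] * beta w <= beta (push j w).
Proof.
rewrite -(ler_pM2r (b_gt0 (w i))) beta_upd mulrAC mulrC ler_wpM2l ?beta_ge0//.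
exact: bcoef_cons.
Qed.

(** Prepending a letter maps the fibre over [q] injectively into the fibre
    over [inc j q], and [beta_push] compares the weights. *)
Lemma Gam_inc i (j : 'I_(n i)) q : a i [:: j] * Gam q <= Gam (inc j q).
Proof.
rewrite -lee_fin EFinM -!esum_beta -esumZ_set; [|exact/ltW/agen|exact: beta_ge0].
apply: (@le_trans _ _ (\esum_(w in [set w | tp w = q]) (beta (push j w))%:E)%E).
  by apply: le_esum => w _; rewrite lee_fin beta_push.
rewrite -(esum_image _ (push j) (fun w => (beta w)%:E)); last by move=> u v _ _; exact: push_inj.
apply: ge_ereal_sup => _ [X [finX sX]] <-; apply: esum_ge; exists X => //.
by split=> // w /sX[v /= <- <-]; rewrite tp_push.
Qed.

Section Kernel.
Variable z : forall i, 'I_(n i) -> R[i].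
Arguments z : clear implicits.
Hypothesis Dz : D a z.

Lemma sqmodM (x y : R[i]) : sqmod (x * y) = sqmod x * sqmod y.
Proof. by rewrite !sqmodE modcM exprMn. Qed.

Lemma sqmod1 : sqmod (1 : R[i]) = 1.
Proof. by rewrite /sqmod/= expr1n expr0n/= addr0. Qed.

Lemma sqmod_prod (X : Type) (s : seq X) (f : X -> R[i]) :
  sqmod (\prod_(x <- s) f x) = \prod_(x <- s) sqmod (f x).
Proof. by apply: (big_morph _ sqmodM sqmod1). Qed.

Lemma mono_tp w : mono z (tp w) = \prod_i wordprod (z i) (w i).
Proof. by apply: eq_bigr => i _; rewrite wordprod_cnt ffunE. Qed.

(** The sum over types is a sum over multiwords of a product over [i], and
    each factor is bounded by [sum_bcoef_le]. *)
Lemma kernel_summable : rsummable (fun q => sqmod (mono z q) * Gam q).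
Proof.
apply/rsummableP => [q|]; first by rewrite mulr_ge0 ?sqmod_ge0 ?Gam_ge0.
rewrite -(esum_fiber beta_ge0 esum_beta); last by move=> q; exact: sqmod_ge0.
pose T i := (\esum_(w in [set w | (0 < size w)%N]) (a i w * sqmod (wordprod (z i) w))%:E)%E.
have Tt i : T i = (fine (T i))%:E.
  rewrite fineK// ge0_fin_numE; first by rewrite (lt_trans (Dz i))// ltry.
  by apply: esum_ge0 => w _; rewrite lee_fin mulr_ge0// sqmod_ge0.
have t1 i : fine (T i) < 1 by rewrite -lte_fin -Tt; exact: Dz.
pose F i (v : seq 'I_(n i)) := b m a v * sqmod (wordprod (z i) v).
have F0 i v : 0 <= F i v by rewrite mulr_ge0 ?sqmod_ge0// ltW// b_gt0.
apply: (@le_lt_trans _ _ (\prod_i (1 - fine (T i)) ^- m i)%:E); last by rewrite ltry.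
apply: esum_le_seq => s us; set N := (\max_(w <- s) deg (tp w))%N.
apply: (@le_trans _ _ (\prod_i \sum_(u : {bseq N of 'I_(n i)}) F i u)).
  rewrite -lee_fin -esum_prod//.
  apply: le_trans (esum_ge_seq _ us); rewrite lee_fin.
  rewrite big_seq [leRHS]big_seq; apply: ler_sum => w ws.
  rewrite ifT; last first.
    apply/fintype.forallP => i; apply: (@leq_trans (deg (tp w))).
      by rewrite deg_tp (bigD1 i)//= leq_addr.
    exact: leq_bigmax_seq.
  by rewrite mono_tp sqmod_prod mulrC /beta -big_split.
apply: ler_prod => i _; rewrite sumr_ge0//=.
rewrite -(big_map (@bseqval _ _) xpredT (F i)).
have us' : uniq [seq bseqval x | x <- index_enum {bseq N of 'I_(n i)}].
  by rewrite map_inj_uniq ?index_enum_uniq//; exact: val_inj.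
have rM u v : sqmod (wordprod (z i) (u ++ v)) = sqmod (wordprod (z i) u) * sqmod (wordprod (z i) v).
  by rewrite /wordprod big_cat sqmodM.
have r1 : sqmod (wordprod (z i) [::]) = 1 by rewrite /wordprod big_nil sqmod1.
have r0 (v : seq 'I_(n i)) : 0 <= sqmod (wordprod (z i) v) by exact: sqmod_ge0.
exact: (sum_bcoef_le (@a0 i) (@anil i) (@m1 i) r0 r1 rM (t1 i) (Tt i) us').
Qed.

End Kernel.

End Weights.

(** * Coordinates on the symmetric space *)

(** Adjacent transpositions generate all permutations. *)
Lemma perm_eq_invariant (T : eqType) (S : Type) (F : seq T -> S) :
  (forall u x y v, F (u ++ x :: y :: v) = F (u ++ y :: x :: v)) ->
  forall s t, perm_eq s t -> F s = F t.
Proof.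
move=> Fs s t st; elim: s t F Fs st => [|x s IH] t F Fs st.
  by move: st; rewrite perm_sym => /perm_nilP ->.
have xt : x \in t by rewrite -(perm_mem st) mem_head.
case/splitPr: xt st => t1 t2; rewrite perm_sym -[x :: t2]cat1s perm_catCA /= perm_cons perm_sym => st.
rewrite (IH _ (fun v => F (x :: v)) _ st) => [|u y z v]; last exact: (Fs (x :: u)).
elim: t1 {st} F Fs => [//|y t1 IH1] F Fs /=.
by rewrite (Fs [::]) (IH1 (fun v => F (y :: v)))// => u ? ? v; exact: (Fs (y :: u)).
Qed.

Lemma cnt_perm n (s t : seq 'I_n) : cnt s = cnt t -> perm_eq s t.
Proof.
move=> /ffunP st; apply/allP => j _ /=.
by have := st j; rewrite !ffunE => ->.
Qed.


Lemma conjCM (R : realType) (x y : R[i]) : (x * y)^* = x^* * y^*.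
Proof. exact: rmorphM. Qed.

Lemma neqC0 (R : realType) (x : R) : (x%:C != 0 :> R[i]) = (x != 0).
Proof. by rewrite -(inj_eq (@complexI R)). Qed.

Section Monomials.
Context {R : realType} {K : monomType}.
Implicit Types (u v p : K).

Lemma malg_commutator p u v : << p >> * (<< u >> * << v >> - << v >> * << u >>) =
  << mmul p (mmul u v) >> - << mmul p (mmul v u) >> :> {malg R[i][K]}.
Proof.
have UU (p1 p2 : K) : << p1 >> * << p2 >> = << mmul p1 p2 >> :> {malg R[i][K]}.
  by rewrite malgM_def fgmulUU mulr1.
by rewrite mulrBr !UU.
Qed.

Lemma mmap_conjB (h : K -> R[i]) u v :
  mmap (Num.conj : R[i] -> R[i]) h (<< u >> - << v >>) = h u - h v.
Proof. by rewrite mmapB !mmapU /= !rmorph1 !mul1r. Qed.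

End Monomials.

Section Coordinates.
Context {R : realType} {k : nat} {n : 'I_k -> nat}.
Variables (m : 'I_k -> nat) (a : forall i, seq 'I_(n i) -> R).
Arguments a : clear implicits.
Hypotheses (a0 : forall i w, 0 <= a i w) (anil : forall i, a i [::] = 0)
  (agen : forall i j, 0 < a i [:: j]) (m1 : forall i, (1 <= m i)%N).
Local Notation C := R[i].
Local Notation mindex := {dffun forall i : 'I_k, {ffun 'I_(n i) -> nat}}.
Local Notation beta := (beta m a).
Local Notation Gam := (Gam m a).
Local Notation NQ := (NQ m a).
Implicit Types (w v : mword n) (q : mindex) (d : mindex -> C) (f g : mword n -> mword n).

Let beta_gt0 w : 0 < beta w. Proof. exact: beta_gt0. Qed.
Let Gam_gt0 q : 0 < Gam q. Proof. exact: Gam_gt0. Qed.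

(** [Wadj f] is the adjoint of the operator that sends [e_v] to [sqrt (beta
    v / beta (f v)) e_(f v)]. Working with adjoints keeps all coordinates
    explicit and makes composites collapse ([Wadj_comp]). *)
Definition Wadj f (x : mword n -> C) : mword n -> C :=
  fun v => (Num.sqrt (beta v / beta (f v)))%:C * x (f v).

Lemma Wadj_comp f g x : Wadj f (Wadj g x) = Wadj (g \o f) x.
Proof.
apply/funext => v; rewrite /Wadj mulrA -rmorphM -sqrtrM/=; last by rewrite divr_ge0// ltW.
by congr ((Num.sqrt _)%:C * _); rewrite mulrA mulfVK// gt_eqF.
Qed.

Lemma Wadj_id f x : (forall v, f v = v) -> Wadj f x = x.
Proof.
move=> fv; apply/funext => v; rewrite /Wadj fv divff; last by rewrite gt_eqF.
by rewrite sqrtr1 mul1r.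
Qed.

Lemma W_out i (j : 'I_(n i)) x w : (forall v, w <> push j v) -> W m a j x w = 0.
Proof.
move=> wj; rewrite /W; case E : (w i) => [//|j' u]; case: eqP => // jj'.
case: (wj (upd w u)); rewrite /push upd_upd updE upd_id// -jj' E//.
Qed.

Lemma W_push i (j : 'I_(n i)) x v :
  W m a j x (push j v) = (Num.sqrt (beta v / beta (push j v)))%:C * x v.
Proof.
rewrite /W updE eqxx; congr ((Num.sqrt _)%:C * x _); last by rewrite upd_upd upd_id.
have bv := b_gt0 a0 anil agen m1 (v i); have bjv := b_gt0 a0 anil agen m1 (j :: v i).
apply/eqP; rewrite eqr_div; [|by rewrite gt_eqF..].
by rewrite -(beta_upd m a v (j :: v i)) mulrC.
Qed.

(** The image of [W j] lives on the words [push j v], so the sum can be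
    indexed by [v]. *)
Lemma W_adj i (j : 'I_(n i)) x y : fdot x (W m a j y) = fdot (Wadj (push j) x) y.
Proof.
rewrite /fdot (@csum_inj _ _ _ (push j)); [|exact: push_inj|]; last first.
  by move=> w wj; rewrite W_out// rmorph0 mulr0.
congr csum; apply/funext => v /=; rewrite W_push /Wadj rmorphM/= conjCR.
by rewrite mulrA [x _ * _]mulrC.
Qed.

Lemma Wfold_adj i (u : seq 'I_(n i)) x y :
  fdot x (foldr (@W _ _ _ m a i) y u) = fdot (Wadj (fun v => upd v (u ++ v i)) x) y.
Proof.
elim: u x => [|j u IH] x /=.
  by rewrite Wadj_id// => v; rewrite upd_id.
rewrite W_adj IH Wadj_comp.
have -> // : push j \o (fun v => upd v (u ++ v i)) = fun v => upd v (j :: u ++ v i).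
by apply/funext => v /=; rewrite /push upd_upd updE.
Qed.

(** The factors for distinct [i] prepend letters to distinct components, so
    together they prepend [w]. *)
Lemma Wword_adj w x y : fdot x (Wword m a w y) = fdot (Wadj (mword_cat w) x) y.
Proof.
have -> : mword_cat w = foldr (fun i v => upd v (w i ++ v i)) ^~ (enum 'I_k).
  apply/funext => v; apply/ffunP => i; rewrite ffunE.
  have : i \in enum 'I_k by rewrite mem_enum.
  elim: (enum 'I_k) (enum_uniq 'I_k) => [//|i' s IH] /= /andP[i's us].
  rewrite inE; have [e _|ii' /= si] := eqVneq i i'.
    subst i'; rewrite updE; congr (_ ++ _); elim: s i's {IH us} => [//|i1 s IH] /=.
    rewrite inE negb_or => /andP[ii1 /IH ->].
    by rewrite updE_neq// eq_sym.
  by rewrite updE_neq ?IH// eq_sym.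
rewrite /Wword; elim: (enum 'I_k) x => [|i s IH] x /=.
  by rewrite Wadj_id.
by rewrite Wfold_adj IH Wadj_comp.
Qed.

(** The squared weights are at most [1 / a_j], by [beta_push]. *)
Lemma W_l2 i (j : 'I_(n i)) x : x \in @l2pred R (mword n) -> W m a j x \in @l2pred R (mword n).
Proof.
move=> /l2predE lx; apply/l2predE/rsummableP => [w|]; first exact: sqmod_ge0.
rewrite (@esum_inj _ _ _ (push j)); [|exact: push_inj|]; last first.
  by move=> w wj; rewrite W_out// /sqmod/= expr0n addr0.
apply/(rsummableP (f := fun v => sqmod (W m a j x (push j v)))) => [v|]; first exact: sqmod_ge0.
apply: (rsummable_le (rsummableZ (a i [:: j])^-1 lx)) => v.
rewrite ger0_norm ?sqmod_ge0// W_push sqmodM ler_wpM2r ?sqmod_ge0//.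
rewrite sqmodE modcR (ger0_norm (sqrtr_ge0 _)) sqr_sqrtr; last by rewrite divr_ge0// ltW.
by rewrite ler_pdivrMr// mulrC ler_pdivlMr// mulrC; exact: beta_push.
Qed.

Lemma Wword_l2 w x : x \in @l2pred R (mword n) -> Wword m a w x \in @l2pred R (mword n).
Proof.
move=> lx; rewrite /Wword; elim: (enum 'I_k) => [//|i s IH] /=.
by elim: (w i) => [//|j u IHu] /=; exact: W_l2.
Qed.

Definition Wwordl w (y : l2 R (mword n)) : l2 R (mword n) :=
  exist _ (Wword m a w (\val y)) (Wword_l2 w (valP y)).

Lemma Wpoly_l2 (g : {malg C[mword n]}) (y : l2 R (mword n)) :
  Wpoly m a g (\val y) = \val (\sum_(w <- msupp g) g@_w *: Wwordl w y).
Proof.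
rewrite /Wpoly; elim/big_rec2: _ => [//|w u v _ ->].
by apply/funext => i.
Qed.

(** The scalar product with [g (W) y] is a conjugate linear form in [g],
    given by its values on words. *)
Lemma fdot_Wpoly (g : {malg C[mword n]}) (x y : l2 R (mword n)) :
  fdot (\val x) (Wpoly m a g (\val y)) =
  mmap (Num.conj : C -> C) (fun w => fdot (Wadj (mword_cat w) (\val x)) (\val y)) g.
Proof.
rewrite Wpoly_l2 -/(dot _ _) dotC dot_suml rmorph_sum mmapE; apply: eq_bigr => w _.
by rewrite dotZl rmorphM/= -dotC; congr (_ * _); exact: Wword_adj.
Qed.

Definition addq (p q : mindex) : mindex := [ffun i => [ffun j => (p i j + q i j)%N]].

Lemma mword_catE v w i : mword_cat v w i = v i ++ w i.
Proof. by rewrite ffunE. Qed.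

Lemma mword1E i : mword1 n i = [::]. Proof. by rewrite ffunE. Qed.

Lemma tp_cat v w : tp (mword_cat v w) = addq (tp v) (tp w).
Proof.
by apply/ffunP => i; apply/ffunP => j; rewrite !ffunE count_cat.
Qed.

Lemma addqC : commutative addq.
Proof. by move=> p q; apply/ffunP => i; apply/ffunP => j; rewrite !ffunE addnC. Qed.

(** The polynomials whose abelianization vanishes form a left ideal that
    contains the commutators. Vanishing is tested against all functions
    [Phi] of the type. *)
Lemma Qc_abelian (g : {malg C[mword n]}) (Phi : mindex -> C) : @Qc k n R g ->
  mmap (Num.conj : C -> C) (Phi \o @tp k n) g = 0.
Proof.
pose K := [set g : {malg C[mword n]} | forall Phi : mindex -> C,
  mmap (Num.conj : C -> C) (Phi \o @tp k n) g = 0].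
suff QK : @Qc k n R `<=` K by move=> /QK; exact.
apply: smallest_sub.
  split => [F|p x y Kx Ky F]; first exact: mmap0.
  rewrite mmapD Ky addr0 malgME raddf_sum big1//= => u _.
  rewrite raddf_sum /=.
  pose Fu q := F (addq (tp u) q).
  have := Kx Fu; rewrite mmapE => Kx0.
  rewrite (eq_bigr (fun v => (p@_u)^* * ((x@_v)^* * Fu (tp v)))) => [|v _].
    by rewrite -big_distrr/= Kx0 mulr0.
  rewrite mmapU/= rmorphM/= -mulrA; congr (_ * (_ * _)); congr F.
  by rewrite -tp_cat.
move=> _ [i [j1 [j2 ->]]] F.
rewrite mmapB !malgM_def !fgmulUU !mmapU mulr1 /= !rmorph1 !mul1r.
apply/eqP; rewrite subr_eq0; apply/eqP; congr F.
exact: etrans (tp_cat _ _) (etrans (addqC _ _) (esym (tp_cat _ _))).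
Qed.

(** The normalization for which the power series of [vecf d] is [sum_q d q z
    ^ q]. *)
Definition vecf d : mword n -> C := fun w => (Num.sqrt (beta w) / Gam (tp w))%:C * d (tp w).

Lemma esum_vecf d :
  (\esum_(w in [set: mword n]) (sqmod (vecf d w))%:E = h2norm2 m a d)%E.
Proof.
transitivity (\esum_(q in [set: mindex]) (sqmod (d q) / Gam q ^+ 2 * Gam q)%:E)%E.
  rewrite -(@esum_fiber _ _ _ _ _ _ (beta_ge0 a0 anil agen m1) (esum_beta a0 anil agen m1)
     (fun q => sqmod (d q) / Gam q ^+ 2)) => [|q]; last first.
    by rewrite divr_ge0 ?sqmod_ge0// sqr_ge0.
  apply: eq_esum => w _; congr EFin; rewrite /vecf sqmodM sqmodE modcR.
  rewrite ger0_norm ?divr_ge0 ?sqrtr_ge0//; last exact/ltW.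
  by rewrite expr_div_n sqr_sqrtr; [ring|exact/ltW].
apply: eq_esum => q _; congr EFin.
by rewrite -/(Gam q); field; rewrite gt_eqF.
Qed.

Definition l2_of (x : mword n -> C) (lx : x \in @l2pred R (mword n)) : l2 R (mword n) :=
  exist _ x lx.

Lemma delta_l2 v : delta v \in @l2pred R (mword n).
Proof.
apply/l2predE/rsummableP => [w|]; first exact: sqmod_ge0.
apply: (@le_lt_trans _ _ 1%:E); last exact: ltry.
apply: esum_le_seq => s us; rewrite (eq_bigr (fun w => (if w == v then 1%N else 0%N)%:R)) => [|w _].
  by rewrite -natr_sum -big_mkcond sum1_count lern1 -/(count_mem v s) count_uniq_mem// leq_b1.
by rewrite /delta; case: eqP => _; rewrite /sqmod/= ?expr0n ?expr1n/= addr0.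
Qed.

Lemma fdot_delta (x : mword n -> C) v : fdot x (delta v) = x v.
Proof.
rewrite /fdot (@csum_single _ _ v) => [|w wv]; first by rewrite /delta eqxx rmorph1 mulr1.
by rewrite /delta; case: eqP => [/wv//|_]; rewrite rmorph0 mulr0.
Qed.

Fact ncoef_key : unit. Proof. by []. Qed.

Section InNQ.
Variable x : NQ.

(** Orthogonality of [x] to the image of the basis vector at [v] under [Z_u
    (Z_j1 Z_j2 - Z_j2 Z_j1)]. The other components of [w] are put into the
    factor [Z_u]. *)
Lemma NQ_swap w i u j1 j2 (v : seq 'I_(n i)) :
  \val (\val x) (upd w (u ++ j1 :: j2 :: v)) / (Num.sqrt (beta (upd w (u ++ j1 :: j2 :: v))))%:C =
  \val (\val x) (upd w (u ++ j2 :: j1 :: v)) / (Num.sqrt (beta (upd w (u ++ j2 :: j1 :: v))))%:C.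
Proof.
pose v0 := upd (mword1 n) v.
pose mw (u1 u2 : seq 'I_(n i)) : mword n :=
  mmul (upd w u) (mmul (upd (mword1 n) u1) (upd (mword1 n) u2)).
pose g : {malg C[mword n]} := << mw [:: j1] [:: j2] >> - << mw [:: j2] [:: j1] >>.
have Qg : Qc g.
  move=> K [[K0 KM] Kg].
  have /(KM << upd w u >> _ 0) : K (Zvar j1 * Zvar j2 - Zvar j2 * Zvar j1).
    by apply: Kg; exists i, j1, j2.
  by move=> /(_ K0); rewrite addr0 malg_commutator.
pose y0 := l2_of (delta_l2 v0).
pose y := \sum_(w <- msupp g) g@_w *: Wwordl w y0.
have My : MQ m a y.
  move=> e e0; exists y; last by rewrite subrr l2norm0.
  move=> K [_ SK]; apply: SK; exists g => //; exists y0.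
  by rewrite Wpoly_l2.
have xy : dot (\val x) y = 0 by have /asboolP := valP x; apply.
have : mmap (Num.conj : C -> C)
    (fun w => fdot (Wadj (mword_cat w) (\val (\val x))) (\val y0)) g = 0.
  by rewrite -fdot_Wpoly Wpoly_l2.
rewrite /g mmap_conjB !fdot_delta.
have cj (u1 u2 : seq 'I_(n i)) : mword_cat (mword_cat (upd w u) (mword_cat (upd (mword1 n) u1) (upd (mword1 n) u2))) v0
    = upd w (u ++ u1 ++ u2 ++ v).
  apply/ffunP => i'; rewrite !mword_catE; have [<-|ii'] := eqVneq i i'.
    by rewrite !updE -!catA.
  by rewrite !updE_neq// !mword1E !cats0.
have E (u1 u2 : seq 'I_(n i)) : Wadj (mword_cat (mw u1 u2))
    (\val (\val x)) v0 = (Num.sqrt (beta v0))%:C *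
   (\val (\val x) (upd w (u ++ u1 ++ u2 ++ v)) / (Num.sqrt (beta (upd w (u ++ u1 ++ u2 ++ v))))%:C).
  rewrite /Wadj cj sqrtrM ?ltW// sqrtrV ?ltW// rmorphM/= fmorphV/=.
  by rewrite -mulrA [_^-1 * _]mulrC.
rewrite !E -mulrBr => /eqP; rewrite mulf_eq0 subr_eq0 => /orP[/eqP|/eqP//].
move=> /(congr1 (@complex.Re R)) /= /eqP; rewrite sqrtr_eq0 leNgt beta_gt0//.
Qed.

(** The letters are permuted in one component after the other. *)
Lemma NQ_tp v w : tp v = tp w ->
  \val (\val x) v / (Num.sqrt (beta v))%:C = \val (\val x) w / (Num.sqrt (beta w))%:C.
Proof.
move=> vw; pose X v := \val (\val x) v / (Num.sqrt (beta v))%:C.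
have Xupd i (u : seq 'I_(n i)) v0 : cnt u = cnt (v0 i) -> X (upd v0 u) = X v0.
  move=> /cnt_perm uv; rewrite -[in RHS](upd_id (w := v0) (erefl (v0 i))).
  apply: (perm_eq_invariant (F := fun u => X (upd v0 u))) uv => *.
  exact: NQ_swap.
have -> : w = foldr (fun i v => upd v (w i)) v (enum 'I_k).
  apply/ffunP => i; have : i \in enum 'I_k by rewrite mem_enum.
  elim: (enum 'I_k) => [//|i' s IH] /=; rewrite inE.
  have [e _|ii' /= si] := eqVneq i i'; first by subst i'; rewrite updE.
  by rewrite updE_neq ?IH// eq_sym.
suff H s : X (foldr (fun i v => upd v (w i)) v s) = X v /\
    forall i, cnt (foldr (fun i v => upd v (w i)) v s i) = cnt (w i).
  by have [e _] := H (enum 'I_k); exact: (esym e).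
elim: s => [|i s [IH1 IH2]] /=.
  by split => // i; have /ffunP/(_ i) := vw; rewrite !ffunE.
rewrite Xupd ?IH2//; split => // i'.
by have [<-|ii'] := eqVneq i i'; [rewrite updE|rewrite updE_neq].
Qed.

(** The value at an arbitrary word of each type; by [NQ_tp] the choice is
    immaterial. *)
Definition ncoef : mindex -> C := locked_with ncoef_key (fun q =>
  \val (\val x) (projT1 (cid (tp_surj q))) / (Num.sqrt (beta (projT1 (cid (tp_surj q)))))%:C
    * (Gam q)%:C).

Lemma val_coef : \val (\val x) = vecf ncoef.
Proof.
apply/funext => w; rewrite /vecf /ncoef unlock; case: cid => v /= vw.
rewrite (NQ_tp vw) rmorphM fmorphV /=.
by field; rewrite !neqC0 !gt_eqF// sqrtr_gt0.
Qed.

End InNQ.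

(** The coefficients of [Wadj (mword_cat w) (vecf d)] depend on [w] only
    through its type, so that [Qc_abelian] applies. *)
Lemma vecf_in_NQ (y : l2 R (mword n)) d : \val y = vecf d -> y \in orthopred (MQ m a).
Proof.
move=> yd.
pose c q v := (Num.sqrt (beta v) / Gam (addq q (tp v)))%:C * d (addq q (tp v)).
have VK w : Wadj (mword_cat w) (vecf d) = c (tp w).
  apply/funext => v; rewrite /Wadj /vecf /c tp_cat mulrA -rmorphM/=.
  congr (_%:C * _); rewrite mulrA; congr (_ / _).
  rewrite sqrtrM ?(ltW (beta_gt0 _))// sqrtrV ?(ltW (beta_gt0 _))//.
  by rewrite mulfVK// gt_eqF// sqrtr_gt0.
have Hpoly (g : {malg C[mword n]}) (x : l2 R (mword n)) : Qc g ->
    fdot (\val y) (Wpoly m a g (\val x)) = 0.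
  move=> Qg; rewrite fdot_Wpoly -[RHS](Qc_abelian (fun q => fdot (c q) (\val x)) Qg).
  by rewrite !mmapE; apply: eq_bigr => w _; rewrite yd VK.
pose K := [set u : l2 R (mword n) | dot y u = 0].
have KM : lspan [set y | exists2 g, Qc g & exists x : l2 R (mword n),
    \val y = Wpoly m a g (\val x)] `<=` K.
  apply: smallest_sub.
    split => [|r u v uK vK]; first by rewrite /K/= dot0r.
    by rewrite /K/= dotDr dotZr uK vK mulr0 addr0.
  by move=> u [g Qg [x ux]]; rewrite /K/= /dot ux Hpoly.
apply/asboolP => u Mu; apply/modc_eq0/eqP; rewrite eq_le modc_ge0 andbT.
apply/ler_addgt0Pr => e e0; rewrite add0r.
have y1 : 0 < l2norm y + 1 by rewrite ltr_pwDr ?l2norm_ge0.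
have [|v /KM Kv uv] := Mu (e / (l2norm y + 1)); first by rewrite divr_gt0.
rewrite -[u](subrK v) dotDr Kv addr0 (le_trans (cauchy_schwarz _ _))//.
rewrite (le_trans (ler_wpM2l (l2norm_ge0 _) (ltW uv)))//.
by rewrite mulrCA ler_piMr ?(ltW e0)// ler_pdivrMr// mul1r lerDl.
Qed.

Definition finnorm d := (h2norm2 m a d < +oo)%E.

(** The default value of [xget] is taken when the coefficients have infinite
    norm. *)
Definition ofcoef d : NQ := xget 0 [set x : NQ | \val (\val x) = vecf d].

Lemma val_ofcoef d : finnorm d -> \val (\val (ofcoef d)) = vecf d.
Proof.
move=> fd; rewrite /ofcoef; case: xgetP => [x _ //|nx].
have ld : vecf d \in @l2pred R (mword n) by rewrite unfold_in /l2pred esum_vecf.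
have Nd : l2_of ld \in orthopred (MQ m a) by exact: (vecf_in_NQ (d := d)).
by case: (nx (exist _ (l2_of ld) Nd)).
Qed.

Lemma vecf_inj : injective vecf.
Proof.
move=> d d' dd'; apply/funext => q; have [w <-] := tp_surj q.
have := congr1 (@^~ w) dd'; rewrite /vecf; apply: mulfI.
by rewrite neqC0 mulf_neq0 ?invr_eq0 ?gt_eqF// sqrtr_gt0.
Qed.

Lemma ofcoefK d : finnorm d -> ncoef (ofcoef d) = d.
Proof. by move=> fd; apply: vecf_inj; rewrite -val_coef val_ofcoef. Qed.

Lemma ncoef_inj : injective ncoef.
Proof. by move=> x y xy; apply/val_inj/val_inj; rewrite !val_coef xy. Qed.

Lemma norm_coef (x : NQ) : ((l2norm (\val x) ^+ 2)%:E = h2norm2 m a (ncoef x))%E.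
Proof. by rewrite -esum_vecf -val_coef esum_sqmod. Qed.

Lemma fin_coef (x : NQ) : finnorm (ncoef x).
Proof. by rewrite /finnorm -norm_coef ltry. Qed.

Lemma ncoef_linear c (x y : NQ) q : ncoef (c *: x + y) q = c * ncoef x q + ncoef y q.
Proof.
rewrite /ncoef !unlock; set v := projT1 _.
have -> : \val (\val (c *: x + y)) v = c * \val (\val x) v + \val (\val y) v by [].
by ring.
Qed.

Lemma ncoef0 q : ncoef 0 q = 0.
Proof.
rewrite /ncoef !unlock; set v := projT1 _.
have -> : \val (\val (0 : NQ)) v = 0 by [].
by rewrite !mul0r.
Qed.

Lemma ncoefD (x y : NQ) q : ncoef (x + y) q = ncoef x q + ncoef y q.
Proof. by rewrite -[x]scale1r ncoef_linear mul1r scale1r. Qed.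

Lemma ncoefZ c (x : NQ) q : ncoef (c *: x) q = c * ncoef x q.
Proof. by rewrite -[c *: x]addr0 ncoef_linear ncoef0 addr0. Qed.

Lemma ncoefB (x y : NQ) q : ncoef (x - y) q = ncoef x q - ncoef y q.
Proof. by rewrite ncoefD -scaleN1r ncoefZ mulN1r. Qed.

Lemma ncoef_sum (X : Type) (s : seq X) (P : pred X) (F : X -> NQ) q :
  ncoef (\sum_(u <- s | P u) F u) q = \sum_(u <- s | P u) ncoef (F u) q.
Proof. by elim/big_rec2: _ => [|u y z _ <-]; rewrite ?ncoef0 ?ncoefD. Qed.

Lemma h2norm2E d : h2norm2 m a d = (\esum_(q in [set: mindex]) (sqmod (d q) / Gam q)%:E)%E.
Proof. by []. Qed.

Lemma finnormP d : finnorm d <-> rsummable (fun q => sqmod (d q) / Gam q).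
Proof.
apply: iff_sym; apply: rsummableP => q.
by rewrite divr_ge0 ?sqmod_ge0// ltW.
Qed.

Lemma norm_rsum (x : NQ) : l2norm (\val x) ^+ 2 = rsum (fun q => sqmod (ncoef x q) / Gam q).
Proof.
apply: EFin_inj; rewrite norm_coef h2norm2E rsumK; first by [].
  by move=> q; rewrite divr_ge0 ?sqmod_ge0// ltW.
exact: (finnormP _).1 (fin_coef x).
Qed.

Lemma dot_coef (x y : NQ) : dot (\val x) (\val y) =
  csum (fun q => ncoef x q * (ncoef y q)^* * (Gam q)^-1%:C).
Proof.
rewrite /dot /fdot !val_coef.
transitivity (csum (fun q => (ncoef x q * (ncoef y q)^* * (Gam q ^- 2)%:C) * (Gam q)%:C)).
  rewrite -(csum_fiber (beta_ge0 a0 anil agen m1) (esum_beta a0 anil agen m1)).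
  congr csum; apply/funext => w; rewrite /vecf conjCM conjCR.
  rewrite -[in RHS](sqr_sqrtr (ltW (beta_gt0 w))).
  move: (ncoef x _) (ncoef y _) (Gam_gt0 (tp w)) => cx cy G0.
  by rewrite !rmorphM/= !fmorphV/= rmorphXn/=; field; rewrite neqC0 gt_eqF.
congr csum; apply/funext => q; move: (ncoef x _) (ncoef y _) (Gam_gt0 q) => cx cy G0.
rewrite !fmorphV rmorphXn /=; field.
by rewrite neqC0 gt_eqF.
Qed.

Lemma csummable_coef (x y : NQ) :
  csummable (fun q => ncoef x q * (ncoef y q)^* * (Gam q)^-1%:C).
Proof.
have sx : rsummable (fun q => sqmod (ncoef x q) / Gam q) by exact: (finnormP _).1 (fin_coef x).
have sy : rsummable (fun q => sqmod (ncoef y q) / Gam q) by exact: (finnormP _).1 (fin_coef y).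
apply: (csummable_le (rsummableD sx sy)) => q.
have G0 := Gam_gt0 q; rewrite !modcM modc_conj modcR gtr0_norm ?invr_gt0//.
rewrite -mulrDl ler_wpM2r; [by []|by rewrite invr_ge0 ltW|rewrite !sqmodE].
have := modc_ge0 (ncoef x q); have := modc_ge0 (ncoef y q); nra.
Qed.

End Coordinates.

(** * A polydisc inside the domain *)

Section Regular.
Context {R : realType}.

(** Beyond some length the limit superior bounds each coefficient by a
    power; the finitely many shorter words are absorbed into the constant. *)
Lemma regular_bound n (a : seq 'I_n -> R) : positive_regular a ->
  exists2 M : R, 1 <= M & forall w, a w <= M ^+ size w.
Proof.
move=> [a0 anil agen]; set u : nat -> \bar R := fun p => _ => au.
have [_ [V [N _ NV] <-] supV] : exists2 y, [set ereal_sup (u @` V) | V in \oo] y & (y < +oo)%E.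
  by apply: ereal_inf_lt.
have [B B0 uB] : exists2 B : R, 0 <= B & forall p, (N <= p)%N -> (u p <= B%:E)%E.
  have uV p : (N <= p)%N -> (u p <= ereal_sup (u @` V))%E.
    by move=> Np; apply: ereal_sup_ubound; exists p => //; exact: NV.
  case: (ereal_sup (u @` V)) supV uV => [r _ uV|//|_ uV].
    by exists (Num.max r 0); rewrite ?le_max ?lexx ?orbT// => p /uV h; rewrite (le_trans h)// lee_fin le_max lexx.
  by exists 0 => // p /uV; rewrite leeNy_eq => /eqP ->; rewrite leNye.
pose S p := \sum_(w : p.-tuple 'I_n) `|a w| ^+ 2.
have S0 p : 0 <= S p by apply: sumr_ge0 => w _; exact: sqr_ge0.
have aS w : a w ^+ 2 <= S (size w).
  rewrite /S (bigD1 (in_tuple w))//= ger0_norm// lerDl.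
  by apply: sumr_ge0 => *; exact: sqr_ge0.
have aB w : (N <= size w)%N -> (0 < size w)%N -> a w <= B ^+ size w.
  move=> Nw w0; have := uB _ Nw; rewrite lee_fin => h.
  rewrite -(@ler_pXn2r _ 2)// ?nnegrE ?exprn_ge0//.
  apply: le_trans (aS w) _; rewrite -exprM mulnC.
  have w2 : (2 * size w)%:R != 0 :> R by rewrite pnatr_eq0 muln_eq0 negb_or -!lt0n w0.
  rewrite -[leLHS]powRr1// -[X in _ `^ X](mulVf w2) powRrM powR_mulrn ?powR_ge0//.
  by apply: lerXn2r => //; rewrite nnegrE powR_ge0.
pose c0 := \sum_(p < N) \sum_(w : p.-tuple 'I_n) a w.
have c0_ge0 : 0 <= c0 by apply: sumr_ge0 => p _; exact: sumr_ge0.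
exists (1 + B + c0) => [|w]; first by rewrite -addrA lerDl addr_ge0.
have [w0|w0] := posnP (size w); first by rewrite (size0nil w0) anil ler01.
have M1 : 1 <= 1 + B + c0 by rewrite -addrA lerDl addr_ge0.
have [Nw|wN] := leqP N (size w).
  apply: le_trans (aB _ Nw w0) _; apply: lerXn2r; rewrite ?nnegrE//.
    by rewrite (le_trans ler01).
  by rewrite -addrA addrCA lerDl addr_ge0.
apply: (@le_trans _ _ (1 + B + c0)); last by rewrite ler_eXnr.
apply: (@le_trans _ _ c0); last by rewrite lerDr addr_ge0.
rewrite /c0 (bigD1 (Ordinal wN))//= (bigD1 (in_tuple w))//= -addrA lerDl.
rewrite addr_ge0//; first by apply: sumr_ge0.
by apply: sumr_ge0 => p _; exact: sumr_ge0.
Qed.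

Lemma count_words n (s : seq (seq 'I_n)) p : uniq s -> (forall w, w \in s -> size w = p) ->
  (size s <= n ^ p)%N.
Proof.
move=> us sp; have -> : (n ^ p = size [seq val t | t <- enum {: p.-tuple 'I_n}])%N.
  by rewrite size_map -cardE card_tuple card_ord.
apply: uniq_leq_size => // w ws; apply/mapP.
have wp : size w == p by rewrite sp.
by exists (Tuple wp); rewrite ?mem_enum.
Qed.

(** There are [n ^ p] words of length [p], and the bound is a geometric
    series of ratio [1 / 4]. *)
Lemma sum_words n (s : seq (seq 'I_n)) (r : R) : uniq s ->
  (forall w, w \in s -> (0 < size w)%N) -> 0 <= r -> n%:R * r <= 4^-1 ->
  \sum_(w <- s) r ^+ size w <= 2^-1.
Proof.
move=> us s0 r0 nr; set N := (\max_(w <- s) size w)%N.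
have -> : \sum_(w <- s) r ^+ size w = \sum_(1 <= p < N.+1) \sum_(w <- s | size w == p) r ^+ p.
  rewrite (exchange_big_dep xpredT)//=; apply: eq_big_seq => w ws.
  rewrite -big_filter (_ : [seq p <- _ | _] = [:: size w]) ?big_seq1//.
  have wN : size w \in index_iota 1 N.+1.
    by rewrite mem_index_iota s0// ltnS; exact: leq_bigmax_seq.
  rewrite (eq_filter (a2 := pred1 (size w))) => [|p]; last by rewrite /= eq_sym.
  by rewrite (filter_pred1_uniq _ wN) ?iota_uniq.
apply: (@le_trans _ _ (\sum_(1 <= p < N.+1) 4^-1 ^+ p)).
  apply: ler_sum => p _; rewrite -big_filter big_const_seq count_predT iter_addr_0.
  rewrite -[_ *+ _]mulr_natl; apply: (@le_trans _ _ ((n ^ p)%N%:R * r ^+ p)).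
    rewrite ler_wpM2r ?exprn_ge0// ler_nat; apply: count_words; first exact: filter_uniq.
    by move=> w; rewrite mem_filter => /andP[/eqP].
  rewrite natrX -exprMn; apply: lerXn2r => //; first by rewrite nnegrE mulr_ge0.
  by rewrite nnegrE invr_ge0.
have -> : \sum_(1 <= p < N.+1) 4^-1 ^+ p = 3^-1 * (1 - 4^-1 ^+ N) :> R.
  elim: (N) => [|N' IH]; first by rewrite big_geq// expr0 subrr mulr0.
  by rewrite big_nat_recr//= IH exprS; field.
have : 0 <= 4^-1 ^+ N :> R by rewrite exprn_ge0// invr_ge0.
lra.
Qed.

End Regular.

Section SmallPoint.
Context {R : realType} {k : nat} {n : 'I_k -> nat}.
Variables (a : forall i, seq 'I_(n i) -> R).
Arguments a : clear implicits.
Hypothesis areg : forall i, positive_regular (a i).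

(** On a polydisc of radius [eps], the defining series is at most [sum_w (M
    eps ^ 2) ^ size w]. *)
Lemma small_polydisc : exists2 eps : R, 0 < eps &
  forall z : forall i, 'I_(n i) -> R[i], (forall i j, modc (z i j) <= eps) -> D a z.
Proof.
have /choice[M MP] : forall i, exists M : R, 1 <= M /\ forall w, a i w <= M ^+ size w.
  by move=> i; have [M] := regular_bound (areg i); exists M.
pose T := 1 + \sum_i M i * (n i)%:R.
have MT i : M i * (n i)%:R <= T.
  rewrite /T (bigD1 i)//= addrCA lerDl addr_ge0// sumr_ge0// => i' _.
  by rewrite mulr_ge0// (le_trans ler01)// (MP i').1.
have T1 : 1 <= T.
  rewrite lerDl sumr_ge0// => i _.
  by rewrite mulr_ge0// (le_trans ler01)// (MP i).1.
have T0 : 0 < T by rewrite (lt_le_trans ltr01).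
exists (2 * T)^-1 => [|z zs i]; first by rewrite invr_gt0 mulr_gt0.
set eps := (2 * T)^-1; have e0 : 0 <= eps by rewrite invr_ge0 mulr_ge0 ?(ltW T0).
have M0 : 0 <= M i by rewrite (le_trans ler01)// (MP i).1.
have [a0 _ _ _] := areg i.
have ze w : sqmod (wordprod (z i) w) <= (eps ^+ 2) ^+ size w.
  rewrite /wordprod sqmod_prod; elim: w => [|j w IH]; first by rewrite big_nil expr0.
  rewrite big_cons /= [leRHS]exprS; apply: ler_pM => //; first exact: sqmod_ge0.
    by rewrite -sqmod_prod sqmod_ge0.
  by rewrite sqmodE; apply: lerXn2r => //; rewrite nnegrE ?modc_ge0.
apply: (@le_lt_trans _ _ (2^-1)%:E); last by rewrite lte_fin invf_lt1// ltr1n.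
apply: ge_ereal_sup => _ [X [finX sX]] <-.
rewrite fsbig_finite//= sumEFin lee_fin.
apply: (@le_trans _ _ (\sum_(w <- fset_set X) (M i * eps ^+ 2) ^+ size w)).
  apply: ler_sum => w _; rewrite exprMn; apply: ler_pM => //; first exact: sqmod_ge0.
  exact: (MP i).2.
apply: sum_words => [||//|]; first exact: fset_uniq.
- by move=> w; rewrite in_fset_set// => /set_mem /sX.
- by rewrite mulr_ge0 ?exprn_ge0.
rewrite mulrCA mulrA; apply: (@le_trans _ _ (T * eps ^+ 2)).
  by rewrite ler_wpM2r ?exprn_ge0.
have -> : T * eps ^+ 2 = 4^-1 * T^-1 by rewrite /eps; field; rewrite gt_eqF.
by rewrite ler_piMr ?invr_ge0// invf_le1.
Qed.

End SmallPoint.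

(** * Power series on the domain *)

Lemma digits_inj B K (f g : 'I_K -> nat) : (forall r, f r < B)%N -> (forall r, g r < B)%N ->
  (\sum_r f r * B ^ r = \sum_r g r * B ^ r)%N -> f =1 g.
Proof.
elim: K f g => [f g _ _ _ []//|K IH] f g fB gB.
rewrite !big_ord_recl !muln1 /bump /=.
have E (h : 'I_K.+1 -> nat) : (\sum_(i < K) h (lift ord0 i) * B ^ (1 + i) =
    (\sum_(i < K) h (lift ord0 i) * B ^ i) * B)%N.
  by rewrite big_distrl; apply: eq_bigr => i _; rewrite add1n expnSr mulnA.
rewrite !E => e; have B0 : (0 < B)%N by apply: leq_ltn_trans (fB ord0).
have e0 : f ord0 = g ord0.
  have := congr1 (modn^~ B) e; rewrite ![(_ + _ * B)%N]addnC !modnMDl.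
  by rewrite !modn_small.
move: e; rewrite e0 => /addnI/eqP; rewrite eqn_pmul2r// => /eqP.
move=> /(IH (fun i => f (lift ord0 i)) (fun i => g (lift ord0 i)) (fun _ => fB _) (fun _ => gB _)) h r.
by case: (unliftP ord0 r) => [r' ->|->//]; exact: h.
Qed.

Section Series.
Context {R : realType} {k : nat} {n : 'I_k -> nat}.
Variables (m : 'I_k -> nat) (a : forall i, seq 'I_(n i) -> R).
Arguments a : clear implicits.
Hypotheses (areg : forall i, positive_regular (a i)) (m1 : forall i, (1 <= m i)%N).
Local Notation C := R[i].
Local Notation mindex := {dffun forall i : 'I_k, {ffun 'I_(n i) -> nat}}.
Local Notation NQ := (NQ m a).
Local Notation Gam := (Gam m a).
Implicit Types (q : mindex) (d : mindex -> C) (x y g : NQ).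

Let a0 i w : 0 <= a i w. Proof. by have [] := areg i. Qed.
Let anil i : a i [::] = 0. Proof. by have [] := areg i. Qed.
Let agen i j : 0 < a i [:: j]. Proof. by have [] := areg i. Qed.
Let Gam_gt0 q : 0 < Gam q. Proof. exact: Gam_gt0. Qed.

Lemma ulamE z (w : mword n) :
  ulam m a z w = (mono z (tp w))^* * (Num.sqrt (beta m a w))%:C.
Proof.
rewrite /ulam big_split /= -(rmorph_prod (Num.conj : C -> C)) mono_tp; congr (_ * _).
rewrite -rmorph_prod /=; congr _%:C.
rewrite -[LHS]ger0_norm; last by apply: prodr_ge0 => i _; exact: sqrtr_ge0.
rewrite -sqrtr_sqr -prodrXl; congr Num.sqrt; apply: eq_bigr => i _.
by rewrite sqr_sqrtr// ltW// b_gt0.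
Qed.

Section Point.
Variable z : D a.
Local Notation zz := (\val z).

Let Dz : D a zz. Proof. exact: set_mem (valP z). Qed.

Lemma finnorm_kernel : finnorm m a (fun q => (mono zz q)^* * (Gam q)%:C).
Proof.
apply: (finnormP a0 anil agen m1 _).2.
apply: (rsummable_le (kernel_summable a0 anil agen m1 Dz)) => q.
rewrite ger0_norm; last by rewrite divr_ge0 ?sqmod_ge0// ltW.
rewrite sqmodM !sqmodE modc_conj modcR real_normK ?num_real//.
by rewrite -mulrA ler_wpM2l ?sqr_ge0// expr2 mulfK// gt_eqF.
Qed.

Definition kervec : NQ := ofcoef m a (fun q => (mono zz q)^* * (Gam q)%:C).

Lemma ncoef_kervec q : ncoef kervec q = (mono zz q)^* * (Gam q)%:C.
Proof. by rewrite ofcoefK//; exact: finnorm_kernel. Qed.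

(** Point evaluations are scalar products: the reproducing property. *)
Lemma U_dot x : U x z = dot (\val x) (\val kervec).
Proof.
rewrite /U /dot; congr (fdot _ _).
rewrite (val_ofcoef a0 anil agen m1 finnorm_kernel); apply/funext => w.
rewrite /vecf ulamE rmorphM fmorphV /=; field.
by rewrite neqC0 gt_eqF.
Qed.

Lemma dot_kervecE x q : ncoef x q * (ncoef kervec q)^* * (Gam q)^-1%:C = ncoef x q * mono zz q.
Proof.
rewrite ncoef_kervec conjCM conjCK conjCR fmorphV /= -!mulrA; congr (_ * _).
by rewrite mulfV ?mulr1// neqC0 gt_eqF.
Qed.

Lemma U_coef x : U x z = csum (fun q => ncoef x q * mono zz q).
Proof.
rewrite U_dot (dot_coef a0 anil agen m1); congr csum; apply/funext => q.
exact: dot_kervecE.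
Qed.

Lemma csummable_series x : csummable (fun q => ncoef x q * mono zz q).
Proof.
have := csummable_coef a0 anil agen m1 x kervec; congr csummable.
by apply/funext => q; exact: dot_kervecE.
Qed.

Lemma U_linear c x y : U (c *: x + y) z = c * U x z + U y z.
Proof. by rewrite !U_dot -dot_linear. Qed.

End Point.

(** The lowest terms of [U y] and [U g * U x] are compared along the curves
    [z_ij = eps t ^ wt_ij] as [t] tends to [0]. The weights [wt_ij] order
    the monomials by degree and separate those of degree at most [N], so
    that the term of [y] of lowest weight cannot cancel. For [x = 0] this
    says that a power series that vanishes on the domain is zero. *)
Lemma low_order N x y g :
  (forall z : D a, U y z = U g z * U x z) ->
  (forall q, (deg q <= N)%N -> ncoef x q = 0) ->
  forall q, (deg q <= N)%N -> ncoef y q = 0.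
Proof.
move=> ygx x0 q1 q1N; apply: contrapT => /eqP yq1.
pose J := {i : 'I_k & 'I_(n i)}.
pose rk i (j : 'I_(n i)) : nat := enum_rank (Tagged (fun i => 'I_(n i)) j : J).
(* The exponents of [q] are the digits of [s q] in base [N.+1], so [s] is
   injective on degrees at most [N]. As [s < M] there, the weight [wt] orders
   these by the degree first and by [s] second. *)
pose s q := (\sum_i \sum_j q i j * N.+1 ^ rk i j)%N.
pose M := (N * N.+1 ^ #|{: J}|).+1.
pose wt q := (M * deg q + s q)%N.
have sM q : (deg q <= N)%N -> (s q < M)%N.
  move=> qN; rewrite ltnS (leq_trans _ (leq_mul qN (leqnn _)))//.
  rewrite /deg big_distrl; apply: leq_sum => i _; rewrite big_distrl; apply: leq_sum => j _.
  by apply: leq_mul => //; apply: leq_pexp2l => //; exact/ltnW/ltn_ord.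
have s_inj p q : (deg p <= N)%N -> (deg q <= N)%N -> s p = s q -> p = q.
  have sE p' : s p' = (\sum_(r < #|{: J}|) (p' (tag (enum_val r)) (tagged (enum_val r))) * N.+1 ^ r)%N.
    rewrite /s sig_big_dep /= (reindex (@enum_val J xpredT))/=; last first.
      by apply: onW_bij; exact: enum_val_bij.
    apply: eq_big => // r _; case E : (enum_val r) => [i j] /=; congr (_ * _ ^ _)%N.
    by rewrite -[in RHS](enum_valK r) E.
  have le (p' : mindex) i j : (deg p' <= N)%N -> (p' i j < N.+1)%N.
    by move=> pN; rewrite ltnS (leq_trans _ pN)// /deg (bigD1 i)//= (bigD1 j)//= -addnA leq_addr.
  move=> pN qN; rewrite !sE => /digits_inj pq.
  apply/ffunP => i; apply/ffunP => j.
  have := pq (fun r => le _ _ _ pN) (fun r => le _ _ _ qN) (enum_rank (Tagged (fun i => 'I_(n i)) j : J)).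
  by rewrite enum_rankK.
(* A term of least weight; if [y] has a nonzero coefficient of degree at most
   [N], it is unique and its degree is at most [N]. *)
have [q0 [yq0 q0min]] : exists q0, ncoef y q0 <> 0 /\ forall q, ncoef y q <> 0 -> (wt q0 <= wt q)%N.
  have ex : exists w, `[< exists2 q, ncoef y q <> 0 & wt q = w >].
    by exists (wt q1); apply/asboolP; exists q1 => //; exact/eqP.
  case: (ex_minnP ex) => w /asboolP[q0 yq0 <-] wmin.
  by exists q0; split => // q yq; apply: wmin; apply/asboolP; exists q.
have wtM q : (N < deg q)%N -> (M * N.+1 <= wt q)%N.
  by move=> qN; rewrite (leq_trans _ (leq_addr _ _))// leq_mul2l qN orbT.
have q0M : (wt q0 < M * N.+1)%N.
  apply: leq_ltn_trans (q0min q1 (elimN eqP yq1)) _.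
  by rewrite mulnS addnC -addnS leq_add ?sM// leq_mul2l q1N orbT.
have q0N : (deg q0 <= N)%N by rewrite leqNgt; apply/negP => /wtM; rewrite leqNgt q0M.
have wt_gt q : q <> q0 -> ncoef y q <> 0 -> (wt q0 < wt q)%N.
  move=> qq0 yq; rewrite ltn_neqAle q0min// andbT; apply/eqP => e.
  have qN : (deg q <= N)%N by rewrite leqNgt; apply/negP => /wtM; rewrite -e leqNgt q0M.
  have := congr1 (divn^~ M) e; rewrite /wt ![(M * _)%N]mulnC !divnMDl//.
  rewrite !divn_small ?sM// !addn0 => dd; apply: qq0; apply: s_inj => //.
  by move: e; rewrite /wt dd => /addnI.
have [eps e0 epsD] := small_polydisc areg.
pose z0 (t : R) i (j : 'I_(n i)) : C := (eps * t ^+ (M + N.+1 ^ rk i j))%:C.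
have z0D t : 0 <= t <= 1 -> D a (z0 t).
  move=> /andP[t0 t1]; apply: epsD => i j; rewrite modcR ger0_norm; last first.
    by rewrite mulr_ge0 ?exprn_ge0// ltW.
  by rewrite ler_piMr ?(ltW e0)// exprn_ile1.
have monoE t q : mono (z0 t) q = (eps ^+ deg q * t ^+ wt q)%:C.
  have wtE : wt q = (\sum_i \sum_j (M + N.+1 ^ rk i j) * q i j)%N.
    rewrite /wt /deg /s big_distrr -big_split /=; apply: eq_bigr => i _.
    rewrite big_distrr -big_split /=; apply: eq_bigr => j _.
    by rewrite mulnDl [(_ ^ _ * _)%N]mulnC.
  rewrite /mono /deg wtE -!prodrXr -big_split rmorph_prod; apply: eq_bigr => i _.
  rewrite -!prodrXr -big_split rmorph_prod; apply: eq_bigr => j _.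
  by rewrite -rmorphXn exprMn exprM.
(* [A] bounds the values at [t = 1]; a series whose terms have weight at least
   [l] is then at most [2 * t ^ l * A x]. *)
pose A (x : NQ) := rsum (fun q => modc (ncoef x q) * eps ^+ deg q).
have eps_ge0 q : 0 <= eps ^+ deg q by rewrite exprn_ge0// ltW.
have sA (x' : NQ) : rsummable (fun q => modc (ncoef x' q) * eps ^+ deg q).
  have z1 : 0 <= (1 : R) <= 1 by rewrite lexx ler01.
  have /csummableP := csummable_series (exist _ (z0 1) (mem_set (z0D 1 z1))) x'.
  congr rsummable; apply/funext => q; rewrite modcM monoE expr1n mulr1 modcR.
  by rewrite ger0_norm.
have A0 (x' : NQ) : 0 <= A x' by apply: rsum_ge0 => q; rewrite mulr_ge0 ?modc_ge0.
have bnd (x' : NQ) (t : R) l : 0 <= t -> t <= 1 -> forall h : mindex -> C,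
   (forall q : mindex, h q = 0 \/ (h q = ncoef x' q * mono (z0 t) q /\ (ncoef x' q <> 0 -> (l <= wt q)%N))) ->
   csummable h /\ modc (csum h) <= 2 * (t ^+ l * A x').
  move=> t0 t1 h hh.
  have hle q : modc (h q) <= t ^+ l * (modc (ncoef x' q) * eps ^+ deg q).
    have [->|[-> lq]] := hh q.
      by rewrite modc0 mulr_ge0 ?exprn_ge0// mulr_ge0 ?modc_ge0.
    have [->|xq] := pselect (ncoef x' q = 0); first by rewrite mul0r modc0 mul0r mulr0.
    rewrite modcM monoE modcR ger0_norm; last by rewrite mulr_ge0// exprn_ge0.
    rewrite mulrA mulrC ler_wpM2r ?mulr_ge0 ?modc_ge0//.
    by rewrite ler_wiXn2l// lq.
  have sh := csummable_le (rsummableZ _ (sA x')) hle; split=> //.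
  rewrite (le_trans (modc_csum sh))// ler_wpM2l// -rsumZ//.
  apply: le_rsum => //; first exact/csummableP.
  exact: rsummableZ.
pose K := 2 * A y + 4 * (A g * A x).
have K0 : 0 <= K by rewrite addr_ge0 ?mulr_ge0.
(* Both the terms of [y] other than [q0] and the product [U g * U x] are of
   weight greater than [wt q0]. After division by [t ^ wt q0] they are of
   order [t], and the coefficient at [q0] vanishes in the limit. *)
suff yK t : 0 < t -> t <= 1 -> modc (ncoef y q0) * eps ^+ deg q0 <= t * K.
  apply: yq0; apply/modc_eq0/eqP; rewrite eq_le modc_ge0 andbT.
  have ed : 0 < eps ^+ deg q0 by rewrite exprn_gt0.
  rewrite -(ler_pM2r ed) mul0r; apply/ler_addgt0Pr => e e1; rewrite add0r.
  have K1 : 0 < K + 1 by rewrite ltr_pwDr.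
  apply: le_trans (yK (Num.min 1 (e / (K + 1))) _ _) _.
  - by rewrite lt_min ltr01 divr_gt0.
  - by rewrite ge_min lexx.
  apply: (@le_trans _ _ (e / (K + 1) * K)).
    by rewrite ler_wpM2r// ge_min lexx orbT.
  by rewrite mulrAC -mulrA ler_piMr ?(ltW e1)// ler_pdivrMr// mul1r lerDl.
move=> t0 t1; have t01 : 0 <= t <= 1 by rewrite (ltW t0).
pose z : D a := exist _ (z0 t) (mem_set (z0D t t01)).
have [sg Ug] : csummable (fun q : mindex => ncoef g q * mono (z0 t) q) /\
    modc (csum (fun q : mindex => ncoef g q * mono (z0 t) q)) <= 2 * (t ^+ 0 * A g).
  by apply: bnd; rewrite ?(ltW t0)// => q; right.
have [sx Ux] : csummable (fun q : mindex => ncoef x q * mono (z0 t) q) /\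
    modc (csum (fun q : mindex => ncoef x q * mono (z0 t) q)) <= 2 * (t ^+ (wt q0).+1 * A x).
  apply: bnd; rewrite ?(ltW t0)// => q; right; split => // xq.
  apply: leq_trans q0M _; apply: wtM; rewrite ltnNge; apply/negP => qN.
  by apply: xq; exact: x0.
have [sy Uy] : csummable (fun q : mindex => if q == q0 then 0 else ncoef y q * mono (z0 t) q) /\
    modc (csum (fun q : mindex => if q == q0 then 0 else ncoef y q * mono (z0 t) q)) <=
      2 * (t ^+ (wt q0).+1 * A y).
  apply: bnd; rewrite ?(ltW t0)// => q; case: eqP => qq0; first by left.
  by right; split => // yq; exact: wt_gt.
have := ygx z; rewrite !U_coef /=.
have -> : (fun q : mindex => ncoef y q * mono (z0 t) q) =
    (fun q : mindex => (if q == q0 then ncoef y q0 * mono (z0 t) q0 else 0) +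
              (if q == q0 then 0 else ncoef y q * mono (z0 t) q)).
  by apply/funext => q; case: eqP => [->|_]; rewrite ?addr0 ?add0r.
rewrite csumD//; last first.
  apply: (csummable_le (rsummableZ (t ^+ wt q0) (sA y))) => q.
  case: eqP => [->|_]; last by rewrite modc0 !mulr_ge0 ?exprn_ge0 ?modc_ge0// ltW.
  rewrite modcM monoE modcR ger0_norm; last by rewrite mulr_ge0// exprn_ge0// ltW.
  by rewrite mulrA mulrC.
rewrite (@csum_single _ _ q0); last by move=> q; case: eqP.
rewrite eqxx => /(canRL (addrK _)) e.
move: Ug Ux Uy (A0 g) (A0 x) (A0 y) e (A0 g); rewrite /K.
move: (csum _) (csum _) (csum _) (A g) (A x) (A y) => Sg Sx Sy Ag Ax Ay.
rewrite expr0 mul1r => Ug Ux Uy Ag0 Ax0 Ay0 e _.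
have {e} : modc (ncoef y q0 * mono (z0 t) q0) <=
    2 * Ag * (2 * (t ^+ (wt q0).+1 * Ax)) + 2 * (t ^+ (wt q0).+1 * Ay).
  rewrite e; apply: le_trans (modcD _ _) _; rewrite modcN modcM.
  by apply: lerD => //; apply: ler_pM => //; exact: modc_ge0.
rewrite modcM monoE modcR ger0_norm; last by rewrite mulr_ge0// exprn_ge0// ltW.
have tw : 0 < t ^+ wt q0 by rewrite exprn_gt0.
rewrite exprS => h; rewrite -(ler_pM2r tw) -mulrA; apply: le_trans h _.
move: (t ^+ wt q0) => T.
by rewrite le_eqVlt; apply/orP; left; apply/eqP; ring.
Qed.

Lemma U_sub x y z : U (x - y) z = U x z - U y z.
Proof. by rewrite !U_dot -dotBl. Qed.

Lemma U_0 z : U (0 : NQ) z = 0.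
Proof. by rewrite U_dot dot0l. Qed.

(** The case [x = 0] of [low_order]. *)
Lemma U_inj x y : U x = U y -> x = y.
Proof.
move=> xy; apply: (ncoef_inj a0 anil agen m1); apply/funext => q.
apply/eqP; rewrite -subr_eq0 -ncoefB; apply/eqP.
apply: (@low_order (deg q) 0 (x - y) 0) => // [z|q' _]; last by rewrite ncoef0.
by rewrite U_sub xy subrr U_0 mul0r.
Qed.

Lemma U_ofcoef d : finnorm m a d -> has_series (U (ofcoef m a d)) d.
Proof. by move=> fd z; rewrite U_coef ofcoefK. Qed.

Lemma U_H2 x : H2 m a (U x).
Proof.
exists (ncoef x) => [|z]; last exact: U_coef.
exact: (fin_coef a0 anil agen m1).
Qed.

(** Every power series of finite norm comes from a vector of [NQ]. *)
Lemma H2_U f : H2 m a f -> exists x, U x = f.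
Proof.
move=> [d fd fE]; exists (ofcoef m a d); apply/funext => z.
by rewrite (U_ofcoef fd) fE.
Qed.

Theorem U_is_unitary : U_unitary m a.
Proof.
split=> [c x y|x d fd xd|].
- by apply/funext => z; exact: U_linear.
- have <- : ofcoef m a d = x.
    by apply: U_inj; apply/funext => z; rewrite (U_ofcoef fd) xd.
  by rewrite (norm_coef a0 anil agen m1) ofcoefK.
- by apply/seteqP; split => [_ [x _ <-]|f /H2_U[x <-]]; [exact: U_H2|exists x].
Qed.

End Series.

(** * Shifts and multiplication operators *)

Lemma rsummable_single (R : realType) (J : choiceType) (j0 : J) (f : J -> R) :
  (forall j, j <> j0 -> f j = 0) -> rsummable f.
Proof.
move=> f0; rewrite /rsummable /summable (@esum_inj R unit J (fun=> j0)); first last.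
- by move=> j jj0; rewrite /= f0 ?normr0// => e; exact: (jj0 tt).
- by case=> -[].
rewrite (_ : [set: unit] = [set tt]); last by apply/seteqP; split => -[].
by rewrite esum_set1 ?abse_ge0//= ltry.
Qed.

Section Shifts.
Context {R : realType} {k : nat} {n : 'I_k -> nat}.
Variables (m : 'I_k -> nat) (a : forall i, seq 'I_(n i) -> R).
Arguments a : clear implicits.
Hypotheses (areg : forall i, positive_regular (a i)) (m1 : forall i, (1 <= m i)%N).
Local Notation C := R[i].
Local Notation mindex := {dffun forall i : 'I_k, {ffun 'I_(n i) -> nat}}.
Local Notation NQ := (NQ m a).
Local Notation Gam := (Gam m a).
Implicit Types (q : mindex) (d : mindex -> C) (x y g : NQ).

Let a0 i w : 0 <= a i w. Proof. by have [] := areg i. Qed.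
Let anil i : a i [::] = 0. Proof. by have [] := areg i. Qed.
Let agen i j : 0 < a i [:: j]. Proof. by have [] := areg i. Qed.
Let Gam_gt0 q : 0 < Gam q. Proof. exact: Gam_gt0. Qed.
Let beta_gt0 w : 0 < beta m a w. Proof. exact: beta_gt0. Qed.
Let finP d : finnorm m a d <-> rsummable (fun q => sqmod (d q) / Gam q).
Proof. exact: finnormP. Qed.

Definition monom (p : mindex) : NQ := ofcoef m a (fun q => (q == p)%:R).

Lemma ncoef_monom p q : ncoef (monom p) q = (q == p)%:R.
Proof.
rewrite ofcoefK//; apply/(finP _).2/(@rsummable_single _ _ p) => r /eqP/negbTE ->.
by rewrite sqmodE modc0 expr0n mul0r.
Qed.

Lemma U_monom p z : U (monom p) z = mono (\val z) p.
Proof.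
rewrite (U_coef areg m1) (@csum_single _ _ p) => [|q /eqP/negbTE qp].
  by rewrite ncoef_monom eqxx mul1r.
by rewrite ncoef_monom qp mul0r.
Qed.

Definition vacuum : NQ := monom (tp (mword1 n)).

Lemma mono1 (z : forall i, 'I_(n i) -> C) : mono z (tp (mword1 n)) = 1.
Proof.
rewrite /mono big1// => i _; rewrite big1// => j _.
by rewrite !ffunE expr0.
Qed.

Lemma U_vacuum z : U vacuum z = 1.
Proof. by rewrite U_monom mono1. Qed.

Section Shift.
Variables (i : 'I_k) (j : 'I_(n i)).

(** The coefficients of the product with [z_j]. *)
Definition shift d : mindex -> C := fun q =>
  if pselect (exists p, q = inc j p) is left e then d (projT1 (cid e)) else 0.

Lemma shift_inc d q : shift d (inc j q) = d q.
Proof.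
rewrite /shift; case: pselect => [ep|[]]; last by exists q.
by case: cid => p /= /minc_inj ->.
Qed.

Lemma shift_out d q : (forall p, q <> inc j p) -> shift d q = 0.
Proof. by move=> qp; rewrite /shift; case: pselect => // e; exfalso; case: e => p /qp. Qed.

Lemma shift_sum d (F : mindex -> R) :
  (\esum_(q in [set: mindex]) (sqmod (shift d q) * F q)%:E =
   \esum_(q in [set: mindex]) (sqmod (d q) * F (inc j q))%:E)%E.
Proof.
rewrite (@esum_inj _ _ _ (inc j)); [|exact: minc_inj|].
  by apply: eq_esum => q _; rewrite shift_inc.
by move=> q qp; rewrite shift_out// sqmodE modc0 expr0n mul0r.
Qed.

Lemma shift_bound d q :
  sqmod (d q) / Gam (inc j q) <= (a i [:: j])^-1 * (sqmod (d q) / Gam q).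
Proof.
rewrite mulrCA ler_wpM2l ?sqmod_ge0// -invfM lef_pV2 ?posrE ?mulr_gt0//.
exact: Gam_inc.
Qed.

Let a_inv0 : 0 <= (a i [:: j])^-1. Proof. by rewrite invr_ge0. Qed.

Lemma finnorm_shift d : finnorm m a d -> finnorm m a (shift d).
Proof.
move=> fd; rewrite /finnorm h2norm2E shift_sum.
have sd := rsummable_le (rsummableZ (a i [:: j])^-1 ((finP d).1 fd)).
apply: (rsummableP (f := fun q => sqmod (d q) / Gam (inc j q)) _).1 => [q|].
  by rewrite divr_ge0 ?sqmod_ge0// ltW.
apply: sd => q; rewrite ger0_norm; first exact: shift_bound.
by rewrite divr_ge0 ?sqmod_ge0// ltW.
Qed.

(** The vector [p] is the orthogonal projection of [X] as soon as both have
    the same scalar products with [NQ]. *)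
Lemma proj_unique (X : l2 R (mword n)) (p : NQ) :
  (forall z : NQ, dot X (\val z) = dot (\val p) (\val z)) -> proj (\val X) = p.
Proof.
move=> Xp; have pP : forall z : NQ, fdot (\val X - \val (\val p)) (\val (\val z)) = 0.
  by move=> z; have := dotBl X (\val p) (\val z); rewrite Xp subrr.
rewrite /proj; case: xgetP => [p' _ p'P|/(_ p)/(_ pP)//].
apply/val_inj/eqP; rewrite -subr_eq0; apply/eqP/l2norm0_eq0/eqP.
rewrite -sqrf_eq0; apply/eqP/complexI; rewrite -dotxx.
have e : \val p' - \val p = \val (p' - p) by [].
rewrite {2}e dotBl -Xp; apply/eqP; rewrite subr_eq0 eq_sym -subr_eq0 -dotBl.
by apply/eqP; exact: (p'P (p' - p)).
Qed.

(** Against [z] in [NQ], the vector [W j x] has the scalar product of [x]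
    with [Wadj (push j) z], which is explicit in coordinates. *)
Lemma L_shift x : L m a j x = ofcoef m a (shift (ncoef x)).
Proof.
have fx := finnorm_shift (fin_coef a0 anil agen m1 x).
pose X := l2_of (W_l2 a0 anil agen m1 j (valP (\val x))).
rewrite /L; apply: (@proj_unique X) => z.
rewrite [LHS]dotC [RHS]dotC; congr (_^*).
rewrite (dot_coef a0 anil agen m1) ofcoefK//.
rewrite (@csum_inj _ _ _ (inc j)); [|exact: minc_inj|]; last first.
  by move=> q qp; rewrite shift_out// rmorph0 mulr0 mul0r.
rewrite /dot /X /= (W_adj a0 anil agen m1).
rewrite /fdot !(val_coef a0 anil agen m1).
transitivity (csum (fun q => ncoef z (inc j q) * (ncoef x q)^* *
    ((Gam (inc j q))^-1 * (Gam q)^-1)%:C * (Gam q)%:C)).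
  rewrite -(csum_fiber (beta_ge0 a0 anil agen m1) (esum_beta a0 anil agen m1)).
  congr csum; apply/funext => w; rewrite /Wadj /vecf tp_push conjCM conjCR.
  have bw := beta_gt0 w; have bp := beta_gt0 (push j w).
  rewrite sqrtrM ?(ltW bw)// sqrtrV ?(ltW bp)// -[in RHS](sqr_sqrtr (ltW bw)).
  move: (ncoef z _) (ncoef x _) (Gam_gt0 (tp w)) (Gam_gt0 (inc j (tp w))) => cz cx G1 G2.
  rewrite !rmorphM/= !fmorphV/=; field.
  by rewrite !neqC0 !gt_eqF// sqrtr_gt0.
congr csum; apply/funext => q /=; rewrite shift_inc.
move: (ncoef z _) (ncoef x _) (Gam_gt0 q) => cz cx G1.
rewrite !rmorphM !fmorphV /=; field.
by rewrite !neqC0 !gt_eqF.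
Qed.

Lemma ncoef_L x : ncoef (L m a j x) = shift (ncoef x).
Proof. by rewrite L_shift ofcoefK//; exact/finnorm_shift/fin_coef. Qed.

Lemma U_L x z : U (L m a j x) z = \val z i j * U x z.
Proof.
rewrite !(U_coef areg m1) ncoef_L -csumZ; last exact: csummable_series.
rewrite (@csum_inj _ _ _ (inc j)); [|exact: minc_inj|].
  by congr csum; apply/funext => q /=; rewrite shift_inc mono_inc; ring.
by move=> q qp; rewrite shift_out// mul0r.
Qed.

Lemma L_monom p : L m a j (monom p) = monom (inc j p).
Proof.
by apply: (U_inj areg m1); apply/funext => z; rewrite U_L !U_monom mono_inc.
Qed.

Lemma L_bounded : bounded_op (L m a j).
Proof.
split.
  move=> c x y; apply: (U_inj areg m1); apply/funext => z.
  by rewrite !(U_L, U_linear areg m1); ring.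
exists (Num.sqrt (a i [:: j])^-1) => x.
rewrite -(@ler_pXn2r _ 2)// ?nnegrE ?mulr_ge0 ?l2norm_ge0 ?sqrtr_ge0//.
rewrite exprMn (sqr_sqrtr a_inv0) -lee_fin (EFinM (a i [:: j])^-1).
have e1 := norm_coef a0 anil agen m1 (L m a j x); have e2 := norm_coef a0 anil agen m1 x.
rewrite e1 e2 ncoef_L !h2norm2E shift_sum -esumZ//; last first.
  by move=> q; rewrite divr_ge0 ?sqmod_ge0// ltW.
by apply: le_esum => q _; rewrite lee_fin shift_bound.
Qed.

End Shift.

Lemma bounded_comp (S T : NQ -> NQ) : bounded_op S -> bounded_op T -> bounded_op (S \o T).
Proof.
move=> [lS [MS bS]] [lT [MT bT]]; split; first by move=> c x y /=; rewrite lT lS.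
exists (`|MS| * MT) => x /=; apply: le_trans (bS _) _.
apply: (@le_trans _ _ (`|MS| * l2norm (\val (T x)))).
  by rewrite ler_wpM2r ?l2norm_ge0// ler_norm.
by rewrite -mulrA ler_wpM2l.
Qed.

Lemma bounded_lin c (S T : NQ -> NQ) : bounded_op S -> bounded_op T -> bounded_op (c *: S + T).
Proof.
move=> [lS [MS bS]] [lT [MT bT]]; split.
  move=> e x y; rewrite -[(c *: S + T) _]/(c *: S _ + T _) lS lT.
  rewrite -[(c *: S + T) _]/(c *: S _ + T _) -[(c *: S + T) _]/(c *: S _ + T _).
  by rewrite !scalerDr !scalerA [c * e]mulrC; rewrite addrACA.
exists (modc c * MS + MT) => x.
apply: le_trans (l2normD (c *: \val (S x)) (\val (T x))) _.
rewrite l2normZ mulrDl lerD//.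
by rewrite -mulrA ler_wpM2l ?modc_ge0.
Qed.

Lemma bounded0 : bounded_op (0 : NQ -> NQ).
Proof.
split=> [c x y|]; first by rewrite scaler0 addr0.
by exists 0 => x; rewrite mul0r l2norm0.
Qed.

Lemma bounded_id : bounded_op (id : NQ -> NQ).
Proof. by split => //; exists 1 => x; rewrite mul1r. Qed.

(** The operators that [U] carries to multiplication by a function. *)
Definition mult_op (T : NQ -> NQ) : Prop := bounded_op T /\
  exists psi : D a -> C, forall x z, U (T x) z = psi z * U x z.

(** In a weak limit [T] of multiplication operators, [U (T x) z] and [U (T
    1) z] are approximated simultaneously, and the multiplying function is
    the image of [1]. *)
Lemma mult_wot_subalgebra : wot_subalgebra mult_op.
Proof.
split.
- by move=> T [].
- split; first by split; [exact: bounded0|exists (fun=> 0) => x z; rewrite U_0 ?mul0r].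
  move=> c S T [bS [p Sp]] [bT [q Tq]]; split; first exact: bounded_lin.
  exists (fun z => c * p z + q z) => x z.
  by rewrite -[(c *: S + T) x]/(c *: S x + T x) (U_linear areg m1) Sp Tq; ring.
- move=> S T [bS [p Sp]] [bT [q Tq]]; split; first exact: bounded_comp.
  by exists (fun z => p z * q z) => x z /=; rewrite Sp Tq mulrA.
move=> T bT Tapp; split => //; exists (U (T vacuum)) => x z.
pose kz := kervec m z; apply/eqP; rewrite -subr_eq0; apply/eqP/modc_eq0/eqP.
rewrite eq_le modc_ge0 andbT; apply/ler_addgt0Pr => e e0; rewrite add0r.
have c0 : 0 < 1 + modc (U x z) by rewrite ltr_wpDr ?modc_ge0.
have [|S [_ [p Sp]] Sclose] := Tapp [:: (x, kz); (vacuum, kz)] (e / (1 + modc (U x z))).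
  by rewrite divr_gt0.
have close y : (y, kz) \in [:: (x, kz); (vacuum, kz)] ->
    modc (U (T y) z - U (S y) z) <= e / (1 + modc (U x z)).
  by move=> /Sclose/modc_ltP/ltW; rewrite -(U_dot areg m1) (U_sub areg m1).
have -> : U (T x) z - U (T vacuum) z * U x z =
    (U (T x) z - U (S x) z) - (U (T vacuum) z - U (S vacuum) z) * U x z.
  by rewrite !Sp U_vacuum; ring.
apply: le_trans (modcD _ _) _; rewrite modcN modcM.
have h1 := close _ (mem_head _ _).
have h2 : modc (U (T vacuum) z - U (S vacuum) z) <= e / (1 + modc (U x z)).
  by apply: close; rewrite !inE eqxx orbT.
apply: le_trans (lerD h1 (ler_wpM2r (modc_ge0 _) h2)) _.
by rewrite -[X in X + _]mulr1 -mulrDr divfK// gt_eqF.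
Qed.

(** By minimality, since [L j] is multiplication by [z_j]. *)
Lemma Finfty_mult T : Finfty m a T -> mult_op T.
Proof.
apply: smallest_sub; first exact: mult_wot_subalgebra.
move=> S [[i [j ->]]|->].
  by split; [exact: L_bounded|exists (fun z => \val z i j) => x z; rewrite U_L].
by split; [exact: bounded_id|exists (fun=> 1) => x z; rewrite mul1r].
Qed.

Theorem Finfty_sub_Hinfty : Finfty_on_H2 m a `<=` Hinfty m a.
Proof.
move=> S [T /Finfty_mult[_ [psi Tpsi]] ST]; exists psi.
  move=> f /(H2_U areg m1)[x <-].
  have -> : (fun z => psi z * U x z) = U (T x) by apply/funext => z; rewrite Tpsi.
  exact: U_H2.
move=> f z; have [x fx] := H2_U areg m1 (set_mem (valP f)).
by rewrite (ST x f (esym fx)) Tpsi fx.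
Qed.

End Shifts.

(** * Truncations and boundedness of multipliers *)

Section Truncation.
Context {R : realType} {k : nat} {n : 'I_k -> nat}.
Variables (m : 'I_k -> nat) (a : forall i, seq 'I_(n i) -> R).
Arguments a : clear implicits.
Hypotheses (areg : forall i, positive_regular (a i)) (m1 : forall i, (1 <= m i)%N).
Local Notation C := R[i].
Local Notation mindex := {dffun forall i : 'I_k, {ffun 'I_(n i) -> nat}}.
Local Notation NQ := (NQ m a).
Local Notation Gam := (Gam m a).
Local Notation nn x := (l2norm (\val x)).
Implicit Types (q : mindex) (d : mindex -> C) (x y g : NQ) (E F : pred nat).

Let a0 i w : 0 <= a i w. Proof. by have [] := areg i. Qed.
Let anil i : a i [::] = 0. Proof. by have [] := areg i. Qed.
Let agen i j : 0 < a i [:: j]. Proof. by have [] := areg i. Qed.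
Let Gam_gt0 q : 0 < Gam q. Proof. exact: Gam_gt0. Qed.
Let finP d : finnorm m a d <-> rsummable (fun q => sqmod (d q) / Gam q).
Proof. exact: finnormP. Qed.
Let fin_n x : rsummable (fun q => sqmod (ncoef x q) / Gam q).
Proof. exact: (finP _).1 (fin_coef a0 anil agen m1 x). Qed.
Let nnE x : nn x ^+ 2 = rsum (fun q => sqmod (ncoef x q) / Gam q).
Proof. exact: norm_rsum. Qed.
Let dG0 (c : C) q : 0 <= sqmod c / Gam q.
Proof. by rewrite divr_ge0 ?sqmod_ge0// ltW. Qed.

Definition trunc E x : NQ := ofcoef m a (fun q => if E (deg q) then ncoef x q else 0).

Lemma ncoef_trunc E x q : ncoef (trunc E x) q = if E (deg q) then ncoef x q else 0.
Proof.
rewrite ofcoefK//; apply/(finP _).2/(rsummable_le (fin_n x)) => p.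
rewrite ger0_norm//; case: ifP => // _.
by rewrite sqmodE modc0 expr0n mul0r.
Qed.

Lemma ncoef_ext x y : (forall q, ncoef x q = ncoef y q) -> x = y.
Proof. by move=> xy; apply: (ncoef_inj a0 anil agen m1); apply/funext. Qed.

Lemma nn_le x y : (forall q, modc (ncoef x q) <= modc (ncoef y q)) -> nn x <= nn y.
Proof.
move=> xy; rewrite -(@ler_pXn2r _ 2)// ?nnegrE ?l2norm_ge0// !nnE.
apply: le_rsum => // q; rewrite ler_wpM2r ?invr_ge0 ?(ltW (Gam_gt0 _))//.
by rewrite !sqmodE; apply: lerXn2r; rewrite ?nnegrE ?modc_ge0.
Qed.

Lemma nn_trunc E x : nn (trunc E x) <= nn x.
Proof.
by apply: nn_le => q; rewrite ncoef_trunc; case: ifP => // _; rewrite modc0 modc_ge0.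
Qed.

Lemma nn_coef x q : modc (ncoef x q) <= Num.sqrt (Gam q) * nn x.
Proof.
rewrite -(@ler_pXn2r _ 2)// ?nnegrE ?mulr_ge0 ?modc_ge0 ?sqrtr_ge0 ?l2norm_ge0//.
rewrite exprMn -sqmodE (sqr_sqrtr (ltW (Gam_gt0 q))) mulrC -ler_pdivrMr//.
rewrite -lee_fin (norm_coef a0 anil agen m1 x) h2norm2E.
by have := @esum_ge_seq _ _ (fun q => sqmod (ncoef x q) / Gam q) [:: q] isT; rewrite big_seq1.
Qed.

Lemma dot_trunc E x y : dot (\val (trunc E x)) (\val y) = dot (\val x) (\val (trunc E y)).
Proof.
rewrite !(dot_coef a0 anil agen m1); congr csum; apply/funext => q.
rewrite !ncoef_trunc; case: ifP => // _; first by rewrite rmorph0 mulr0 !mul0r.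
Qed.

Lemma trunc_idem E x : trunc E (trunc E x) = trunc E x.
Proof. by apply: ncoef_ext => q; rewrite !ncoef_trunc; case: (E _). Qed.

Lemma nn_split E x : nn x ^+ 2 = nn (trunc E x) ^+ 2 + nn (x - trunc E x) ^+ 2.
Proof.
rewrite !nnE -rsumD; [|exact: fin_n..]; congr rsum; apply/funext => q.
rewrite ncoefB ncoef_trunc; case: ifP => _; rewrite ?subrr ?subr0 -mulrDl; congr (_ / _).
  by rewrite [X in _ + X]sqmodE modc0 expr0n addr0.
by rewrite [X in X + _]sqmodE modc0 expr0n add0r.
Qed.

(** A finite part of the sum that gives the squared norm of [x] involves
    bounded degrees only, and the truncation is orthogonal to the remainder. *)
Lemma trunc_approx x (e : R) : 0 < e ->
  exists N, forall N', (N <= N')%N -> nn (x - trunc (fun l => (l <= N')%N) x) < e.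
Proof.
move=> e0; have [s us hs] : exists2 s : seq mindex, uniq s &
    nn x ^+ 2 - e ^+ 2 < \sum_(q <- s) sqmod (ncoef x q) / Gam q.
  apply: contrapT => h.
  have : (\esum_(q in [set: mindex]) (sqmod (ncoef x q) / Gam q)%:E <= (nn x ^+ 2 - e ^+ 2)%:E)%E.
    by apply: esum_le_seq => s us; rewrite leNgt; apply/negP => hs; apply: h; exists s.
  rewrite -h2norm2E -(norm_coef a0 anil agen m1 x) lee_fin.
  by rewrite lerDl oppr_ge0 leNgt exprn_gt0.
exists (\max_(q <- s) deg q)%N => N' sN.
rewrite -(@ltr_pXn2r _ 2)// ?nnegrE ?l2norm_ge0 ?(ltW e0)//.
rewrite -(ltrD2l (nn (trunc (fun l => (l <= N')%N) x) ^+ 2)) -nn_split.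
rewrite -ltrBlDr; apply: lt_le_trans hs _.
rewrite -lee_fin (norm_coef a0 anil agen m1) h2norm2E.
apply: le_trans (esum_ge_seq _ us); rewrite lee_fin big_seq [leRHS]big_seq.
apply: ler_sum => q qs; rewrite ncoef_trunc ifT//.
by apply: leq_trans sN; exact: leq_bigmax_seq.
Qed.

Lemma low_mindices N : exists2 s : seq mindex, uniq s & forall q, (deg q <= N)%N = (q \in s).
Proof.
pose T := {dffun forall i : 'I_k, {ffun 'I_(n i) -> 'I_N.+1}}.
pose f (t : T) : mindex := [ffun i => [ffun j => val (t i j)]].
exists [seq q <- undup [seq f t | t : T] | (deg q <= N)%N].
  exact/filter_uniq/undup_uniq.
move=> q; rewrite mem_filter; case qN : (_ <= _)%N => //=; rewrite mem_undup.
apply/esym/mapP; exists [ffun i => [ffun j => inord (q i j)]]; first by rewrite mem_enum.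
apply/ffunP => i; apply/ffunP => j; rewrite !ffunE /= inordK// ltnS.
by apply: leq_trans qN; rewrite /deg (bigD1 i)//= (bigD1 j)//= -addnA leq_addr.
Qed.

Lemma trunc_sum N (s : seq mindex) x : uniq s -> (forall q, (deg q <= N)%N = (q \in s)) ->
  trunc (fun l => (l <= N)%N) x = \sum_(q <- s) ncoef x q *: monom m a q.
Proof.
move=> us sN; apply: ncoef_ext => p; rewrite ncoef_trunc ncoef_sum sN.
under eq_bigr do rewrite ncoefZ (ncoef_monom areg m1).
case: ifPn => ps.
  rewrite (big_rem p)//= eqxx mulr1 big_seq big1 ?addr0// => q.
  case: eqP => [<-|_ _]; last by rewrite mulr0.
  by rewrite mem_rem_uniqF.
rewrite big_seq big1// => q; case: eqP => [<-|_ _]; last by rewrite mulr0.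
by rewrite (negbTE ps).
Qed.

Lemma valNQ_sum (X : Type) (s : seq X) (P : pred X) (f : X -> NQ) :
  \val (\sum_(u <- s | P u) f u) = \sum_(u <- s | P u) \val (f u).
Proof. by elim/big_rec2: _ => [//|u v w _ <-]. Qed.

Section Multiplier.
Variables (T : NQ -> NQ) (psi : D a -> C).
Hypothesis Tpsi : forall x z, U (T x) z = psi z * U x z.

Let T1psi x z : U (T x) z = U (T (vacuum m a)) z * U x z.
Proof. by rewrite !Tpsi (U_vacuum areg m1) mulr1. Qed.

(** Multiplication by [psi] is linear and [U] is injective. *)
Lemma mult_linear : linear T.
Proof.
move=> c x y; apply: (U_inj areg m1); apply/funext => z.
by rewrite (U_linear areg m1) !Tpsi (U_linear areg m1); ring.
Qed.

Let T0 : T 0 = 0.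
Proof. by have := mult_linear (-1) 0 0; rewrite scaleN1r oppr0 addr0 scaleN1r addNr. Qed.

Let TD x y : T (x + y) = T x + T y.
Proof. by have := mult_linear 1 x y; rewrite !scale1r. Qed.

Let TZ c x : T (c *: x) = c *: T x.
Proof. by rewrite -[c *: x]addr0 mult_linear T0 addr0. Qed.

Let TB x y : T (x - y) = T x - T y.
Proof. by rewrite TD -scaleN1r TZ scaleN1r. Qed.

Let Tsum (X : Type) (s : seq X) (f : X -> NQ) : T (\sum_(u <- s) f u) = \sum_(u <- s) T (f u).
Proof. by elim/big_rec2: _ => [//|u v w _ <-]; rewrite TD. Qed.

Local Notation low N := (trunc (fun l => (l <= N)%N)).

(** As [U (T x) = psi * U x] and [psi] is itself a power series, [T x]
    starts in no lower degree than [x]. *)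
Lemma mult_low N x : (forall q, (deg q <= N)%N -> ncoef x q = 0) -> low N (T x) = 0.
Proof.
move=> x0; apply: ncoef_ext => q; rewrite ncoef_trunc ncoef0; case: ifP => // qN.
exact: (low_order areg m1 (T1psi x) x0).
Qed.

(** The truncation has finite dimensional range. *)
Lemma mult_low_bounded N : exists2 c : R, 0 <= c & forall x, nn (T (low N x)) <= c * nn x.
Proof.
have [s us sN] := low_mindices N.
exists (\sum_(q <- s) Num.sqrt (Gam q) * nn (T (monom m a q))).
  by apply: sumr_ge0 => q _; rewrite mulr_ge0 ?sqrtr_ge0 ?l2norm_ge0.
move=> x; rewrite (trunc_sum _ us sN) Tsum valNQ_sum.
apply: le_trans (l2norm_sum _ _ _) _; rewrite big_distrl; apply: ler_sum => q _ /=.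
rewrite TZ; apply: le_trans (_ : modc (ncoef x q) * nn (T (monom m a q)) <= _).
  by rewrite -l2normZ.
by rewrite mulrAC ler_wpM2r ?l2norm_ge0// nn_coef.
Qed.

Hypothesis unbounded : forall K : R, 0 <= K -> exists x, K * nn x < nn (T x).

(** On vectors that start beyond degree [N], [T] is still unbounded, because
    it is bounded on those of degree at most [N]. A small such vector is
    added to [X] so that the image becomes large; then [N'] is chosen so
    that this is visible in the degrees up to [N']. *)
Lemma hump (X : NQ) (N l : nat) : exists Y N',
  [/\ (N < N')%N, forall q, (deg q <= N)%N -> ncoef Y q = ncoef X q,
      nn (Y - X) <= 2^-1 ^+ l.+1 & l%:R <= nn (low N' (T Y))].
Proof.
have [c c0 cP] := mult_low_bounded N.
pose r : R := 2^-1 ^+ l.+1; have r0 : 0 < r by rewrite exprn_gt0// invr_gt0.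
(* [T] of [x - low N x] has norm at least [(l + 1 + nn (T X)) / r * nn x], since
   [c * nn x] bounds the norm of [T (low N x)]. After scaling to norm [r] the
   image still outweighs [T X] by [l + 1], of which [1] is lost by passing to
   finitely many degrees. *)
have [|x xK] := unbounded (K := (l%:R + 1 + nn (T X)) / r + c).
  by rewrite addr_ge0// divr_ge0 ?(ltW r0)// !addr_ge0 ?l2norm_ge0.
have x0 : 0 < nn x.
  rewrite lt_def l2norm_ge0 andbT; apply/eqP => x0.
  have e : x = 0 by apply/val_inj/l2norm0_eq0.
  by move: xK; rewrite e T0 l2norm0 mulr0 ltxx.
pose y := (r / nn x)%:C *: (x - low N x).
have rx : 0 < r / nn x by rewrite divr_gt0.
have nZ (u : NQ) : nn ((r / nn x)%:C *: u) = r / nn x * nn u.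
  by rewrite -[\val _]/((r / nn x)%:C *: \val u) l2normZ modcR gtr0_norm.
have ny : nn y <= r.
  rewrite nZ mulrAC ler_pdivrMr// ler_wpM2l ?(ltW r0)//.
  apply: nn_le => q; rewrite ncoefB ncoef_trunc; case: ifP => _; rewrite ?subr0//.
  by rewrite subrr modc0 modc_ge0.
have nTy : l%:R + 1 + nn (T X) <= nn (T y).
  rewrite /y TZ nZ TB -ler_pdivrMl// invf_div mulrC.
  have h : nn (T x) <= nn (T x - T (low N x)) + nn (T (low N x)).
    by rewrite -{1}[T x](subrK (T (low N x))); exact: l2normD.
  have := cP x; move: xK h; rewrite mulrDl -mulrA [r^-1 * _]mulrC => h1 h2 h3.
  by rewrite -(lerD2r (c * nn x)); apply: ltW; apply: lt_le_trans h1 (le_trans h2 _); rewrite lerD2l.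
pose Y := X + y.
have nTY : l%:R + 1 <= nn (T Y).
  rewrite -(lerD2r (nn (T X))); apply: le_trans nTy _.
  have -> : T y = T Y - T X by rewrite /Y TD [T X + _]addrC addrK.
  exact: l2normB.
have [N0 N0P] := trunc_approx (T Y) ltr01.
exists Y, (maxn N0 N.+1); split.
- by rewrite leq_max ltnSn orbT.
- move=> q qN; rewrite /Y ncoefD ncoefZ ncoefB ncoef_trunc qN subrr mulr0 addr0//.
- by rewrite /Y addrC addKr.
have := N0P (maxn N0 N.+1) (leq_maxl _ _) => h.
have h2 : nn (T Y) <= nn (low (maxn N0 N.+1) (T Y)) + nn (T Y - low (maxn N0 N.+1) (T Y)).
  by rewrite -{1}[T Y](subrK (low (maxn N0 N.+1) (T Y))) addrC; exact: l2normD.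
by rewrite -(lerD2r 1); apply: le_trans nTY (le_trans h2 _); rewrite lerD2l ltW.
Qed.

(** The gliding hump: vectors of norm at most [2 ^- l.+1], each supported
    beyond the degrees that matter for the previous ones, add up to a vector
    whose image would have infinite norm, because low degrees of the image
    depend only on low degrees. *)
Lemma unbounded_absurd : False.
Proof.
pose st := (NQ * nat)%type.
have /choice[step stepP] : forall sl : st * nat, exists s' : st,
    [/\ (sl.1.2 < s'.2)%N, forall q, (deg q <= sl.1.2)%N -> ncoef s'.1 q = ncoef sl.1.1 q,
        nn (s'.1 - sl.1.1) <= 2^-1 ^+ sl.2.+1 & sl.2%:R <= nn (low s'.2 (T s'.1))].
  by move=> [[X N] l]; have [Y [N' H]] := hump X N l; exists (Y, N').
pose fix s (l : nat) : st := if l is l'.+1 then step (s l', l') else (0, 0%N).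
have sS l : [/\ ((s l).2 < (s l.+1).2)%N,
    forall q, (deg q <= (s l).2)%N -> ncoef (s l.+1).1 q = ncoef (s l).1 q,
    nn ((s l.+1).1 - (s l).1) <= 2^-1 ^+ l.+1 & l%:R <= nn (low (s l.+1).2 (T (s l.+1).1))].
  exact: (stepP (s l, l)).
have sl l : (l <= (s l).2)%N.
  by elim: l => // l IH; have [h _ _ _] := sS l; exact: leq_ltn_trans h.
have s_mono l l' : (l <= l')%N -> ((s l).2 <= (s l').2)%N.
  by move/subnK <-; elim: (l' - l)%N => // p IH; have [h _ _ _] := sS (p + l)%N; rewrite addSn (leq_trans IH)// ltnW.
have s_coef l l' q : (l <= l')%N -> (deg q <= (s l).2)%N -> ncoef (s l').1 q = ncoef (s l).1 q.
  move=> ll' ql; move/subnK: ll' => <-; elim: (l' - l)%N => // p IH.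
  by have [_ h _ _] := sS (p + l)%N; rewrite addSn h// (leq_trans ql)// s_mono// leq_addl.
have s_norm l : nn (s l).1 <= 1 - 2^-1 ^+ l.
  elim: l => [|l IH]; first by rewrite expr0 subrr l2norm0.
  have [_ _ h _] := sS l; rewrite -[(s l.+1).1](subrK (s l).1).
  apply: le_trans (l2normD _ _) _; apply: le_trans (lerD h IH) _.
  by rewrite exprS; lra.
(* The coefficients of degree at most [(s l).2] no longer change after stage
   [l], and [deg q <= (s (deg q)).2]; so [d] is the limit of the stages. *)
pose d q := ncoef (s (deg q)).1 q.
have fd : finnorm m a d.
  rewrite /finnorm h2norm2E; apply: (@le_lt_trans _ _ 1%:E); last exact: ltry.
  apply: esum_le_seq => t ut; pose l := (\max_(q <- t) deg q)%N.
  apply: (@le_trans _ _ (nn (s l).1 ^+ 2)).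
    rewrite -lee_fin (norm_coef a0 anil agen m1) h2norm2E.
    apply: le_trans (esum_ge_seq _ ut); rewrite lee_fin big_seq [leRHS]big_seq.
    apply: ler_sum => q qt; rewrite /d (s_coef (deg q) l)//.
    exact: leq_bigmax_seq.
  rewrite expr_le1 ?l2norm_ge0//; apply: le_trans (s_norm l) _.
  by rewrite gerDl oppr_le0 exprn_ge0.
pose x := ofcoef m a d.
have xs l q : (deg q <= (s l).2)%N -> ncoef x q = ncoef (s l).1 q.
  move=> ql; rewrite ofcoefK// /d -(s_coef _ (maxn l (deg q)))//; last exact: leq_maxr.
  by rewrite (s_coef l)// leq_maxl.
have big l : l%:R <= nn (T x).
  have [_ _ _ h] := sS l; apply: le_trans h _.
  suff -> : low (s l.+1).2 (T (s l.+1).1) = low (s l.+1).2 (T x) by exact: nn_trunc.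
  have : low (s l.+1).2 (T (x - (s l.+1).1)) = 0.
    by apply: mult_low => q ql; rewrite ncoefB (xs l.+1)// subrr.
  rewrite TB => h; apply: ncoef_ext => q; rewrite !ncoef_trunc; case: ifP => // ql.
  have := congr1 (fun y => ncoef y q) h; rewrite ncoef_trunc ql ncoef0 ncoefB => /eqP.
  by rewrite subr_eq0 => /eqP.
have := big (Num.trunc (nn (T x))).+1; rewrite leNgt => /negP; apply.
by rewrite truncnS_gt.
Qed.

End Multiplier.

Lemma mult_bounded (T : NQ -> NQ) (psi : D a -> C) :
  (forall x z, U (T x) z = psi z * U x z) -> bounded_op T.
Proof.
move=> Tpsi; split; first exact: mult_linear Tpsi.
apply: contrapT => /forallNP h; apply: (unbounded_absurd Tpsi) => K _.
have /existsNP[x /negP] := h K; rewrite -ltNge => xK.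
by exists x.
Qed.

End Truncation.

(** * Fejer means *)

(** The number of integers [s] with [a <= s < b], as far as [s < M]. *)
Lemma count_interval a b M :
  (\sum_(s < M) ((a <= s) && (s < b))%N = minn b M - a)%N.
Proof.
elim: M => [|M IH]; first by rewrite big_ord0 minn0.
by rewrite big_ord_recr/= IH; lia.
Qed.

Lemma sum_diagonal N i j : (j <= i)%N ->
  (\sum_(d < N) (N - d) * (i == d + j) = N - (i - j))%N.
Proof.
move=> ji; suff H M : (M <= N)%N -> (\sum_(d < M) (N - d) * (i == d + j) =
    (i - j < M) * (N - (i - j)))%N.
  by rewrite H//; case: ltnP => h; rewrite ?mul1n// mul0n; apply/esym/eqP; rewrite subn_eq0.
elim: M => [|M IH] MN; first by rewrite big_ord0.
rewrite big_ord_recr/= (IH (ltnW MN)) ltnS; case: eqP => e.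
  have -> : (i - j = M)%N by lia.
  by rewrite ltnn leqnn mul0n mul1n muln1.
have e' : (i - j == M)%N = false by apply/eqP; lia.
by rewrite muln0 addn0 [in RHS]leq_eqVlt e'.
Qed.

Lemma half_sum_squares (R : realFieldType) (M u v : R) :
  M * u * v <= 2^-1 * (M ^+ 2 * u ^+ 2 + v ^+ 2).
Proof.
rewrite -subr_ge0.
have -> : 2^-1 * (M ^+ 2 * u ^+ 2 + v ^+ 2) - M * u * v = 2^-1 * (M * u - v) ^+ 2 by field.
by rewrite mulr_ge0 ?sqr_ge0// invr_ge0.
Qed.

Section Fejer.
Context {R : realType} {k : nat} {n : 'I_k -> nat}.
Variables (m : 'I_k -> nat) (a : forall i, seq 'I_(n i) -> R).
Arguments a : clear implicits.
Hypotheses (areg : forall i, positive_regular (a i)) (m1 : forall i, (1 <= m i)%N).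
Local Notation C := R[i].
Local Notation mindex := {dffun forall i : 'I_k, {ffun 'I_(n i) -> nat}}.
Local Notation NQ := (NQ m a).
Local Notation Gam := (Gam m a).
Local Notation nn x := (l2norm (\val x)).
Local Notation trunc := (trunc (m := m) (a := a)).
Local Notation low N := (trunc (fun l => (l <= N)%N)).
Local Notation monom := (monom m a).
Local Notation vacuum := (vacuum m a).
Implicit Types (p q : mindex) (d : nat) (x y g : NQ) (E F : pred nat).

Let a0 i w : 0 <= a i w. Proof. by have [] := areg i. Qed.
Let anil i : a i [::] = 0. Proof. by have [] := areg i. Qed.
Let agen i j : 0 < a i [:: j]. Proof. by have [] := areg i. Qed.
Let tE := ncoef_trunc areg m1.
Let ext := ncoef_ext areg m1.

Lemma trunc_ext E F x : (forall l, E l = F l) -> trunc E x = trunc F x.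
Proof. by move=> EF; apply: ext => q; rewrite !tE EF. Qed.

Lemma trunc_none E x : (forall l, E l = false) -> trunc E x = 0.
Proof. by move=> E0; apply: ext => q; rewrite tE E0 ncoef0. Qed.

Lemma trunc_trunc E F x : trunc E (trunc F x) = trunc (fun l => E l && F l) x.
Proof. by apply: ext => q; rewrite !tE; case: (E _). Qed.

Lemma nnZ c x : nn (c *: x) = modc c * nn x.
Proof. exact: l2normZ. Qed.

Lemma trunc_lin E c x y : trunc E (c *: x + y) = c *: trunc E x + trunc E y.
Proof.
apply: ext => q; rewrite tE !ncoefD !ncoefZ !tE; case: ifP => // _.
by rewrite mulr0 addr0.
Qed.

Lemma trunc_monom E p : trunc E (monom p) = (E (deg p))%:R *: monom p.
Proof.
apply: ext => q; rewrite tE ncoefZ !(ncoef_monom areg m1).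
by case: eqP => [->|_]; [rewrite mulr1; case: ifP|rewrite mulr0; case: ifP].
Qed.

Lemma ncoef_deg x q : ncoef x q = ncoef (trunc (pred1 (deg q)) x) q.
Proof. by rewrite tE /= eqxx. Qed.

(** A window of [N] consecutive degrees, by its last degree [s]. Each degree
    belongs to [N] windows. *)
Definition window N s : pred nat := fun l => (l <= s)%N && (s < l + N)%N.

(** Each coefficient is counted at most [N] times. *)
Lemma window_norms N M x :
  \sum_(s < M) nn (trunc (window N s) x) ^+ 2 <= N%:R * nn x ^+ 2.
Proof.
have sx y := (finnormP a0 anil agen m1 _).1 (fin_coef a0 anil agen m1 y).
under eq_bigr do rewrite (norm_rsum a0 anil agen m1).
rewrite (norm_rsum a0 anil agen m1) -rsum_sum// -rsumZ//.
apply: le_rsum => [| |q]; [exact: rsummable_sum|exact: rsummableZ|].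
have G0 : 0 < Gam q by exact: Gam_gt0.
rewrite (eq_bigr (fun s : 'I_M => (window N s (deg q))%:R * (sqmod (ncoef x q) / Gam q))) => [|s _].
  rewrite -big_distrl ler_wpM2r ?divr_ge0 ?sqmod_ge0 ?(ltW G0)//.
  rewrite -natr_sum ler_nat /window count_interval.
  by rewrite leq_subLR geq_minl.
rewrite tE; case: ifP => _; rewrite ?mul1r// mul0r.
by rewrite sqmodE modc0 expr0n mul0r.
Qed.

Variable B : set (NQ -> NQ).
Hypotheses (Balg : wot_subalgebra B) (BL : forall i (j : 'I_(n i)), B (L m a j)) (Bid : B id).

(** Multiplication by a homogeneous polynomial of degree [d], as an operator
    of the algebra: degrees are raised by exactly [d]. *)
Definition homog d (A : NQ -> NQ) : Prop := [/\ B A,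
  exists p : D a -> C, forall x z, U (A x) z = p z * U x z &
  forall E x, trunc E (A x) = A (trunc (fun l => E (d + l)%N) x)].

Lemma homog_linear d A : homog d A -> linear A.
Proof. by move=> [_ [p Ap] _]; exact: (mult_linear areg m1 Ap). Qed.

Lemma homog0 d : homog d 0.
Proof.
have [_ [B0 _] _ _] := Balg; split=> //; first by exists (fun=> 0) => x z; rewrite U_0// mul0r.
by move=> E x; apply: ext => q; rewrite tE ncoef0 if_same.
Qed.

Lemma homog_lin d c A A' : homog d A -> homog d A' -> homog d (c *: A + A').
Proof.
have [_ [_ BD] _ _] := Balg.
move=> [BA [p Ap] tA] [BA' [p' Ap'] tA']; split; first exact: BD.
  exists (fun z => c * p z + p' z) => x z.
  by rewrite -[(c *: A + A') x]/(c *: A x + A' x) (U_linear areg m1) Ap Ap'; ring.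
move=> E x; rewrite -[(c *: A + A') x]/(c *: A x + A' x) trunc_lin tA tA'.
by [].
Qed.

Lemma homog_L d i (j : 'I_(n i)) A : homog d A -> homog d.+1 (L m a j \o A).
Proof.
have [_ _ Bcomp _] := Balg.
move=> [BA [p Ap] tA]; split; first exact: Bcomp.
  by exists (fun z => \val z i j * p z) => x z /=; rewrite (U_L areg m1) Ap mulrA.
move=> E x /=; have tL F y : trunc F (L m a j y) = L m a j (trunc (fun l => F l.+1) y).
  apply: ext => q; rewrite tE !(ncoef_L areg m1).
  have [[q' ->]|nq] := pselect (exists q', q = inc j q').
    by rewrite !shift_inc tE deg_inc.
  have nq' q' : q <> inc j q' by move=> e; apply: nq; exists q'.
  by rewrite !shift_out// if_same.
by rewrite tL tA.
Qed.

(** A product of [deg q] operators [L j]. *)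
Lemma homog_monom q : exists2 A, homog (deg q) A & A vacuum = monom q.
Proof.
suff H d p : deg p = d -> exists2 A, homog d A & A vacuum = monom p by exact: H.
elim: d p => [|d IH] p dp.
  exists id; last by rewrite (deg0 dp).
  split=> [//||E x]; last exact: trunc_ext.
  by exists (fun=> 1) => x z; rewrite mul1r.
have [|i [j [p' pp']]] := @inc_pred _ _ p; first by rewrite dp.
move: dp; rewrite pp' deg_inc => -[dp']; have [A hA Av] := IH p' dp'.
exists (L m a j \o A); first exact: homog_L.
by rewrite /= Av (L_monom areg m1).
Qed.

(** A homogeneous component has finitely many coefficients, hence is a
    combination of monomials. *)
Lemma homog_component d g : exists2 A, homog d A & A vacuum = trunc (pred1 d) g.
Proof.
have [s us sd] := @low_mindices k n d.
have -> : trunc (pred1 d) g = low d (trunc (pred1 d) g).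
  by rewrite trunc_trunc; apply: trunc_ext => l /=; case: eqP => [->|]; rewrite ?leqnn ?andbF.
rewrite (trunc_sum areg m1 _ us sd).
elim: s {us sd} => [|q s [A hA As]]; first by exists 0; [exact: homog0|rewrite big_nil].
rewrite big_cons tE; case: ifPn => [/eqP qd|_]; last first.
  by exists A => //; rewrite scale0r add0r.
have [A' hA' A'v] := homog_monom q; rewrite qd in hA'.
exists (ncoef g q *: A' + A); first exact: homog_lin.
by rewrite -[(_ *: A' + A) _]/(ncoef g q *: A' vacuum + A vacuum) A'v As.
Qed.

Variables (T : NQ -> NQ) (psi : D a -> C).
Hypothesis Tpsi : forall x z, U (T x) z = psi z * U x z.
Local Notation g := (T vacuum).

Variable A : nat -> NQ -> NQ.
Hypotheses (hA : forall d, homog d (A d)) (Ag : forall d, A d vacuum = trunc (pred1 d) g).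

Lemma homog_comm S d S' : (exists p : D a -> C, forall x z, U (S x) z = p z * U x z) ->
  homog d S' -> forall x, S (S' x) = S' (S x).
Proof.
move=> [p Sp] [_ [p' Sp'] _] x; apply: (U_inj areg m1); apply/funext => z.
by rewrite Sp Sp' Sp' Sp mulrCA.
Qed.

(** [A d] is the homogeneous component of degree [d] of [T]: a monomial is
    the image of the vacuum vector under an operator [A'] that commutes with
    both and raises degrees by [deg p], and on the vacuum vector the two
    agree in degree [d]. *)
Lemma component_monom d p q :
  ncoef (A d (monom p)) q = ncoef (T (monom p)) q *+ (deg q == d + deg p)%N.
Proof.
have [A' hA' A'v] := homog_monom p; have [_ _ tA'] := hA'.
have lA' := homog_linear hA'.
have A'0 : A' 0 = 0 by have := lA' (-1) 0 0; rewrite scaleN1r oppr0 addr0 scaleN1r addNr.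
have [_ pA _] := hA d.
(* Both sides become coefficients of [A'] applied to a truncation of [T] of the
   vacuum vector: on the left to degree [d], on the right to the degree that
   [A'] raises to [deg q]. *)
rewrite -A'v (homog_comm pA hA') Ag (homog_comm (ex_intro _ psi Tpsi) hA').
rewrite ncoef_deg [in RHS]ncoef_deg !tA' trunc_trunc.
case: eqP => [e|ne]; last first.
  rewrite trunc_none ?A'0 ?ncoef0// => l /=.
  by case: eqP => //= e; case: eqP => // el; case: ne; rewrite -e el addnC.
rewrite mulr1n; congr (ncoef (A' _) _); apply: trunc_ext => l /=.
by rewrite e addnC eqn_add2r andbb.
Qed.

Lemma component_low p q : (deg q < deg p)%N -> ncoef (T (monom p)) q = 0.
Proof.
have [A' hA' A'v] := homog_monom p; have [_ _ tA'] := hA'.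
have lA' := homog_linear hA'.
have A'0 : A' 0 = 0 by have := lA' (-1) 0 0; rewrite scaleN1r oppr0 addr0 scaleN1r addNr.
move=> qp; rewrite -A'v (homog_comm (ex_intro _ psi Tpsi) hA') ncoef_deg tA'.
by rewrite trunc_none ?A'0 ?ncoef0// => l /=; apply/eqP; lia.
Qed.

Lemma lin_sum (S : NQ -> NQ) (s : seq mindex) (c : mindex -> C) : linear S ->
  S (\sum_(p <- s) c p *: monom p) = \sum_(p <- s) c p *: S (monom p).
Proof.
move=> lS; elim: s => [|p s IH]; last by rewrite !big_cons lS IH.
by rewrite !big_nil; have := lS (-1) 0 0; rewrite scaleN1r oppr0 addr0 scaleN1r addNr.
Qed.

(** The homogeneous components of [T] with the weights [1 - d / N] of a
    Fejer mean. *)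
Definition fejer N : NQ -> NQ := \sum_(d < N) ((N - d)%:R / N%:R : C) *: A d.

Lemma fun_sumE (I : Type) (s : seq I) (P : pred I) (F : I -> NQ -> NQ) x :
  (\sum_(u <- s | P u) F u) x = \sum_(u <- s | P u) F u x.
Proof. by elim/big_rec2: _ => [//|u y f _ <-]. Qed.

Lemma fejerE N x : fejer N x = \sum_(d < N) ((N - d)%:R / N%:R : C) *: A d x.
Proof. by rewrite /fejer fun_sumE. Qed.

Lemma fejer_B N : B (fejer N).
Proof.
have [_ [B0 BD] _ _] := Balg; rewrite /fejer; elim/big_rec: _ => // d S _ BS.
by apply: BD => //; have [] := hA d.
Qed.

Lemma fejer_linear N : linear (fejer N).
Proof. by have [bB _ _ _] := Balg; have [] := bB _ (fejer_B N). Qed.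

Lemma low_fejer N K x : low K (fejer N x) = low K (fejer N (low K x)).
Proof.
apply: ext => q; rewrite !tE; case: ifP => // qK; rewrite !fejerE !ncoef_sum.
apply: eq_bigr => d _; rewrite !ncoefZ; congr (_ * _).
have [_ _ tA] := hA d; rewrite ncoef_deg tA [in RHS]ncoef_deg tA trunc_trunc.
congr (ncoef (A d _) _); apply: trunc_ext => l /=.
by case: eqP => //= e; apply/esym; lia.
Qed.

(** Degrees [i] and [j] lie together in [N - |i - j|] windows, the weight of
    the Fejer mean up to the factor [N]. As all operators involved are
    linear and only low degrees matter, it is enough to compare coefficients
    on monomials. *)
Lemma fejer_windows N K x : (0 < N)%N -> N%:R *: low K (fejer N (low K x)) =
  low K (\sum_(s < K + N) trunc (window N s) (T (trunc (window N s) (low K x)))).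
Proof.
move=> N0; have [t ut tK] := @low_mindices k n K.
have lT := mult_linear areg m1 Tpsi.
apply: ext => q; rewrite ncoefZ !tE; case: ifP => qK; last by rewrite mulr0.
rewrite (trunc_sum areg m1 x ut tK) (lin_sum _ _ (fejer_linear N)) !ncoef_sum.
rewrite big_distrr; under [RHS]eq_bigr => s _.
  have lW : linear (fun y => T (trunc (window N s) y)).
    by move=> c y y'; rewrite trunc_lin lT.
  rewrite tE (lin_sum _ _ lW) ncoef_sum.
  over.
have -> : \sum_(s < K + N) (if window N s (deg q)
    then \sum_(p <- t) ncoef (ncoef x p *: T (trunc (window N s) (monom p))) q else 0) =
  \sum_(p <- t) \sum_(s < K + N) (ncoef x p * ncoef (T (monom p)) q) *+
     (window N s (deg p) && window N s (deg q)).
  rewrite exchange_big; apply: eq_bigr => s _ /=; case: ifP => sq; last first.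
    by rewrite big1// => p _; rewrite andbF.
  apply: eq_bigr => p _; rewrite trunc_monom andbT.
  have T0 : T 0 = 0 by have := lT (-1) 0 0; rewrite scaleN1r oppr0 addr0 scaleN1r addNr.
  by case: (window N s (deg p)); rewrite ncoefZ ?scale1r// scale0r T0 ncoef0 mulr0.
apply: eq_big_seq => p pt; have pK : (deg p <= K)%N by rewrite tK.
rewrite ncoefZ fejerE ncoef_sum.
have [pq|qp] := leqP (deg p) (deg q); last first.
  rewrite (component_low qp) [RHS]big1 => [|s _]; last by rewrite mulr0 mul0rn.
  rewrite big1 /= ?mulr0// => d _.
  by rewrite ncoefZ component_monom component_low// mul0rn mulr0.
set tau := ncoef (T (monom p)) q; have NC : N%:R != 0 :> C by rewrite pnatr_eq0 -lt0n.
have -> : \sum_(s < K + N) (ncoef x p * tau) *+ (window N s (deg p) && window N s (deg q)) =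
    (ncoef x p * tau) *+ (N - (deg q - deg p)).
  rewrite sumrMnr; congr (_ *+ _).
  transitivity (\sum_(s < K + N) ((deg q <= s) && (s < deg p + N)))%N; last by rewrite count_interval; lia.
  by apply: eq_bigr => s _; rewrite /window; congr nat_of_bool; lia.
rewrite /= mulrCA -mulrnAr; congr (_ * _); rewrite big_distrr/=.
rewrite (eq_bigr (fun d : 'I_N => tau *+ ((N - d) * (deg q == d + deg p))%N)) => [|d _].
  by rewrite sumrMnr sum_diagonal.
rewrite ncoefZ component_monom mulrA mulrCA divff// mulr1 mulr_natl -/tau.
by rewrite mulnC mulrnA.
Qed.

Lemma component_vanish d x q : (deg q < d)%N -> ncoef (A d x) q = 0.
Proof.
move=> qd; have [_ _ tA] := hA d; have lA := homog_linear (hA d).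
rewrite ncoef_deg tA trunc_none; last by move=> l /=; apply/eqP; lia.
by have := lA (-1) 0 0; rewrite scaleN1r oppr0 addr0 scaleN1r addNr => ->; rewrite ncoef0.
Qed.

(** [T] is the sum of its homogeneous components, and those of large degree
    do not reach low degrees. *)
Lemma component_sum K x q : (deg q <= K)%N ->
  ncoef (T x) q = \sum_(d < K.+1) ncoef (A d x) q.
Proof.
move=> qK; have [t ut tK] := @low_mindices k n K.
have lT := mult_linear areg m1 Tpsi.
have -> : ncoef (T x) q = ncoef (T (low K x)) q.
  have h := mult_low areg m1 Tpsi (N := K) (x := (-1) *: low K x + x).
  have {h} : low K (T ((-1) *: low K x + x)) = 0.
    by apply: h => p pK; rewrite ncoefD ncoefZ tE pK mulN1r addNr.
  move=> /(congr1 (fun y => ncoef y q)); rewrite tE qK lT ncoefD ncoefZ ncoef0 mulN1r.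
  by move=> /eqP; rewrite addrC subr_eq0 => /eqP.
have AE d : ncoef (A d x) q = ncoef (A d (low K x)) q.
  have [_ _ tA] := hA d; rewrite ncoef_deg [in RHS]ncoef_deg !tA trunc_trunc.
  congr (ncoef (A d _) _); apply: trunc_ext => l /=.
  by case: eqP => //= e; apply/esym; lia.
under [RHS]eq_bigr do rewrite AE.
rewrite (trunc_sum areg m1 x ut tK) (lin_sum _ _ lT) ncoef_sum.
under [RHS]eq_bigr do rewrite (lin_sum _ _ (homog_linear (hA _))) ncoef_sum.
rewrite exchange_big; apply: eq_bigr => p _ /=.
under [RHS]eq_bigr do rewrite ncoefZ component_monom.
rewrite ncoefZ -big_distrr/=; congr (_ * _).
have [pq|qp] := leqP (deg p) (deg q); last first.
  by rewrite component_low// big1// => d _; rewrite mul0rn.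
have dK : (deg q - deg p < K.+1)%N by rewrite ltnS; lia.
rewrite (bigD1 (Ordinal dK))//= subnK// eqxx mulr1n big1 ?addr0// => d dn.
case: eqP => // e; case/eqP: dn; apply/val_inj => /=; lia.
Qed.

(** In degrees at most [K] only the components [A d] with [d <= K]
    contribute, and their weights in the Fejer mean differ from [1] by [d /
    N]. *)
Lemma fejer_low N K x : (K < N)%N ->
  low K (T x - fejer N x) = low K (\sum_(d < K.+1) (d%:R / N%:R : C) *: A d x).
Proof.
move=> KN; have NC : N%:R != 0 :> C by rewrite pnatr_eq0; case: N KN.
apply: ext => q; rewrite !tE; case: ifP => // qK.
rewrite ncoefB (component_sum x qK) fejerE !ncoef_sum.
have -> : \sum_(d < N) ncoef (((N - d)%:R / N%:R : C) *: A d x) q =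
    \sum_(d < K.+1) ncoef (((N - d)%:R / N%:R : C) *: A d x) q.
  rewrite -!(big_mkord xpredT (fun d => ncoef (((N - d)%:R / N%:R : C) *: A d x) q)).
  rewrite (big_cat_nat (n := K.+1))//= [X in _ + X]big1_seq ?addr0// => d.
  rewrite mem_index_iota => /andP[_ /andP[Kd _]].
  by rewrite ncoefZ component_vanish ?mulr0// (leq_ltn_trans qK).
rewrite -sumrB; apply: eq_bigr => d _; rewrite !ncoefZ.
rewrite natrB; last by rewrite (leq_trans _ KN)// ltnW.
by field.
Qed.

Variable M : R.
Hypotheses (M0 : 0 <= M) (TM : forall x, nn (T x) <= M * nn x).

(** With [y] the truncated Fejer mean of [x], the scalar product of [y] with
    itself is the average over [s] of the scalar products of [T P_s x] and
    [P_s y], for [P_s] the truncation to a window. Each of these is at most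
    half the sum of [M ^ 2 |P_s x| ^ 2] and [|P_s y| ^ 2], and
    [window_norms] sums the two parts. *)
Lemma low_fejer_bound N K x : (0 < N)%N -> nn (low K (fejer N x)) <= M * nn x.
Proof.
move=> N0; set y := low K (fejer N x).
have NR : 0 < N%:R :> R by rewrite ltr0n.
have yE : (N%:R : C) * (nn y ^+ 2)%:C = \sum_(s < K + N)
    dot (\val (T (trunc (window N s) (low K x)))) (\val (trunc (window N s) y)).
  rewrite -dotxx -dotZl.
  have -> : (N%:R : C) *: \val y = \val ((N%:R : C) *: y) by [].
  rewrite {1}/y low_fejer fejer_windows// (dot_trunc areg m1) /y (trunc_idem areg m1) -/y.
  rewrite valNQ_sum dot_suml; apply: eq_bigr => s _.
  by rewrite (dot_trunc areg m1).
have h1 : N%:R * nn y ^+ 2 <= \sum_(s < K + N)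
    (2^-1 * (M ^+ 2 * nn (trunc (window N s) (low K x)) ^+ 2 + nn (trunc (window N s) y) ^+ 2)).
  have -> : N%:R * nn y ^+ 2 = modc ((N%:R : C) * (nn y ^+ 2)%:C).
    by rewrite modcM modcR (ger0_norm (sqr_ge0 _)) -(rmorph_nat (real_complex R)) modcR normr_nat.
  rewrite yE; apply: le_trans (modc_sum _ _ _) _; apply: ler_sum => s _.
  apply: le_trans (cauchy_schwarz _ _) _.
  apply: le_trans (ler_wpM2r (l2norm_ge0 _) (TM _)) _.
  exact: half_sum_squares.
have h2 : N%:R * nn y ^+ 2 <= 2^-1 * (M ^+ 2 * (N%:R * nn x ^+ 2) + N%:R * nn y ^+ 2).
  apply: le_trans h1 _; rewrite -big_distrr/= ler_wpM2l ?invr_ge0//.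
  rewrite big_split/= lerD ?window_norms// -big_distrr/= ler_wpM2l ?sqr_ge0//.
  apply: le_trans (window_norms _ _ _) _; rewrite ler_wpM2l//.
  by apply: lerXn2r; rewrite ?nnegrE ?l2norm_ge0// (nn_trunc areg m1).
(* The half of [nn y ^+ 2] on the right of [h2] is absorbed on the left. *)
rewrite -(@ler_pXn2r _ 2)// ?nnegrE ?mulr_ge0 ?l2norm_ge0// exprMn -(ler_pM2l NR).
move: h2; move: (nn y ^+ 2) (nn x ^+ 2) (M ^+ 2) => u v w; nra.
Qed.

Lemma fejer_bound N x : (0 < N)%N -> nn (fejer N x) <= M * nn x.
Proof.
move=> N0; apply/ler_addgt0Pr => e e0.
have [K /(_ K (leqnn _)) Kx] := trunc_approx areg m1 (fejer N x) e0.
rewrite -[fejer N x](subrK (low K (fejer N x))) addrC.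
apply: le_trans (l2normD _ _) _; apply: lerD; last exact: ltW.
exact: low_fejer_bound.
Qed.

(** In low degrees the error is a fixed vector divided by [N] ([fejer_low]);
    the high degrees of [y] are negligible, uniformly in [N], by
    [fejer_bound]. *)
Lemma fejer_cvg x y (e : R) : 0 < e -> exists N0, forall N, (N0 <= N)%N ->
  modc (dot (\val (T x - fejer N x)) (\val y)) < e.
Proof.
move=> e0; pose b := 2 * M * nn x + 1.
have b0 : 0 < b by rewrite ltr_pwDr// !mulr_ge0 ?l2norm_ge0.
have [|K /(_ K (leqnn _)) Ky] := trunc_approx areg m1 y (e := e / 2 / b).
  by rewrite !divr_gt0.
pose c := \sum_(d < K.+1) d%:R * nn (A d x).
have c0 : 0 <= c by apply: sumr_ge0 => d _; rewrite mulr_ge0 ?l2norm_ge0.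
pose r := c * nn y / (e / 2); have r0 : 0 <= r.
  by rewrite divr_ge0 ?mulr_ge0 ?l2norm_ge0// ltW// divr_gt0.
(* [r] makes the error [c / N] of the low degrees small against [nn y]. *)
exists (maxn K (Num.trunc r)).+1 => N; rewrite gtn_max => /andP[KN rN].
have NR : 0 < N%:R :> R by rewrite ltr0n (leq_ltn_trans _ KN).
have N0 : (0 < N)%N by rewrite -(ltr0n R).
have {}rN : r < N%:R.
  by apply: lt_le_trans (truncnS_gt _) _; rewrite ler_nat.
set v := T x - fejer N x.
have -> : dot (\val v) (\val y) = dot (\val (low K v)) (\val y) + dot (\val v) (\val (y - low K y)).
  rewrite (dot_trunc areg m1) -dotDr; congr dot.
  by have -> : \val (low K y) + \val (y - low K y) = \val (low K y + (y - low K y)) by []; rewrite addrC subrK.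
apply: le_lt_trans (modcD _ _) _; rewrite [e]splitr; apply: ltr_leD.
  apply: le_lt_trans (cauchy_schwarz _ _) _.
  have low_v : nn (low K v) <= c / N%:R.
    rewrite /v fejer_low//; apply: le_trans (nn_trunc areg m1 _ _) _.
    rewrite valNQ_sum; apply: le_trans (l2norm_sum _ _ _) _.
    rewrite /c big_distrl; apply: ler_sum => d _ /=.
    rewrite nnZ.
    have -> : (d%:R / N%:R : C) = (d%:R / N%:R)%:C by rewrite rmorphM fmorphV/= !rmorph_nat.
    by rewrite modcR ger0_norm ?divr_ge0// mulrAC.
  apply: le_lt_trans (ler_wpM2r (l2norm_ge0 _) low_v) _.
  have e2 : 0 < e / 2 by rewrite divr_gt0.
  rewrite mulrAC ltr_pdivrMr// -ltr_pdivrMl//; move: rN.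
  by rewrite /r mulrC.
apply: le_trans (cauchy_schwarz _ _) _.
have nv : nn v <= b.
  apply: le_trans (l2normB (\val (T x)) (\val (fejer N x))) _.
  have := TM x; have := fejer_bound x N0; rewrite /b; lra.
apply: le_trans (ler_pM (l2norm_ge0 _) (l2norm_ge0 _) nv (ltW Ky)) _.
by rewrite mulrC divfK// gt_eqF.
Qed.

Lemma mult_in_B : B T.
Proof.
have [_ _ _ Bclosed] := Balg; apply: Bclosed.
  by split; [exact: (mult_linear areg m1 Tpsi)|exists M].
move=> s e e0.
have /choice[N0 N0P] : forall p : NQ * NQ, exists N0, forall N, (N0 <= N)%N ->
  modc (dot (\val (T p.1 - fejer N p.1)) (\val p.2)) < e.
  by move=> p; exact: fejer_cvg.
exists (fejer (\max_(p <- s) N0 p)); first exact: fejer_B.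
move=> p ps; apply/modc_ltP; apply: N0P.
exact: leq_bigmax_seq.
Qed.

End Fejer.

Section Main.
Context {R : realType} {k : nat} {n : 'I_k -> nat}.
Variables (m : 'I_k -> nat) (a : forall i, seq 'I_(n i) -> R).
Arguments a : clear implicits.
Hypotheses (areg : forall i, positive_regular (a i)) (m1 : forall i, (1 <= m i)%N).
Local Notation NQ := (NQ m a).

(** The Fejer means of [T] belong to every algebra in question. *)
Lemma mult_Finfty (T : NQ -> NQ) (psi : D a -> R[i]) :
  (forall x z, U (T x) z = psi z * U x z) -> Finfty m a T.
Proof.
move=> Tpsi B [Balg gens].
have BL i (j : 'I_(n i)) : B (L m a j) by apply: gens; left; exists i, j.
have Bid : B id by apply: gens; right.
have [lT [M TM]] := mult_bounded areg m1 Tpsi.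
have /choice[A AP] : forall d, exists A, homog B d A /\ A (vacuum m a) = trunc (pred1 d) (T (vacuum m a)).
  by move=> d; have [A hA Av] := homog_component areg m1 Balg BL Bid d (T (vacuum m a)); exists A.
apply: (mult_in_B areg m1 Balg BL Bid Tpsi (fun d => (AP d).1) (fun d => (AP d).2) (M := `|M|)) => // x.
by apply: le_trans (TM x) _; rewrite ler_wpM2r ?l2norm_ge0// ler_norm.
Qed.

Lemma Hinfty_sub_Finfty : Hinfty m a `<=` Finfty_on_H2 m a.
Proof.
move=> S [psi psiM Spsi].
have /choice[T TP] : forall x : NQ, exists y : NQ, U y = (fun z => psi z * U x z).
  by move=> x; apply: (H2_U areg m1); exact/psiM/U_H2.
have Tpsi x z : U (T x) z = psi z * U x z by rewrite TP.
exists T; first exact: mult_Finfty Tpsi.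
by move=> x f fx; apply/funext => z; rewrite Spsi fx TP.
Qed.

End Main.

(** * The Hardy algebra *)

Theorem theorem3p6 (R : realType) (k : nat) (n m : 'I_k -> nat)
    (a : forall i : 'I_k, seq 'I_(n i) -> R)
    (k_ge1 : (1 <= k)%N)
    (n_ge1 : forall i, (1 <= n i)%N)
    (m_ge1 : forall i, (1 <= m i)%N)
    (a_regular : forall i, positive_regular (a i)) :
  U_unitary m a /\ Finfty_on_H2 m a = Hinfty m a.
Proof.
split; first exact: U_is_unitary.
by apply/seteqP; split; [exact: Finfty_sub_Hinfty|exact: Hinfty_sub_Finfty].
Qed.
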